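(* Let $m$ be a positive integer and $0<\alpha<m$. Then there exists a constant $c>0$ such that for every $f\in(\Lambda_\alpha)_+$ and for arbitrary contractions $T$ and $R$ on Hilbert space the following inequality holds: $$\left\|\sum_{k=0}^m(-1)^k\binom mk f\left(T+\frac km(R-T)\right)\right\|\le c\,\|f\|_{\Lambda_\alpha}\,\|T-R\|^\alpha .$$
   Context: Let $\mathbb T$ be the unit circle. For $\tau\in\mathbb T$ put $(\Delta_\tau f)(\zeta)=f(\tau\zeta)-f(\zeta)$, $\zeta\in\mathbb T$. For $\alpha>0$ let $n$ be the integer with $n-1\le\alpha<n$. The Hölder–Zygmund class $\Lambda_\alpha$ consists of the continuous functions $f$ on $\mathbb T$ such that $$\|f\|_{\Lambda_\alpha}=\sup_{\tau\ne1,\;\zeta\in\mathbb T}\frac{|(\Delta_\tau^nf)(\zeta)|}{|1-\tau|^\alpha}<\infty .$$ $(\Lambda_\alpha)_+$ is the set of $f\in\Lambda_\alpha$ whose Fourier coefficients satisfy $\hat f(n)=0$ for $n<0$; such functions extend to functions in the disk algebra $C_A$ (functions continuous on the closed unit disk and analytic in its interior). A contraction is an operator of norm at most $1$. For a contraction $T$ and $f\in C_A$, $f(T)$ is defined by the extension of the polynomial functional calculus to $C_A$ by means of von Neumann's inequality $\|f(T)\|\le\|f\|_{C_A}$. *)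

(* Defs.v *)
From Stdlib Require Import Reals ZArith Lia Lra ClassicalEpsilon.
From Coquelicot Require Import Coquelicot.

Open Scope R_scope.

(* [Rpower 0 a] is [1] in the standard library; here [0 ^ a = 0]. *)
Definition nnpow (x a : R) : R :=
  if Req_EM_T x 0 then 0 else Rpower x a.

Definition circle (z : C) : Prop := Cmod z = 1.

Definition closed_disk (z : C) : Prop := Cmod z <= 1.

(* Functions on the circle are represented by functions [f : C -> C] of which
   only the values on [circle] matter. *)

Definition Delta (tau : C) (f : C -> C) : C -> C :=
  fun zeta => (f (tau * zeta) - f zeta)%C.

Definition zygmund_order (alpha : R) : nat := Z.to_nat (up alpha).

Lemma zygmund_order_spec (alpha : R) :
  0 < alpha -> INR (zygmund_order alpha) - 1 <= alpha < INR (zygmund_order alpha).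
Proof.
intros Ha; unfold zygmund_order.
destruct (archimed alpha) as [H1 H2].
assert (H0 : (0 <= up alpha)%Z) by (apply le_IZR; lra).
rewrite INR_IZR_INZ, Z2Nat.id by exact H0; lra.
Qed.

Definition Zygmund_norm (alpha : R) (f : C -> C) : Rbar :=
  Lub_Rbar (fun r : R => exists tau zeta : C,
    circle tau /\ tau <> RtoC 1 /\ circle zeta /\
    r = Cmod (Nat.iter (zygmund_order alpha) (Delta tau) f zeta)
        / nnpow (Cmod (1 - tau)%C) alpha).

Definition Zygmund (alpha : R) (f : C -> C) : Prop :=
  continuous_on circle f /\ is_finite (Zygmund_norm alpha f).

Definition cis (t : R) : C := (cos t, sin t).

Definition fourier_coef (f : C -> C) (j : Z) : C :=
  (RtoC (/ (2 * PI)) *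
   RInt (V := C_R_CompleteNormedModule)
     (fun t : R => f (cis t) * cis (- (IZR j * t))) 0 (2 * PI))%C.

Definition Zygmund_plus (alpha : R) (f : C -> C) : Prop :=
  Zygmund alpha f /\ forall j : Z, (j < 0)%Z -> fourier_coef f j = RtoC 0.

Definition disk_algebra (F : C -> C) : Prop :=
  continuous_on closed_disk F /\
  forall z : C, Cmod z < 1 ->
    ex_derive (K := C_AbsRing) (V := C_NormedModule) F z.

(* The values of the extension are determined on [closed_disk] only. *)
Definition disk_extension (f : C -> C) : C -> C :=
  epsilon (inhabits (fun _ : C => RtoC 0))
    (fun F => disk_algebra F /\ forall zeta, circle zeta -> F zeta = f zeta).

(* Positive definiteness of [inner] follows from that of [norm]. *)
Record HilbertSpace := {
  hilbert_space :> CompleteNormedModule C_AbsRing;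
  inner : hilbert_space -> hilbert_space -> C;
  inner_plus_l : forall x y z,
    inner (plus x y) z = (inner x z + inner y z)%C;
  inner_scal_l : forall (a : C) x y,
    inner (scal a x) y = (a * inner x y)%C;
  inner_conj : forall x y, inner y x = Cconj (inner x y);
  inner_norm : forall x, inner x x = RtoC (norm x ^ 2)
}.

(* Equal to [p_infty] when [A] is unbounded on the unit ball. *)
Definition op_norm {H : HilbertSpace} (A : H -> H) : Rbar :=
  Lub_Rbar (fun r : R => exists x : H, norm x <= 1 /\ r = norm (A x)).

Definition contraction {H : HilbertSpace} (T : H -> H) : Prop :=
  is_linear T /\ Rbar_le (op_norm T) 1.

Definition op_minus {H : HilbertSpace} (A B : H -> H) : H -> H :=
  fun x => minus (A x) (B x).

Definition op_segment {H : HilbertSpace} (T Q : H -> H) (t : R) : H -> H :=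
  fun x => plus (T x) (scal (RtoC t) (minus (Q x) (T x))).

Record cpoly := { bound : nat; coef : nat -> C }.

Definition poly_eval (p : cpoly) (z : C) : C :=
  sum_n (fun k => coef p k * z ^ k)%C (bound p).

Definition poly_op {H : HilbertSpace} (p : cpoly) (T : H -> H) : H -> H :=
  fun x => sum_n (fun k => scal (coef p k) (Nat.iter k T x)) (bound p).

(* [A] is the operator norm limit of [p n (T)] for some polynomials [p n]
   converging to [F] in [C_A]; for a contraction [T], von Neumann's inequality
   makes [A] exist and be unique for every [F] in [C_A]. *)
Definition is_fcalc {H : HilbertSpace} (F : C -> C) (T A : H -> H) : Prop :=
  is_linear A /\
  exists p : nat -> cpoly,
    (forall eps : posreal, eventually (fun n => forall z, closed_disk z ->
       Cmod (poly_eval (p n) z - F z)%C <= eps)) /\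
    (forall eps : posreal, eventually (fun n =>
       Rbar_le (op_norm (op_minus (poly_op (p n) T) A)) eps)).

Definition fcalc {H : HilbertSpace} (F : C -> C) (T : H -> H) : H -> H :=
  epsilon (inhabits (fun _ : H => zero)) (is_fcalc F T).

Definition op_difference {H : HilbertSpace}
    (m : nat) (F : C -> C) (T Q : H -> H) : H -> H :=
  fun x => sum_n (fun k =>
    scal (RtoC ((-1) ^ k * Binomial.C m k))
         (fcalc F (op_segment T Q (INR k / INR m)) x)) m.

(* Main.v *)
(* Write [d = norm (T - Q)].  If [p] is a polynomial of degree [N] bounded by
   [M] on the circle, then [l |-> p (T + l (Q - T))] is a polynomial in [l]
   bounded by [(1 + |l| d) ^ N * M] in norm, by von Neumann's inequality and the
   growth of [p] outside the disk.  Cauchy's estimates on [|l| = 1 / (N d)] bound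
   its coefficients, and an [m]-th difference annihilates those of degree less
   than [m]: this gives a Bernstein inequality [C * (N d) ^ m * M] for operator
   differences.  A generalized Jackson kernel approximates [f] by polynomials of
   degree [O(2 ^ j)] within [C * 2 ^ (- j alpha)]; summing the Bernstein bounds
   of the dyadic blocks over [2 ^ j d <= 1], where [alpha < m] makes the sum
   geometric, and bounding the tail by von Neumann's inequality yields
   [C * d ^ alpha].  Fejer means reduce the general case to polynomials; they
   converge to the extension of [f] to the disk by the maximum principle, which
   follows from the mean value property at [0] (Goursat's theorem in logarithmic
   polar coordinates) and Moebius maps. *)
Require Import Defs.
From Stdlib Require Import Reals Lra Lia Arith ZArith ClassicalEpsilon FunctionalExtensionality.
From Coquelicot Require Import Coquelicot.
Open Scope R_scope.

(** * Sums, norms and roots of unity *)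

(** Polynomial estimates are made with finite sums over roots of unity: when the nodes outnumber the
    frequencies, discrete orthogonality is exact, and it serves von Neumann's inequality, Cauchy's
    estimates and the Jackson means alike. Integrals appear only where they are forced, in the Fejer
    means (Fourier coefficients are integrals) and in the mean value property. [disk_extension] and
    [fcalc] are values of a choice operator, about which nothing is known before a suitable object
    is shown to exist. Fejer means provide existence and must then be compared with whatever was
    chosen. The chosen extension is known only to be continuous on the closed disk and
    differentiable inside, which is why the maximum principle is needed for such functions and not
    just for polynomials. The constant may depend only on [m] and [alpha]. The order of the
    differences in the norm of [f] need not be [m]; neither it nor the degree of a Fejer mean
    survives in the bounds, because the Jackson kernel enters only through moments divided by its
    mass. *)

Definition csum (f : nat -> C) (N : nat) : C := sum_n f N.
Definition rsum (f : nat -> R) (N : nat) : R := sum_n f N.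

Lemma csum_S (f : nat -> C) N : csum f (S N) = (csum f N + f (S N))%C.
Proof. apply (@sum_Sn C_AbelianMonoid). Qed.

Lemma rsum_S (f : nat -> R) N : rsum f (S N) = rsum f N + f (S N).
Proof. apply (@sum_Sn R_AbelianMonoid). Qed.

Lemma csum_0 (f : nat -> C) : csum f 0 = f 0%nat.
Proof. apply (@sum_O C_AbelianMonoid). Qed.

Lemma rsum_0 (f : nat -> R) : rsum f 0 = f 0%nat.
Proof. apply (@sum_O R_AbelianMonoid). Qed.

Lemma csum_ext (f g : nat -> C) N :
  (forall k, (k <= N)%nat -> f k = g k) -> csum f N = csum g N.
Proof. apply (@sum_n_ext_loc C_AbelianMonoid). Qed.

Lemma rsum_ext (f g : nat -> R) N :
  (forall k, (k <= N)%nat -> f k = g k) -> rsum f N = rsum g N.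
Proof. apply (@sum_n_ext_loc R_AbelianMonoid). Qed.

Lemma csum_plus (f g : nat -> C) N :
  csum (fun k => (f k + g k)%C) N = (csum f N + csum g N)%C.
Proof. apply (@sum_n_plus C_AbelianMonoid). Qed.

Lemma rsum_plus (f g : nat -> R) N :
  rsum (fun k => f k + g k) N = rsum f N + rsum g N.
Proof. apply (@sum_n_plus R_AbelianMonoid). Qed.

Lemma csum_mult_l (a : C) (f : nat -> C) N :
  csum (fun k => (a * f k)%C) N = (a * csum f N)%C.
Proof. apply (@sum_n_mult_l C_Ring). Qed.

Lemma csum_mult_r (a : C) (f : nat -> C) N :
  csum (fun k => (f k * a)%C) N = (csum f N * a)%C.
Proof. apply (@sum_n_mult_r C_Ring). Qed.

Lemma rsum_mult_l (a : R) (f : nat -> R) N :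
  rsum (fun k => a * f k) N = a * rsum f N.
Proof. apply (@sum_n_mult_l R_Ring). Qed.

Lemma csum_switch (f : nat -> nat -> C) M N :
  csum (fun i => csum (f i) N) M = csum (fun j => csum (fun i => f i j) M) N.
Proof. apply (@sum_n_switch C_AbelianMonoid). Qed.

Lemma csum_minus (f g : nat -> C) N :
  csum (fun k => (f k - g k)%C) N = (csum f N - csum g N)%C.
Proof.
induction N as [|N IH]; [now rewrite !csum_0|].
rewrite !csum_S, IH; ring.
Qed.

Lemma csum_zero N : csum (fun _ => RtoC 0) N = RtoC 0.
Proof.
induction N as [|N IH]; [now rewrite csum_0|rewrite csum_S, IH; ring].
Qed.

Lemma csum_conj (f : nat -> C) N : Cconj (csum f N) = csum (fun k => Cconj (f k)) N.
Proof.
induction N as [|N IH]; [now rewrite !csum_0|].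
rewrite !csum_S, <- IH; apply Cplus_conj.
Qed.

Lemma csum_RtoC (f : nat -> R) N : csum (fun k => RtoC (f k)) N = RtoC (rsum f N).
Proof.
induction N as [|N IH]; [now rewrite csum_0, rsum_0|].
rewrite csum_S, rsum_S, IH, RtoC_plus; reflexivity.
Qed.

Lemma csum_const (c : C) N : csum (fun _ => c) N = (RtoC (INR (S N)) * c)%C.
Proof.
induction N as [|N IH]; [rewrite csum_0; simpl; ring|].
rewrite csum_S, IH, (S_INR (S N)), RtoC_plus; ring.
Qed.

Lemma csum_delta (f : nat -> C) i N :
  (i <= N)%nat -> csum (fun k => if Nat.eqb k i then f k else RtoC 0) N = f i.
Proof.
induction N as [|N IH]; intros Hi.
- rewrite csum_0; replace i with 0%nat by lia; reflexivity.
- rewrite csum_S; destruct (Nat.eqb_spec (S N) i) as [E|E].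
  + rewrite (csum_ext _ (fun _ => RtoC 0)), csum_zero.
    * subst i; ring.
    * intros k Hk; destruct (Nat.eqb_spec k i); [lia|reflexivity].
  + rewrite IH by lia; ring.
Qed.

Lemma csum_support (f : nat -> C) d N :
  (d <= N)%nat -> (forall k, (d < k <= N)%nat -> f k = RtoC 0) -> csum f N = csum f d.
Proof.
intros Hd Hf; induction N as [|N IH].
- now replace d with 0%nat by lia.
- destruct (Nat.eq_dec d (S N)) as [->|E]; [reflexivity|].
  rewrite csum_S, Hf, IH by (lia || (intros; apply Hf; lia)); ring.
Qed.

Lemma rsum_const (c : R) N : rsum (fun _ => c) N = INR (S N) * c.
Proof.
induction N as [|N IH]; [rewrite rsum_0; simpl; ring|].
rewrite rsum_S, IH, (S_INR (S N)); ring.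
Qed.

Lemma rsum_le (f g : nat -> R) N :
  (forall k, (k <= N)%nat -> f k <= g k) -> rsum f N <= rsum g N.
Proof.
induction N as [|N IH]; intros Hk.
- rewrite !rsum_0; apply Hk; lia.
- rewrite !rsum_S; apply Rplus_le_compat; [apply IH; intros; apply Hk; lia|apply Hk; lia].
Qed.

Lemma rsum_nonneg (f : nat -> R) N :
  (forall k, (k <= N)%nat -> 0 <= f k) -> 0 <= rsum f N.
Proof.
intros Hf; replace 0 with (rsum (fun _ => 0) N) by (rewrite rsum_const; ring).
now apply rsum_le.
Qed.

Lemma rsum_le_index (f : nat -> R) M N :
  (forall k, 0 <= f k) -> (M <= N)%nat -> rsum f M <= rsum f N.
Proof.
intros Hf; induction 1 as [|N _ IH]; [apply Rle_refl|].
rewrite rsum_S; specialize (Hf (S N)); lra.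
Qed.

Lemma Cmod_minus_le (x y : C) : Cmod (x - y)%C <= Cmod x + Cmod y.
Proof. rewrite <- (Cmod_opp y); apply Cmod_triangle. Qed.

Lemma Cmod_dist_triangle (x y z : C) : Cmod (x - y)%C <= Cmod (x - z)%C + Cmod (y - z)%C.
Proof. replace (x - y)%C with ((x - z) - (y - z))%C by ring; apply Cmod_minus_le. Qed.

Lemma Cmod_csum_le (f : nat -> C) N : Cmod (csum f N) <= rsum (fun k => Cmod (f k)) N.
Proof.
induction N as [|N IH]; [rewrite csum_0, rsum_0; lra|].
rewrite csum_S, rsum_S.
eapply Rle_trans; [apply Cmod_triangle|lra].
Qed.

(** * Sums and norms in complex normed modules *)

Definition vsum {V : NormedModule C_AbsRing} (v : nat -> V) (N : nat) : V := sum_n v N.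

Section Modules.
Context {V : NormedModule C_AbsRing}.
Implicit Types (x y : V) (v : nat -> V).

Lemma vsum_S v N : vsum v (S N) = plus (vsum v N) (v (S N)).
Proof. apply (@sum_Sn V). Qed.

Lemma vsum_0 v : vsum v 0 = v 0%nat.
Proof. apply (@sum_O V). Qed.

Lemma vsum_ext (u v : nat -> V) N :
  (forall k, (k <= N)%nat -> u k = v k) -> vsum u N = vsum v N.
Proof. apply (@sum_n_ext_loc V). Qed.

Lemma vsum_plus (u v : nat -> V) N :
  vsum (fun k => plus (u k) (v k)) N = plus (vsum u N) (vsum v N).
Proof. apply (@sum_n_plus V). Qed.

Lemma vsum_switch (f : nat -> nat -> V) M N :
  vsum (fun i => vsum (f i) N) M = vsum (fun j => vsum (fun i => f i j) M) N.
Proof. apply (@sum_n_switch V). Qed.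

Lemma scal_Cplus (a b : C) x : scal (a + b)%C x = plus (scal a x : V) (scal b x : V).
Proof. exact (@scal_distr_r C_Ring V a b x). Qed.

Lemma scal_plus (a : C) x y : scal a (plus x y) = plus (scal a x : V) (scal a y : V).
Proof. exact (@scal_distr_l C_Ring V a x y). Qed.

Lemma minus_plus_plus (a b c d : V) :
  minus (plus a b) (plus c d) = plus (minus a c) (minus b d).
Proof.
unfold minus; rewrite (opp_plus (G := V)), <- !plus_assoc; f_equal.
rewrite !plus_assoc; f_equal; apply plus_comm.
Qed.

(** The axiom of a normed module is the inequality [<=]; the converse is the same axiom for the
    scalar [/ a]. *)
Lemma norm_scal_C (a : C) x : norm (scal a x) = Cmod a * norm x.
Proof.
apply Rle_antisym; [apply (norm_scal (K := C_AbsRing))|].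
destruct (Ceq_dec a 0) as [->|Ha].
- rewrite Cmod_0, Rmult_0_l; apply norm_ge_0.
- assert (Ha' := proj1 (Cmod_gt_0 a) Ha).
  assert (H := norm_scal (K := C_AbsRing) (/ a)%C (scal a x)).
  rewrite scal_assoc in H.
  change (mult (/ a)%C a) with (/ a * a)%C in H.
  rewrite Cinv_l in H by exact Ha.
  change (RtoC 1) with (@one C_Ring) in H; rewrite scal_one in H.
  change (norm x <= Cmod (/ a) * norm (scal a x)) in H.
  rewrite Cmod_inv in H by exact Ha.
  apply (Rmult_le_compat_l (Cmod a)) in H; [|lra].
  rewrite <- Rmult_assoc, Rinv_r, Rmult_1_l in H by lra; exact H.
Qed.

Lemma norm_minus_sym x y : norm (minus x y) = norm (minus y x).
Proof. now rewrite <- norm_opp, opp_minus. Qed.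

Lemma norm_minus_le x y : norm (minus x y) <= norm x + norm y.
Proof. unfold minus; rewrite <- (norm_opp y); apply norm_triangle. Qed.

Lemma plus_minus_cancel x y : plus y (minus x y) = x.
Proof.
unfold minus; rewrite (plus_comm x), plus_assoc.
etransitivity; [apply (f_equal (fun z : V => plus z x)), (plus_opp_r (G := V))|].
apply (plus_zero_l (G := V)).
Qed.

Lemma norm_le_plus_minus x y : norm x <= norm y + norm (minus x y).
Proof. rewrite <- (plus_minus_cancel x y) at 1; apply norm_triangle. Qed.

Lemma norm_minus_triangle x y z :
  norm (minus x z) <= norm (minus x y) + norm (minus y z).
Proof.
rewrite (minus_trans y x z); apply norm_triangle.
Qed.

Lemma norm_minus_plus_le x y z w :
  norm (minus (plus x y) (plus z w)) <= norm (minus x z) + norm (minus y w).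
Proof. rewrite minus_plus_plus; apply norm_triangle. Qed.

Lemma norm_eq_minus x y : norm (minus x y) = 0 -> x = y.
Proof.
intros E; apply norm_eq_zero in E.
apply (plus_reg_r (opp y)); rewrite plus_opp_r; exact E.
Qed.

Lemma norm_vsum_le v N : norm (vsum v N) <= rsum (fun k => norm (v k)) N.
Proof.
induction N as [|N IH]; [rewrite vsum_0, rsum_0; apply Rle_refl|].
rewrite vsum_S, rsum_S; eapply Rle_trans; [apply norm_triangle|].
now apply Rplus_le_compat_r.
Qed.

Lemma vsum_zero N : vsum (fun _ => zero) N = (zero : V).
Proof.
induction N as [|N IH]; [now rewrite vsum_0|].
now rewrite vsum_S, IH, plus_zero_r.
Qed.

Lemma vsum_minus (u v : nat -> V) N :
  vsum (fun k => minus (u k) (v k)) N = minus (vsum u N) (vsum v N).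
Proof.
induction N as [|N IH]; [now rewrite !vsum_0|].
rewrite !vsum_S, IH; symmetry; apply minus_plus_plus.
Qed.

Lemma vsum_scal_r (c : nat -> C) x N :
  vsum (fun k => scal (c k) x) N = scal (csum c N) x.
Proof.
induction N as [|N IH]; [now rewrite vsum_0, csum_0|].
rewrite vsum_S, csum_S, IH; symmetry; apply scal_Cplus.
Qed.

Lemma vsum_scal_l (c : C) v N :
  vsum (fun k => scal c (v k) : V) N = scal c (vsum v N).
Proof.
induction N as [|N IH]; [now rewrite !vsum_0|].
rewrite !vsum_S, IH; symmetry; apply scal_plus.
Qed.

Lemma scal_C0 x : scal (RtoC 0) x = zero.
Proof. apply (scal_zero_l (K := C_Ring)). Qed.

Lemma scal_C1 x : scal (RtoC 1) x = x.
Proof. apply (scal_one (K := C_Ring)). Qed.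

Lemma scal_CC (a b : C) x : scal a (scal b x) = scal (a * b)%C x.
Proof. apply (scal_assoc (K := C_Ring)). Qed.

Lemma scal_minus_C (a b : C) x : scal (a - b)%C x = minus (scal a x : V) (scal b x : V).
Proof.
unfold Cminus; rewrite scal_Cplus.
unfold minus; f_equal; exact (@scal_opp_l C_Ring V b x).
Qed.

Lemma scal_minus (a : C) x y : scal a (minus x y) = minus (scal a x : V) (scal a y : V).
Proof. exact (@scal_minus_distr_l C_Ring V a x y). Qed.

Lemma norm_segment_le t x y B : 0 <= t <= 1 -> norm x <= B -> norm y <= B ->
  norm (plus x (scal (RtoC t) (minus y x) : V)) <= B.
Proof.
intros Ht Hx Hy.
assert (E : plus x (scal (RtoC t) (minus y x) : V)
  = plus (scal (RtoC (1 - t)) x : V) (scal (RtoC t) y : V)).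
{ rewrite RtoC_minus, scal_minus_C, scal_C1, scal_minus.
  unfold minus; rewrite <- !plus_assoc; f_equal; apply plus_comm. }
rewrite E; eapply Rle_trans; [apply norm_triangle|].
rewrite !norm_scal_C, !Cmod_R, !Rabs_pos_eq by lra; nra.
Qed.

Lemma vsum_support v d N :
  (d <= N)%nat -> (forall k, (d < k <= N)%nat -> v k = zero) -> vsum v N = vsum v d.
Proof.
intros Hd Hf; induction N as [|N IH].
- now replace d with 0%nat by lia.
- destruct (Nat.eq_dec d (S N)) as [->|E]; [reflexivity|].
  rewrite vsum_S, Hf, IH by (lia || (intros; apply Hf; lia)); apply plus_zero_r.
Qed.

Lemma vsum_delta v i N :
  (i <= N)%nat -> vsum (fun k => if Nat.eqb k i then v k else zero) N = v i.
Proof.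
induction N as [|N IH]; intros Hi.
- rewrite vsum_0; replace i with 0%nat by lia; reflexivity.
- rewrite vsum_S; destruct (Nat.eqb_spec (S N) i) as [E|E].
  + rewrite (vsum_ext _ (fun _ => zero)), vsum_zero.
    * subst i; apply plus_zero_l.
    * intros k Hk; destruct (Nat.eqb_spec k i); [lia|reflexivity].
  + rewrite IH by lia; apply plus_zero_r.
Qed.

End Modules.

Lemma lt_div_mult x e k : 0 < k -> x < e / k -> x * k < e.
Proof.
intros Hk H; apply (Rmult_lt_compat_r k) in H; [|exact Hk].
replace (e / k * k) with e in H by (field; lra); exact H.
Qed.

Lemma pow_unit r k : 0 <= r <= 1 -> 0 <= r ^ k <= 1.
Proof.
intros Hr; split; [apply pow_le; lra|].
rewrite <- (pow1 k); apply pow_incr; lra.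
Qed.

Lemma fraction_unit k m : (0 < m)%nat -> (k <= m)%nat -> 0 <= INR k / INR m <= 1.
Proof.
intros Hm Hk; assert (Hmr : 0 < INR m) by (now apply lt_0_INR).
assert (Hk2 := pos_INR k); assert (Hk3 := le_INR k m Hk).
assert (Hi := Rinv_0_lt_compat _ Hmr); unfold Rdiv; split; [apply Rmult_le_pos; lra|].
apply (Rmult_le_reg_r (INR m)); [lra|]; rewrite Rmult_assoc, Rinv_l; lra.
Qed.

(** * The unit circle and roots of unity *)

Lemma cis_plus a b : cis (a + b) = (cis a * cis b)%C.
Proof.
unfold cis, Cmult; simpl; rewrite cos_plus, sin_plus; f_equal; ring.
Qed.

Lemma cis_0 : cis 0 = RtoC 1.
Proof. unfold cis; now rewrite cos_0, sin_0. Qed.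

Lemma Cmod_cis t : Cmod (cis t) = 1.
Proof.
unfold Cmod, cis; simpl; rewrite !Rmult_1_r.
assert (H := sin2_cos2 t); unfold Rsqr in H.
replace (cos t * cos t + sin t * sin t) with 1 by lra; apply sqrt_1.
Qed.

Lemma cis_pow t n : (cis t ^ n)%C = cis (INR n * t).
Proof.
induction n as [|n IH]; [simpl; rewrite Rmult_0_l, cis_0; reflexivity|].
rewrite S_INR, Rmult_plus_distr_r, Rmult_1_l, cis_plus, <- IH; simpl; ring.
Qed.

Lemma cis_opp t : cis (- t) = Cconj (cis t).
Proof. unfold cis, Cconj; simpl; now rewrite cos_neg, sin_neg. Qed.

Lemma cis_2PI : cis (2 * PI) = RtoC 1.
Proof. unfold cis; now rewrite cos_2PI, sin_2PI. Qed.

Lemma cis_neq_1 t : 0 < t < 2 * PI -> cis t <> RtoC 1.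
Proof.
intros Ht E; apply (f_equal fst) in E; simpl in E.
replace t with (2 * (t / 2)) in E by field.
rewrite cos_2a_sin in E.
assert (H : 0 < sin (t / 2)) by (apply sin_gt_0; lra).
nra.
Qed.

Lemma circle_cis z : circle z -> exists t, 0 <= t <= 2 * PI /\ z = cis t.
Proof.
intros Hz; destruct z as [a b].
assert (H : a * a + b * b = 1).
{ assert (E := Cmod2_alt (a, b)); rewrite Hz in E; simpl in E; lra. }
assert (Ha : -1 <= a <= 1) by nra.
assert (B := acos_bound a); assert (C0 := cos_acos a Ha).
assert (Hs := sin2_cos2 (acos a)); unfold Rsqr in Hs; rewrite C0 in Hs.
assert (Hs0 : 0 <= sin (acos a)) by (apply sin_ge_0; lra).
destruct (Rle_dec 0 b) as [Hb|Hb].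
- exists (acos a); split; [lra|]; unfold cis; rewrite C0; f_equal.
  nra.
- exists (2 * PI - acos a); split; [lra|]; unfold cis.
  rewrite cos_minus, sin_minus, cos_2PI, sin_2PI, C0; f_equal; nra.
Qed.

Lemma circle_conj z : circle z -> (z * Cconj z)%C = RtoC 1.
Proof.
intros Hz; rewrite <- Cmod2_conj, Hz; f_equal; ring.
Qed.

Lemma circle_mult z w : circle z -> circle w -> circle (z * w)%C.
Proof. unfold circle; intros Hz Hw; rewrite Cmod_mult, Hz, Hw; ring. Qed.

Lemma circle_pow z n : circle z -> circle (z ^ n)%C.
Proof. unfold circle; intros Hz; rewrite Cmod_pow, Hz; apply pow1. Qed.

(* A primitive root of unity of order [S L]: sums over [sum_n _ L] have [S L] terms. *)
Definition omega (L : nat) : C := cis (2 * PI / INR (S L)).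

Lemma circle_omega L : circle (omega L).
Proof. apply Cmod_cis. Qed.

Lemma omega_order L : (omega L ^ S L)%C = RtoC 1.
Proof.
unfold omega; rewrite cis_pow.
replace (INR (S L) * (2 * PI / INR (S L))) with (2 * PI)
  by (field; apply not_0_INR; lia).
apply cis_2PI.
Qed.

Lemma omega_pow_neq_1 L l : (0 < l < S L)%nat -> (omega L ^ l)%C <> RtoC 1.
Proof.
intros Hl; unfold omega; rewrite cis_pow; apply cis_neq_1.
assert (P := PI_RGT_0).
assert (H1 : 0 < INR l) by (apply lt_0_INR; lia).
assert (H2 : INR l < INR (S L)) by (apply lt_INR; lia).
assert (H3 : 0 < INR l / INR (S L) < 1).
{ split; [apply Rdiv_lt_0_compat; lra|].
  apply (Rmult_lt_reg_r (INR (S L))); [lra|].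
  unfold Rdiv; rewrite Rmult_assoc, Rinv_l by lra; lra. }
replace (INR l * (2 * PI / INR (S L))) with (INR l / INR (S L) * (2 * PI)) by (field; lra).
nra.
Qed.

Lemma geometric_csum (w : C) N : ((1 - w) * csum (fun k => (w ^ k)%C) N = 1 - w ^ S N)%C.
Proof.
induction N as [|N IH]; [rewrite csum_0; simpl; ring|].
rewrite csum_S, Cmult_plus_distr_l, IH; simpl; ring.
Qed.

Lemma omega_sum L l :
  (0 < l < S L)%nat -> csum (fun s => ((omega L ^ s) ^ l)%C) L = RtoC 0.
Proof.
intros Hl.
rewrite (csum_ext _ (fun s => ((omega L ^ l) ^ s)%C)).
2:{ intros k _; rewrite <- !Cpow_mult_r; f_equal; lia. }
assert (G := geometric_csum (omega L ^ l)%C L).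
rewrite <- Cpow_mult_r, Nat.mul_comm, Cpow_mult_r, omega_order, Cpow_1_l in G.
replace (RtoC 1 - RtoC 1)%C with (RtoC 0) in G by ring.
destruct (Ceq_dec (csum (fun k => ((omega L ^ l) ^ k)%C) L) 0) as [E|E]; [exact E|].
exfalso; apply (Cmult_neq_0 (1 - omega L ^ l)%C _) in E; [now apply E|].
intros Z; apply (omega_pow_neq_1 L l Hl).
replace (omega L ^ l)%C with (1 - (1 - omega L ^ l))%C by ring.
rewrite Z; ring.
Qed.

(** The two inequalities express that [x] and [y] differ by less than the order [S L], so distinct
    exponents stay distinct modulo that order. Subtraction on [nat] being truncated, the sum is
    computed for [y < x] and the other case follows by conjugation. *)
Lemma omega_orthogonal L x y :
  (x < y + S L)%nat -> (y < x + S L)%nat -> x <> y ->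
  csum (fun s => ((omega L ^ s) ^ x * Cconj ((omega L ^ s) ^ y))%C) L = RtoC 0.
Proof.
assert (W : forall x y, (y < x < y + S L)%nat ->
  csum (fun s => ((omega L ^ s) ^ x * Cconj ((omega L ^ s) ^ y))%C) L = RtoC 0).
{ clear; intros x y H; rewrite <- (omega_sum L (x - y)) by lia.
  apply csum_ext; intros s _.
  replace x with ((x - y) + y)%nat at 1 by lia.
  rewrite Cpow_add_r, <- Cmult_assoc, circle_conj; [ring|].
  apply circle_pow, circle_pow, circle_omega. }
intros H1 H2 N; destruct (Nat.lt_ge_cases y x) as [H|H]; [apply W; lia|].
assert (E : csum (fun s => ((omega L ^ s) ^ y * Cconj ((omega L ^ s) ^ x))%C) L = RtoC 0)
  by (apply W; lia).
apply (f_equal Cconj) in E; rewrite csum_conj in E.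
rewrite (csum_ext _ (fun s => Cconj ((omega L ^ s) ^ y * Cconj ((omega L ^ s) ^ x)))%C).
- rewrite E; unfold Cconj, RtoC; simpl; f_equal; ring.
- intros s _; rewrite Cmult_conj, Cconj_conj; ring.
Qed.

Lemma omega_sum_diag L x :
  csum (fun s => ((omega L ^ s) ^ x * Cconj ((omega L ^ s) ^ x))%C) L = RtoC (INR (S L)).
Proof.
rewrite (csum_ext _ (fun _ => RtoC 1)).
- rewrite csum_const; ring.
- intros s _; apply circle_conj, circle_pow, circle_pow, circle_omega.
Qed.

(** * Integrals of complex functions of a real variable *)

Local Notation CR := C_R_CompleteNormedModule.

(** Phrased with [Cmod] so that estimates apply directly; the balls of the uniform structure on [C]
    are those of a product and agree with it up to a factor [sqrt 2]. *)
Definition cont_at (f : R -> C) (t : R) : Prop :=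
  forall eps, 0 < eps -> exists delta, 0 < delta /\
    forall u, Rabs (u - t) < delta -> Cmod (f u - f t)%C < eps.

Lemma cont_at_continuous f t : cont_at f t -> continuous (U := CR) f t.
Proof.
intros Hf; apply filterlim_locally; intros eps.
destruct (Hf eps (cond_pos eps)) as [d [Hd H]].
exists (mkposreal d Hd); intros u Hu; apply C_NormedModule_mixin_compat1.
apply H; exact Hu.
Qed.

Lemma cont_at_const c t : cont_at (fun _ => c) t.
Proof.
intros eps He; exists 1; split; [lra|]; intros u _.
replace (c - c)%C with (RtoC 0) by ring; now rewrite Cmod_0.
Qed.

Lemma cont_at_ext f g t : (forall u, f u = g u) -> cont_at f t -> cont_at g t.
Proof.
intros E Hf eps He; destruct (Hf eps He) as [d [Hd H]]; exists d; split; [exact Hd|].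
intros u Hu; rewrite <- !E; now apply H.
Qed.

Lemma cont_at_plus f g t :
  cont_at f t -> cont_at g t -> cont_at (fun u => (f u + g u)%C) t.
Proof.
intros Hf Hg eps He.
destruct (Hf (eps / 2) ltac:(lra)) as [d1 [H1 H1']].
destruct (Hg (eps / 2) ltac:(lra)) as [d2 [H2 H2']].
exists (Rmin d1 d2); split; [now apply Rmin_pos|]; intros u Hu.
assert (E1 := H1' u (Rlt_le_trans _ _ _ Hu (Rmin_l _ _))).
assert (E2 := H2' u (Rlt_le_trans _ _ _ Hu (Rmin_r _ _))).
replace (f u + g u - (f t + g t))%C with ((f u - f t) + (g u - g t))%C by ring.
eapply Rle_lt_trans; [apply Cmod_triangle|lra].
Qed.

Lemma cont_at_mult f g t :
  cont_at f t -> cont_at g t -> cont_at (fun u => (f u * g u)%C) t.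
Proof.
intros Hf Hg eps He.
set (K := 1 + Cmod (f t) + Cmod (g t)).
assert (F0 := Cmod_ge_0 (f t)); assert (G0 := Cmod_ge_0 (g t)).
assert (HK : 1 <= K) by (unfold K; lra).
set (e := Rmin 1 (eps / (2 * K))).
assert (He' : 0 < e) by (apply Rmin_pos; [lra|apply Rdiv_lt_0_compat; lra]).
assert (He1 : e <= 1) by apply Rmin_l.
assert (He2 : e * K <= eps / 2).
{ assert (E : e <= eps / (2 * K)) by apply Rmin_r.
  apply (Rmult_le_compat_r K) in E; [|lra].
  replace (eps / (2 * K) * K) with (eps / 2) in E by (field; lra); exact E. }
destruct (Hf e He') as [d1 [H1 H1']].
destruct (Hg e He') as [d2 [H2 H2']].
exists (Rmin d1 d2); split; [now apply Rmin_pos|]; intros u Hu.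
assert (E1 := H1' u (Rlt_le_trans _ _ _ Hu (Rmin_l _ _))).
assert (E2 := H2' u (Rlt_le_trans _ _ _ Hu (Rmin_r _ _))).
replace (f u * g u - f t * g t)%C
  with ((f u - f t) * (g u - g t) + (f t * (g u - g t) + (f u - f t) * g t))%C by ring.
set (x := Cmod (f u - f t)%C) in *; set (y := Cmod (g u - g t)%C) in *.
assert (X0 : 0 <= x) by apply Cmod_ge_0; assert (Y0 : 0 <= y) by apply Cmod_ge_0.
apply Rle_lt_trans with (x * y + (Cmod (f t) * y + x * Cmod (g t))).
- eapply Rle_trans; [apply Cmod_triangle|]; rewrite Cmod_mult; fold x y.
  apply Rplus_le_compat_l; eapply Rle_trans; [apply Cmod_triangle|].
  rewrite !Cmod_mult; fold x y; lra.
- apply Rle_lt_trans with (e * K); [|lra].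
  unfold K; assert (x * y <= e * 1) by (apply Rmult_le_compat; lra).
  assert (Cmod (f t) * y <= Cmod (f t) * e) by (apply Rmult_le_compat_l; lra).
  assert (x * Cmod (g t) <= e * Cmod (g t)) by (apply Rmult_le_compat_r; lra).
  lra.
Qed.

Lemma cont_at_minus f g t :
  cont_at f t -> cont_at g t -> cont_at (fun u => (f u - g u)%C) t.
Proof.
intros Hf Hg; apply (cont_at_ext (fun u => (f u + (- RtoC 1) * g u)%C)).
- intros u; ring.
- apply cont_at_plus; [exact Hf|]; apply cont_at_mult; [apply cont_at_const|exact Hg].
Qed.

Lemma Cmod_le_parts (z : C) : Cmod z <= Rabs (fst z) + Rabs (snd z).
Proof.
destruct z as [a b]; simpl.
replace (a, b) with (RtoC a + RtoC b * Ci)%C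
  by (unfold Cplus, Cmult, RtoC, Ci; simpl; f_equal; ring).
eapply Rle_trans; [apply Cmod_triangle|].
rewrite Cmod_mult, Cmod_Ci, !Cmod_R; lra.
Qed.

Lemma cont_at_pair (p q : R -> R) t :
  continuity_pt p t -> continuity_pt q t -> cont_at (fun u => (p u, q u)) t.
Proof.
intros Hp Hq eps He.
apply continuity_pt_locally with (eps := mkposreal _ (is_pos_div_2 (mkposreal _ He))) in Hp.
apply continuity_pt_locally with (eps := mkposreal _ (is_pos_div_2 (mkposreal _ He))) in Hq.
destruct Hp as [d1 H1]; destruct Hq as [d2 H2].
exists (Rmin d1 d2); split; [apply Rmin_pos; apply cond_pos|]; intros u Hu.
assert (E1 := H1 u (Rlt_le_trans _ _ _ Hu (Rmin_l _ _))).
assert (E2 := H2 u (Rlt_le_trans _ _ _ Hu (Rmin_r _ _))).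
simpl in E1, E2; eapply Rle_lt_trans; [apply Cmod_le_parts|]; simpl.
unfold Rminus in *; lra.
Qed.

Lemma cont_at_cis_lin a b t : cont_at (fun u => cis (a * u + b)) t.
Proof.
apply cont_at_pair; apply derivable_continuous_pt; reg.
Qed.

Lemma cont_at_cis t : cont_at cis t.
Proof.
apply (cont_at_ext (fun u => cis (1 * u + 0))); [intros u; f_equal; ring|].
apply cont_at_cis_lin.
Qed.

Definition CRInt (f : R -> C) (a b : R) : C := RInt (V := CR) f a b.

Lemma cont_ex_RInt f a b : a <= b -> (forall t, a <= t <= b -> cont_at f t) ->
  ex_RInt (V := CR) f a b.
Proof.
intros Hab Hf; apply ex_RInt_continuous; intros t Ht; apply cont_at_continuous, Hf.
now rewrite Rmin_left, Rmax_right in Ht by exact Hab.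
Qed.

Lemma CRInt_correct f a b : a <= b -> (forall t, a <= t <= b -> cont_at f t) ->
  is_RInt (V := CR) f a b (CRInt f a b).
Proof. intros Hab Hf; apply (RInt_correct (V := CR)); now apply cont_ex_RInt. Qed.

Lemma CRInt_ext f g a b : a <= b ->
  (forall t, a <= t <= b -> f t = g t) -> CRInt f a b = CRInt g a b.
Proof.
intros Hab E; apply (RInt_ext (V := CR)); intros t.
rewrite Rmin_left, Rmax_right by exact Hab; intros Ht; apply E; lra.
Qed.

Lemma CRInt_bound f a b M : a <= b -> (forall t, a <= t <= b -> cont_at f t) ->
  (forall t, a <= t <= b -> Cmod (f t) <= M) -> Cmod (CRInt f a b) <= (b - a) * M.
Proof.
intros Hab Hf HM; rewrite Cmod_norm.
apply (norm_RInt_le_const (V := C_R_NormedModule) f a b); [exact Hab| |].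
- intros t Ht; rewrite <- Cmod_norm; now apply HM.
- now apply CRInt_correct.
Qed.

Lemma CRInt_bound_fun f g a b l : a <= b -> (forall t, a <= t <= b -> cont_at f t) ->
  (forall t, a <= t <= b -> Cmod (f t) <= g t) -> is_RInt g a b l ->
  Cmod (CRInt f a b) <= l.
Proof.
intros Hab Hf HM Hg; rewrite Cmod_norm.
apply (norm_RInt_le (V := C_R_NormedModule) f g a b); [exact Hab| | |exact Hg].
- intros t Ht; rewrite <- Cmod_norm; now apply HM.
- now apply CRInt_correct.
Qed.

Lemma CRInt_plus f g a b : a <= b -> (forall t, a <= t <= b -> cont_at f t) ->
  (forall t, a <= t <= b -> cont_at g t) ->
  CRInt (fun t => (f t + g t)%C) a b = (CRInt f a b + CRInt g a b)%C.
Proof.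
intros Hab Hf Hg; apply (RInt_plus (V := CR)); now apply cont_ex_RInt.
Qed.

Lemma CRInt_minus f g a b : a <= b -> (forall t, a <= t <= b -> cont_at f t) ->
  (forall t, a <= t <= b -> cont_at g t) ->
  CRInt (fun t => (f t - g t)%C) a b = (CRInt f a b - CRInt g a b)%C.
Proof.
intros Hab Hf Hg; apply (RInt_minus (V := CR)); now apply cont_ex_RInt.
Qed.

Lemma CRInt_const c a b : CRInt (fun _ => c) a b = (RtoC (b - a) * c)%C.
Proof.
unfold CRInt; rewrite (RInt_const (V := CR)).
destruct c as [x y]; unfold scal; simpl; unfold prod_scal, Cmult, RtoC; simpl.
unfold scal; simpl; unfold mult; simpl; f_equal; ring.
Qed.

(** The integral lives in a real normed module, so linearity over the complex numbers is checked on
    the two components. *)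
Lemma CRInt_mult_l (c : C) f a b : a <= b -> (forall t, a <= t <= b -> cont_at f t) ->
  CRInt (fun t => (c * f t)%C) a b = (c * CRInt f a b)%C.
Proof.
intros Hab Hf; apply (is_RInt_unique (V := CR)).
assert (Hi := CRInt_correct f a b Hab Hf).
destruct (CRInt f a b) as [p q]; destruct c as [x y].
assert (H1 := is_RInt_fct_extend_fst (U := R_NormedModule) (V := R_NormedModule) _ _ _ _ Hi).
assert (H2 := is_RInt_fct_extend_snd (U := R_NormedModule) (V := R_NormedModule) _ _ _ _ Hi).
simpl in H1, H2.
unfold Cmult; simpl.
apply (is_RInt_fct_extend_pair (U := R_NormedModule) (V := R_NormedModule)); simpl.
- apply (is_RInt_minus (V := R_NormedModule)); now apply (is_RInt_scal (V := R_NormedModule)).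
- apply (is_RInt_plus (V := R_NormedModule)); now apply (is_RInt_scal (V := R_NormedModule)).
Qed.

Lemma CRInt_Chasles f a b c : a <= b -> b <= c -> (forall t, a <= t <= c -> cont_at f t) ->
  CRInt f a c = (CRInt f a b + CRInt f b c)%C.
Proof.
intros Hab Hbc Hf; symmetry; apply (RInt_Chasles (V := CR)); apply cont_ex_RInt; try lra;
  intros t Ht; apply Hf; lra.
Qed.

Lemma CRInt_shift f a b s : a <= b -> (forall t, cont_at f t) ->
  CRInt (fun t => f (t + s)) a b = CRInt f (a + s) (b + s).
Proof.
intros Hab Hf.
assert (E := RInt_comp_lin (V := CR) f 1 s a b).
replace (1 * a + s) with (a + s) in E by ring.
replace (1 * b + s) with (b + s) in E by ring.
unfold CRInt; rewrite <- E by (apply cont_ex_RInt; [lra|intros; apply Hf]).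
apply CRInt_ext; [exact Hab|]; intros t _; rewrite Rmult_1_l.
symmetry; apply (scal_one (K := R_Ring) (V := CR)).
Qed.

(** The interval from 0 to [T + s] is cut once at [s] and once at [T]; periodicity identifies the
    piece from [T] to [T + s] with the one from 0 to [s]. The shift [s] may be negative. *)
Lemma CRInt_periodic f T s : 0 <= T -> (forall t, cont_at f t) ->
  (forall t, f (t + T) = f t) ->
  CRInt (fun t => f (t + s)) 0 T = CRInt f 0 T.
Proof.
intros HT Hf Hp; rewrite CRInt_shift by assumption.
assert (Hi : forall a b, ex_RInt (V := CR) f a b).
{ intros a b; apply ex_RInt_continuous; intros t _; apply cont_at_continuous, Hf. }
assert (C1 : plus (RInt (V := CR) f 0 s) (RInt (V := CR) f s (T + s)) = RInt (V := CR) f 0 (T + s))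
  by (apply RInt_Chasles; apply Hi).
assert (C2 : plus (RInt (V := CR) f 0 T) (RInt (V := CR) f T (T + s)) = RInt (V := CR) f 0 (T + s))
  by (apply RInt_Chasles; apply Hi).
assert (E : RInt (V := CR) f T (T + s) = RInt (V := CR) f 0 s).
{ assert (E := RInt_comp_lin (V := CR) f 1 T 0 s (Hi _ _)).
  replace (1 * 0 + T) with T in E by ring; replace (1 * s + T) with (T + s) in E by ring.
  rewrite <- E; apply (RInt_ext (V := CR)); intros t _.
  rewrite Rmult_1_l, Hp; apply (scal_one (K := R_Ring) (V := CR)). }
rewrite E in C2; rewrite Rplus_0_l; unfold CRInt.
apply (plus_reg_l (G := CR) (RInt (V := CR) f 0 s)).
etransitivity; [exact C1|]; etransitivity; [symmetry; exact C2|].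
apply (plus_comm (G := CR)).
Qed.

(** * Goursat's theorem for rectangles *)

Lemma nested_intervals (x h : nat -> R) :
  (forall n, x n <= x (S n)) -> (forall n, x (S n) + h (S n) <= x n + h n) ->
  (forall n, 0 <= h n) -> exists z, forall n, x n <= z <= x n + h n.
Proof.
intros Hx Hy Hh.
assert (Mx : forall m n, (m <= n)%nat -> x m <= x n).
{ intros m n; induction 1 as [|n _ IH]; [lra|]; specialize (Hx n); lra. }
assert (My : forall m n, (m <= n)%nat -> x n + h n <= x m + h m).
{ intros m n; induction 1 as [|n _ IH]; [lra|]; specialize (Hy n); lra. }
assert (U : forall m n, x m <= x n + h n).
{ intros m n; destruct (Nat.le_ge_cases m n) as [H|H].
  - specialize (Mx m n H); specialize (Hh n); lra.
  - specialize (My n m H); specialize (Hh m); lra. }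
destruct (completeness (fun r => exists n, r = x n)) as [z [Hz1 Hz2]].
- exists (x 0%nat + h 0%nat); intros r [n ->]; apply U.
- exists (x 0%nat); now exists 0%nat.
- exists z; intros n; split; [apply Hz1; now exists n|].
  apply Hz2; intros r [m ->]; apply U.
Qed.

Definition cdiff_at (f : C -> C) (z : C) : Prop :=
  exists l : C, forall eps, 0 < eps -> exists delta, 0 < delta /\
    forall w, Cmod (w - z)%C < delta ->
      Cmod (f w - f z - l * (w - z))%C <= eps * Cmod (w - z)%C.

Section Goursat.
Variable f : C -> C.
Let g (s t : R) : C := f (s, t).
Variable b0 : R.
Hypothesis f_diff : forall z, fst z < b0 -> cdiff_at f z.

Lemma goursat_cont s0 t0 : s0 < b0 -> forall eps, 0 < eps -> exists delta, 0 < delta /\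
  forall s t, Cmod ((s, t) - (s0, t0))%C < delta -> Cmod (g s t - g s0 t0)%C < eps.
Proof.
intros Hs eps He; destruct (f_diff (s0, t0) Hs) as [l Hl].
destruct (Hl 1 Rlt_0_1) as [d [Hd H]].
assert (L0 := Cmod_ge_0 l).
exists (Rmin d (eps / (2 + Cmod l))); split.
- apply Rmin_pos; [exact Hd|apply Rdiv_lt_0_compat; lra].
- intros s t Hst.
  assert (H1 := H (s, t) (Rlt_le_trans _ _ _ Hst (Rmin_l _ _))).
  assert (H2 : Cmod ((s, t) - (s0, t0))%C < eps / (2 + Cmod l))
    by (eapply Rlt_le_trans; [exact Hst|apply Rmin_r]).
  unfold g; set (h := ((s, t) - (s0, t0))%C) in *.
  replace (f (s, t) - f (s0, t0))%C
    with ((f (s, t) - f (s0, t0) - l * h) + l * h)%C by ring.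
  eapply Rle_lt_trans; [apply Cmod_triangle|]; rewrite Cmod_mult.
  apply lt_div_mult in H2; [|lra].
  assert (P := Cmod_ge_0 h); nra.
Qed.

Lemma goursat_cont_h c s0 : s0 < b0 -> cont_at (fun s => g s c) s0.
Proof.
intros Hs eps He; destruct (goursat_cont s0 c Hs eps He) as [d [Hd H]].
exists d; split; [exact Hd|]; intros u Hu; apply H.
eapply Rle_lt_trans; [apply Cmod_le_parts|]; simpl.
replace (c + - c) with 0 by ring; rewrite Rabs_R0; unfold Rminus in Hu; lra.
Qed.

Lemma goursat_cont_v s t0 : s < b0 -> cont_at (fun t => g s t) t0.
Proof.
intros Hs eps He; destruct (goursat_cont s t0 Hs eps He) as [d [Hd H]].
exists d; split; [exact Hd|]; intros u Hu; apply H.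
eapply Rle_lt_trans; [apply Cmod_le_parts|]; simpl.
replace (s + - s) with 0 by ring; rewrite Rabs_R0; unfold Rminus in Hu; lra.
Qed.

(** The integral of [f(z) dz] counterclockwise around the rectangle with sides [[a, b]] and
    [[c, d]]; on the vertical sides [dz] is [Ci * dt]. *)
Definition bdry (a b c d : R) : C :=
  (CRInt (fun s => g s c) a b + Ci * CRInt (fun t => g b t) c d
   - CRInt (fun s => g s d) a b - Ci * CRInt (fun t => g a t) c d)%C.

Lemma bdry_quarters a e b c k d : a <= e -> e <= b -> b < b0 -> c <= k -> k <= d ->
  bdry a b c d = (bdry a e c k + bdry e b c k + bdry a e k d + bdry e b k d)%C.
Proof.
intros Hae Heb Hb Hck Hkd; unfold bdry.
rewrite (CRInt_Chasles (fun s => g s c) a e b), (CRInt_Chasles (fun s => g s d) a e b),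
  (CRInt_Chasles (fun t => g b t) c k d), (CRInt_Chasles (fun t => g a t) c k d);
  try assumption; try (intros t Ht; apply goursat_cont_h; lra);
  try (intros t Ht; apply goursat_cont_v; lra).
ring.
Qed.

(** An affine function integrates to zero around a rectangle, so only the remainder counts. The sum
    [S] of the side lengths bounds both the lengths and the distance to [z0], whence its square. *)
Lemma bdry_local z0 l eps a b c d : 0 <= eps ->
  a <= fst z0 <= b -> b < b0 -> c <= snd z0 <= d ->
  (forall s t, a <= s <= b -> c <= t <= d ->
     Cmod (g s t - f z0 - l * ((s, t) - z0))%C <= eps * Cmod ((s, t) - z0)%C) ->
  Cmod (bdry a b c d) <= 4 * eps * ((b - a) + (d - c)) ^ 2.
Proof.
intros He Ha Hb Hc HL; destruct z0 as [s0 t0]; simpl fst in *; simpl snd in *.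
set (S := (b - a) + (d - c)).
assert (Hd : forall s t, a <= s <= b -> c <= t <= d ->
  Cmod (g s t - f (s0, t0) - l * ((s, t) - (s0, t0)))%C <= eps * S).
{ intros s t Hs Ht; eapply Rle_trans; [now apply HL|]; apply Rmult_le_compat_l; [exact He|].
  eapply Rle_trans; [apply Cmod_le_parts|]; simpl; unfold S.
  apply Rplus_le_compat; apply Rabs_le; lra. }
set (r := fun s t => (g s t - f (s0, t0) - l * ((s, t) - (s0, t0)))%C) in *.
assert (Ch : forall y s, a <= s <= b -> cont_at (fun s => g s y) s)
  by (intros y s Hs; apply goursat_cont_h; lra).
assert (Cv : forall y t, a <= y <= b -> cont_at (fun t => g y t) t)
  by (intros y t Hy; apply goursat_cont_v; lra).
assert (Hab : a <= b) by lra; assert (Hcd : c <= d) by lra.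
(* Opposite sides are paired, and from each pair the increment of the affine part, which is constant
   along the sides, is subtracted. The two subtracted integrals cancel: [(b - a) * (d - c) * Ci * l]
   occurs with both signs. *)
assert (E : bdry a b c d =
  (CRInt (fun s => (g s c - g s d - Ci * RtoC (c - d) * l))%C a b
   + Ci * CRInt (fun t => g b t - g a t - RtoC (b - a) * l)%C c d)%C).
{ rewrite !CRInt_minus, !CRInt_const; try assumption;
    try (intros t Ht; apply Ch; exact Ht); try (intros t Ht; apply Cv; lra);
    try (intros t Ht; apply cont_at_const);
    try (intros t Ht; apply cont_at_minus; (apply Ch || apply Cv); lra).
  unfold bdry.
  change (fun t : R => g b t) with (g b); change (fun t : R => g a t) with (g a).
  rewrite !RtoC_minus; ring. }
rewrite E.
assert (HS : b - a <= S /\ d - c <= S) by (unfold S; lra).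
assert (HeS : 0 <= eps * S) by (apply Rmult_le_pos; lra).
assert (I1 : Cmod (CRInt (fun s => (g s c - g s d - Ci * RtoC (c - d) * l))%C a b) <= (b - a) * (2 * (eps * S))).
{ apply CRInt_bound; [exact Hab| |].
  - intros t Ht; apply cont_at_minus; [apply cont_at_minus; apply Ch; exact Ht|apply cont_at_const].
  - intros s Hs; replace (g s c - g s d - Ci * RtoC (c - d) * l)%C with (r s c - r s d)%C.
    + eapply Rle_trans; [apply Cmod_minus_le|].
      assert (D1 := Hd s c Hs ltac:(lra)); assert (D2 := Hd s d Hs ltac:(lra)).
      fold (r s c) in D1; fold (r s d) in D2; lra.
    + unfold r.
      replace (Ci * RtoC (c - d))%C with (((s, c) - (s0, t0)) - ((s, d) - (s0, t0)))%C
        by (unfold Cminus, Cplus, Copp, Cmult, Ci, RtoC; simpl; f_equal; ring).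
      ring. }
assert (I2 : Cmod (CRInt (fun t => g b t - g a t - RtoC (b - a) * l)%C c d) <= (d - c) * (2 * (eps * S))).
{ apply CRInt_bound; [exact Hcd| |].
  - intros t Ht; apply cont_at_minus; [apply cont_at_minus; apply Cv; lra|apply cont_at_const].
  - intros t Ht; replace (g b t - g a t - RtoC (b - a) * l)%C with (r b t - r a t)%C.
    + eapply Rle_trans; [apply Cmod_minus_le|].
      assert (D1 := Hd b t ltac:(lra) Ht); assert (D2 := Hd a t ltac:(lra) Ht).
      fold (r b t) in D1; fold (r a t) in D2; lra.
    + unfold r.
      replace (RtoC (b - a)) with (((b, t) - (s0, t0)) - ((a, t) - (s0, t0)))%C
        by (unfold Cminus, Cplus, Copp, RtoC; simpl; f_equal; ring).
      ring. }
eapply Rle_trans; [apply Cmod_triangle|]; rewrite Cmod_mult, Cmod_Ci, Rmult_1_l.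
assert (N1 : (b - a) * (2 * (eps * S)) <= S * (2 * (eps * S))) by (apply Rmult_le_compat_r; lra).
assert (N2 : (d - c) * (2 * (eps * S)) <= S * (2 * (eps * S))) by (apply Rmult_le_compat_r; lra).
replace (4 * eps * S ^ 2) with (S * (2 * (eps * S)) + S * (2 * (eps * S))) by ring.
lra.
Qed.

Lemma Cmod_sum4 (z1 z2 z3 z4 : C) :
  Cmod (z1 + z2 + z3 + z4)%C <= Cmod z1 + Cmod z2 + Cmod z3 + Cmod z4.
Proof.
assert (E1 := Cmod_triangle (z1 + z2 + z3) z4).
assert (E2 := Cmod_triangle (z1 + z2) z3); assert (E3 := Cmod_triangle z1 z2); lra.
Qed.

(** Bisection always leaves a quarter that carries at least a quarter of the integral, while near
    the common point of the nested rectangles differentiability makes the integral small against the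
    square of the side lengths. The half-plane in the hypothesis on [f] fits the later use with
    [F (cexp z)]: points of negative real part are mapped into the punctured disk. *)
Theorem goursat a b c d : a <= b -> b < b0 -> c <= d -> bdry a b c d = RtoC 0.
Proof.
intros Hab Hb Hcd.
set (h := b - a); set (k := d - c).
set (J := Cmod (bdry a b c d)).
(* [p] is the lower left corner of the rectangle kept after [n] bisections. *)
set (good := fun (n : nat) (p : R * R) =>
  a <= fst p /\ fst p + h / 2 ^ n <= b /\ c <= snd p /\ snd p + k / 2 ^ n <= d /\
  J / 4 ^ n <= Cmod (bdry (fst p) (fst p + h / 2 ^ n) (snd p) (snd p + k / 2 ^ n))).
set (next := fun (n : nat) (p q : R * R) =>
  fst p <= fst q /\ fst q + h / 2 ^ S n <= fst p + h / 2 ^ n /\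
  snd p <= snd q /\ snd q + k / 2 ^ S n <= snd p + k / 2 ^ n).
assert (Hh : 0 <= h) by (unfold h; lra); assert (Hk : 0 <= k) by (unfold k; lra).
assert (P2 : forall n, 0 < 2 ^ n) by (intros n; apply pow_lt; lra).
assert (P4 : forall n, 0 < 4 ^ n) by (intros n; apply pow_lt; lra).
assert (hn : forall n, 0 <= h / 2 ^ n)
  by (intros n; apply Rmult_le_pos; [exact Hh|left; apply Rinv_0_lt_compat, P2]).
assert (kn : forall n, 0 <= k / 2 ^ n)
  by (intros n; apply Rmult_le_pos; [exact Hk|left; apply Rinv_0_lt_compat, P2]).
assert (step : forall n p, good n p -> exists q, good (S n) q /\ next n p q).
{ intros n [x y] [G1 [G2 [G3 [G4 G5]]]]; simpl fst in *; simpl snd in *.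
  set (u := h / 2 ^ S n); set (v := k / 2 ^ S n).
  assert (Eu : h / 2 ^ n = u + u) by (unfold u; simpl; field; apply Rgt_not_eq, P2).
  assert (Ev : k / 2 ^ n = v + v) by (unfold v; simpl; field; apply Rgt_not_eq, P2).
  assert (Hu : 0 <= u) by apply hn; assert (Hv : 0 <= v) by apply kn.
  rewrite Eu in G2, G5; rewrite Ev in G4, G5.
  assert (Q := bdry_quarters x (x + u) (x + (u + u)) y (y + v) (y + (v + v))
     ltac:(lra) ltac:(lra) ltac:(lra) ltac:(lra) ltac:(lra)).
  rewrite Q in G5.
  assert (T := Cmod_sum4 (bdry x (x + u) y (y + v)) (bdry (x + u) (x + (u + u)) y (y + v))
    (bdry x (x + u) (y + v) (y + (v + v))) (bdry (x + u) (x + (u + u)) (y + v) (y + (v + v)))).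
  assert (EJ : J / 4 ^ n = 4 * (J / 4 ^ S n)) by (simpl; field; apply Rgt_not_eq, P4).
  rewrite EJ in G5.
  assert (sub : forall x' y', x' = x \/ x' = x + u -> y' = y \/ y' = y + v ->
    J / 4 ^ S n <= Cmod (bdry x' (x' + u) y' (y' + v)) ->
    exists q, good (S n) q /\ next n (x, y) q).
  { intros x' y' Hx' Hy' HJ; exists (x', y'); unfold good, next; simpl fst; simpl snd.
    rewrite Eu, Ev; fold u v; destruct Hx', Hy'; subst x' y'; repeat split; try lra; exact HJ. }
  replace (x + (u + u)) with (x + u + u) in T by ring.
  replace (x + (u + u)) with (x + u + u) in G5 by ring.
  replace (y + (v + v)) with (y + v + v) in T by ring.
  replace (y + (v + v)) with (y + v + v) in G5 by ring.
  destruct (Rle_dec (J / 4 ^ S n) (Cmod (bdry x (x + u) y (y + v)))) as [K1|K1];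
    [apply (sub x y); auto|].
  destruct (Rle_dec (J / 4 ^ S n) (Cmod (bdry (x + u) (x + u + u) y (y + v)))) as [K2|K2];
    [apply (sub (x + u) y); auto|].
  destruct (Rle_dec (J / 4 ^ S n) (Cmod (bdry x (x + u) (y + v) (y + v + v)))) as [K3|K3];
    [apply (sub x (y + v)); auto|].
  apply (sub (x + u) (y + v)); auto; lra. }
assert (start : good 0%nat (a, c)).
{ unfold good; simpl; replace (a + h / 1) with b by (unfold h; field).
  replace (c + k / 1) with d by (unfold k; field); unfold J; repeat split; lra. }
set (nx := fun n p => epsilon (inhabits p) (fun q => good (S n) q /\ next n p q)).
set (p := fix p n := match n with O => (a, c) | S n => nx n (p n) end).
assert (Hp : forall n, good n (p n)).
{ intros n; induction n as [|n IH]; [exact start|].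
  exact (proj1 (epsilon_spec (inhabits (p n)) _ (step n (p n) IH))). }
assert (Hn : forall n, next n (p n) (p (S n))).
{ intros n; exact (proj2 (epsilon_spec (inhabits (p n)) _ (step n (p n) (Hp n)))). }
destruct (nested_intervals (fun n => fst (p n)) (fun n => h / 2 ^ n)) as [s0 Hs0];
  [intros n; apply Hn|intros n; apply Hn|exact hn|].
destruct (nested_intervals (fun n => snd (p n)) (fun n => k / 2 ^ n)) as [t0 Ht0];
  [intros n; apply Hn|intros n; apply Hn|exact kn|].
assert (Hs0' : s0 < b0).
{ specialize (Hs0 0%nat); simpl in Hs0; unfold h in Hs0; lra. }
apply Cmod_eq_0; fold J.
assert (J0 : 0 <= J) by apply Cmod_ge_0.
destruct (f_diff (s0, t0) Hs0') as [l Hl].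
apply Rle_antisym; [|exact J0]; apply le_epsilon; intros eps He; rewrite Rplus_0_l.
(* The local estimate will read [J / 4 ^ n <= 4 * e * ((h + k) / 2 ^ n) ^ 2], in which [4 ^ n]
   cancels; the 1 keeps the denominator positive for degenerate rectangles. *)
set (e := eps / (4 * (1 + (h + k) ^ 2))).
assert (Sq : 0 <= (h + k) ^ 2) by apply pow2_ge_0.
assert (He' : 0 < e) by (apply Rdiv_lt_0_compat; lra).
destruct (Hl e He') as [del [Hdel HL]].
assert (Hn0 : exists n, (h + k) / 2 ^ n < del).
{ destruct (pow_lt_1_zero (/ 2)) with (y := del / (1 + (h + k))) as [n Hn0].
  - rewrite Rabs_pos_eq; lra.
  - apply Rdiv_lt_0_compat; lra.
  - exists n; specialize (Hn0 n (le_n n)); rewrite Rabs_pos_eq in Hn0 by (apply pow_le; lra).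
    rewrite pow_inv in Hn0.
    assert (Hi : 0 < / 2 ^ n) by (apply Rinv_0_lt_compat, P2).
    apply (Rmult_lt_compat_r (1 + (h + k))) in Hn0; [|lra].
    unfold Rdiv in Hn0; rewrite (Rmult_assoc del), Rinv_l in Hn0 by lra.
    unfold Rdiv; nra. }
destruct Hn0 as [n Hn0].
destruct (Hp n) as [G1 [G2 [G3 [G4 G5]]]].
assert (B : Cmod (bdry (fst (p n)) (fst (p n) + h / 2 ^ n) (snd (p n)) (snd (p n) + k / 2 ^ n))
  <= 4 * e * ((fst (p n) + h / 2 ^ n - fst (p n)) + (snd (p n) + k / 2 ^ n - snd (p n))) ^ 2).
{ apply (bdry_local (s0, t0) l); simpl fst; simpl snd; try lra; try apply Hs0; try apply Ht0.
  intros s t Hs Ht; apply HL; eapply Rle_lt_trans; [apply Cmod_le_parts|]; simpl.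
  eapply Rle_lt_trans; [|exact Hn0].
  replace ((h + k) / 2 ^ n) with (h / 2 ^ n + k / 2 ^ n) by (field; apply Rgt_not_eq, P2).
  specialize (Hs0 n); specialize (Ht0 n); apply Rplus_le_compat; apply Rabs_le; lra. }
replace ((fst (p n) + h / 2 ^ n - fst (p n)) + (snd (p n) + k / 2 ^ n - snd (p n)))
  with ((h + k) / 2 ^ n) in B by (field; apply Rgt_not_eq, P2).
assert (E4 : ((h + k) / 2 ^ n) ^ 2 = (h + k) ^ 2 / 4 ^ n).
{ replace 4 with (2 ^ 2) by ring; rewrite <- !pow_mult, (Nat.mul_comm 2 n), pow_mult.
  field; apply Rgt_not_eq, P2. }
rewrite E4 in B.
assert (B2 : J / 4 ^ n <= 4 * e * ((h + k) ^ 2 / 4 ^ n)) by lra.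
apply (Rmult_le_compat_r (4 ^ n)) in B2; [|left; apply P4].
replace (J / 4 ^ n * 4 ^ n) with J in B2 by (field; apply Rgt_not_eq, P4).
replace (4 * e * ((h + k) ^ 2 / 4 ^ n) * 4 ^ n) with (4 * e * (h + k) ^ 2) in B2
  by (field; apply Rgt_not_eq, P4).
eapply Rle_trans; [exact B2|].
assert (Ee : 4 * e * (1 + (h + k) ^ 2) = eps) by (unfold e; field; lra).
nra.
Qed.

End Goursat.

(** * The maximum principle on the disk *)

Definition cont_on (D : C -> Prop) (f : C -> C) : Prop :=
  forall z, D z -> forall eps, 0 < eps -> exists delta, 0 < delta /\
    forall w, D w -> Cmod (w - z)%C < delta -> Cmod (f w - f z)%C < eps.

Lemma continuous_on_iff D f :
  continuous_on (T := C_UniformSpace) (U := C_UniformSpace) D f <-> cont_on D f.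
Proof.
split.
- intros Hf z Hz eps He.
  assert (S0 := sqrt_lt_R0 2 ltac:(lra)).
  assert (He' : 0 < eps / sqrt 2) by (apply Rdiv_lt_0_compat; lra).
  destruct (Hf z Hz (fun y => ball (M := C_UniformSpace) (f z) (eps / sqrt 2) y)) as [d Hd].
  { exists (mkposreal _ He'); intros y Hy; exact Hy. }
  exists d; split; [apply cond_pos|]; intros w Hw Hwz.
  assert (E := C_NormedModule_mixin_compat2 (f z) (f w) (mkposreal _ He')
    (Hd w (C_NormedModule_mixin_compat1 z w d Hwz) Hw)).
  simpl in E; replace (sqrt 2 * (eps / sqrt 2)) with eps in E by (field; lra); exact E.
- intros Hf z Hz P [eps HP].
  destruct (Hf z Hz eps (cond_pos eps)) as [d [Hd H]].
  assert (S0 := sqrt_lt_R0 2 ltac:(lra)).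
  assert (Hd' : 0 < d / sqrt 2) by (apply Rdiv_lt_0_compat; lra).
  exists (mkposreal _ Hd'); intros w Hw Dw; apply HP, C_NormedModule_mixin_compat1.
  apply H; [exact Dw|].
  assert (E := C_NormedModule_mixin_compat2 z w (mkposreal _ Hd') Hw).
  simpl in E; replace (sqrt 2 * (d / sqrt 2)) with d in E by (field; lra); exact E.
Qed.

Lemma ex_derive_cdiff f z :
  ex_derive (K := C_AbsRing) (V := C_NormedModule) f z <-> cdiff_at f z.
Proof.
split.
- intros [l [_ Hl]]; exists l; intros eps He.
  destruct (Hl z (fun P HP => HP) (mkposreal _ He)) as [d Hd].
  exists d; split; [apply cond_pos|]; intros w Hw.
  assert (E := Hd w Hw).
  change (Cmod (f w - f z - (w - z) * l)%C <= eps * Cmod (w - z)%C) in E.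
  now rewrite (Cmult_comm l).
- intros [l Hl]; exists l; split.
  + apply is_linear_scal_l.
  + intros x Hx eps.
    assert (Ex : z = x).
    { apply (is_filter_lim_locally_unique (K := C_AbsRing) (V := AbsRing_NormedModule C_AbsRing)).
      exact Hx. }
    subst x; destruct (Hl eps (cond_pos eps)) as [d [Hd H]].
    exists (mkposreal d Hd); intros w Hw.
    specialize (H w Hw); rewrite (Cmult_comm l) in H; exact H.
Qed.

Lemma cdiff_quadratic f z l K : 0 <= K ->
  (forall w, Cmod (w - z)%C < 1 - Cmod z ->
     Cmod (f w - f z - l * (w - z))%C <= K * Cmod (w - z)%C ^ 2) ->
  Cmod z < 1 -> cdiff_at f z.
Proof.
intros HK H Hz; exists l; intros eps He.
exists (Rmin (1 - Cmod z) (eps / (1 + K))); split.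
{ apply Rmin_pos; [lra|apply Rdiv_lt_0_compat; lra]. }
intros w Hw.
assert (Hw1 : Cmod (w - z)%C < 1 - Cmod z) by (eapply Rlt_le_trans; [exact Hw|apply Rmin_l]).
assert (Hw2 : Cmod (w - z)%C < eps / (1 + K)) by (eapply Rlt_le_trans; [exact Hw|apply Rmin_r]).
eapply Rle_trans; [now apply H|].
apply lt_div_mult in Hw2; [|lra].
assert (P := Cmod_ge_0 (w - z)%C); set (h := Cmod (w - z)%C) in *.
replace (K * h ^ 2) with (K * h * h) by ring; apply Rmult_le_compat_r; [exact P|nra].
Qed.

Lemma cdiff_comp f g z : cdiff_at g z -> cdiff_at f (g z) -> cdiff_at (fun w => f (g w)) z.
Proof.
intros [lg Hg] [lf Hf]; exists (lf * lg)%C; intros eps He.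
assert (G0 := Cmod_ge_0 lg); assert (F0 := Cmod_ge_0 lf).
set (e1 := eps / (2 * (1 + Cmod lg))).
assert (He1 : 0 < e1) by (apply Rdiv_lt_0_compat; lra).
destruct (Hf e1 He1) as [d1 [Hd1 H1]].
set (e2 := Rmin 1 (eps / (2 * (1 + Cmod lf)))).
assert (He2 : 0 < e2) by (apply Rmin_pos; [lra|apply Rdiv_lt_0_compat; lra]).
destruct (Hg e2 He2) as [d2 [Hd2 H2]].
exists (Rmin d2 (d1 / (1 + Cmod lg))); split.
- apply Rmin_pos; [exact Hd2|apply Rdiv_lt_0_compat; lra].
- intros w Hw; set (h := (w - z)%C) in *.
  assert (P := Cmod_ge_0 h).
  assert (E2 := H2 w (Rlt_le_trans _ _ _ Hw (Rmin_l _ _))); fold h in E2.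
  assert (Hw2 : Cmod h < d1 / (1 + Cmod lg)) by (eapply Rlt_le_trans; [exact Hw|apply Rmin_r]).
  apply lt_div_mult in Hw2; [|lra].
  assert (B1 : e2 <= 1) by apply Rmin_l.
  assert (B2 : e2 * (1 + Cmod lf) <= eps / 2).
  { assert (E : e2 <= eps / (2 * (1 + Cmod lf))) by apply Rmin_r.
    apply (Rmult_le_compat_r (1 + Cmod lf)) in E; [|lra].
    replace (eps / (2 * (1 + Cmod lf)) * (1 + Cmod lf)) with (eps / 2) in E by (field; lra); exact E. }
  assert (B3 : e1 * (1 + Cmod lg) = eps / 2) by (unfold e1; field; lra).
  set (k := (g w - g z)%C).
  assert (Hk : Cmod k <= (1 + Cmod lg) * Cmod h).
  { replace k with ((g w - g z - lg * h) + lg * h)%C by (unfold k; ring).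
    eapply Rle_trans; [apply Cmod_triangle|]; rewrite Cmod_mult; nra. }
  assert (E1 := H1 (g w) ltac:(fold k; lra)); fold k in E1.
  replace (f (g w) - f (g z) - lf * lg * h)%C
    with ((f (g w) - f (g z) - lf * k) + lf * (g w - g z - lg * h))%C by (unfold k; ring).
  eapply Rle_trans; [apply Cmod_triangle|]; rewrite Cmod_mult.
  assert (E3 : e1 * Cmod k <= eps / 2 * Cmod h).
  { rewrite <- B3, Rmult_assoc; apply Rmult_le_compat_l; lra. }
  assert (E4 : Cmod lf * Cmod (g w - g z - lg * h)%C <= Cmod lf * (e2 * Cmod h))
    by (apply Rmult_le_compat_l; lra).
  nra.
Qed.

(** * The complex exponential and the mean value property *)

Definition cexp (z : C) : C := (RtoC (exp (fst z)) * cis (snd z))%C.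

Lemma cexp_plus z w : cexp (z + w) = (cexp z * cexp w)%C.
Proof.
unfold cexp; destruct z as [a b], w as [c d]; simpl.
rewrite exp_plus, cis_plus, RtoC_mult; ring.
Qed.

Lemma Cmod_cexp z : Cmod (cexp z) = exp (fst z).
Proof.
unfold cexp; rewrite Cmod_mult, Cmod_cis, Cmod_R, Rabs_pos_eq; [ring|left; apply exp_pos].
Qed.

Lemma derive_at_0 (p : R -> R) l : derivable_pt_lim p 0 l ->
  forall eps, 0 < eps -> exists delta, 0 < delta /\
    forall h, Rabs h < delta -> Rabs (p h - p 0 - l * h) <= eps * Rabs h.
Proof.
intros Hp eps He; destruct (Hp eps He) as [d Hd].
exists d; split; [apply cond_pos|]; intros h Hh.
destruct (Req_EM_T h 0) as [->|N].
- rewrite Rmult_0_r, Rminus_0_r, Rminus_diag, Rabs_R0; lra.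
- specialize (Hd h N Hh); rewrite Rplus_0_l in Hd.
  replace (p h - p 0 - l * h) with (((p h - p 0) / h - l) * h) by (field; exact N).
  rewrite Rabs_mult; apply Rmult_le_compat_r; [apply Rabs_pos|lra].
Qed.

Lemma cexp_diff_0 eps : 0 < eps -> exists delta, 0 < delta /\
  forall h, Cmod h < delta -> Cmod (cexp h - 1 - h)%C <= eps * Cmod h.
Proof.
(* The real and imaginary parts of the remainder come out at most [3 * (e * m)] and [5 * (e * m)],
   where [m] is the modulus of [h]; this accounts for the 8. Requiring also [m < e] brings the
   quadratic term [(exp s - 1) * sin t] into this form. *)
intros He; set (e := Rmin 1 (eps / 8)).
assert (He' : 0 < e) by (apply Rmin_pos; lra).
assert (B1 : e <= 1) by apply Rmin_l; assert (B2 : e <= eps / 8) by apply Rmin_r.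
destruct (derive_at_0 exp 1 derivable_pt_lim_exp_0 e He') as [d1 [Hd1 H1]].
destruct (derive_at_0 cos 0) with (eps := e) as [d2 [Hd2 H2]]; [|exact He'|].
{ generalize (derivable_pt_lim_cos 0); now rewrite sin_0, Ropp_0. }
destruct (derive_at_0 sin 1) with (eps := e) as [d3 [Hd3 H3]]; [|exact He'|].
{ generalize (derivable_pt_lim_sin 0); now rewrite cos_0. }
exists (Rmin (Rmin d1 e) (Rmin d2 d3)); split; [repeat (assumption || apply Rmin_pos)|].
intros h Hh.
assert (Hh1 : Cmod h < d1) by (eapply Rlt_le_trans; [exact Hh|]; eapply Rle_trans; apply Rmin_l).
assert (Hhe : Cmod h < e)
  by (eapply Rlt_le_trans; [exact Hh|]; eapply Rle_trans; [apply Rmin_l|apply Rmin_r]).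
assert (Hh2 : Cmod h < d2)
  by (eapply Rlt_le_trans; [exact Hh|]; eapply Rle_trans; [apply Rmin_r|apply Rmin_l]).
assert (Hh3 : Cmod h < d3) by (eapply Rlt_le_trans; [exact Hh|]; eapply Rle_trans; apply Rmin_r).
assert (M := Rmax_Cmod h).
assert (Ms := Rmax_l (Rabs (fst h)) (Rabs (snd h))).
assert (Mt := Rmax_r (Rabs (fst h)) (Rabs (snd h))).
set (m := Cmod h) in *; destruct h as [s t]; simpl fst in *; simpl snd in *.
assert (M0 : 0 <= m) by apply Cmod_ge_0.
assert (K1 := H1 s ltac:(lra)); rewrite exp_0 in K1.
assert (K2 := H2 t ltac:(lra)); rewrite cos_0 in K2.
assert (K3 := H3 t ltac:(lra)); rewrite sin_0 in K3.
set (E1 := exp s - 1 - 1 * s) in *; set (E2 := cos t - 1 - 0 * t) in *;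
  set (E3 := sin t - 0 - 1 * t) in *.
assert (K1' : Rabs E1 <= e * m) by (eapply Rle_trans; [exact K1|apply Rmult_le_compat_l; lra]).
assert (K2' : Rabs E2 <= e * m) by (eapply Rle_trans; [exact K2|apply Rmult_le_compat_l; lra]).
assert (K3' : Rabs E3 <= e * m) by (eapply Rle_trans; [exact K3|apply Rmult_le_compat_l; lra]).
assert (Hd1' : Rabs (exp s - 1) <= 2 * m).
{ replace (exp s - 1) with (E1 + s) by (unfold E1; ring).
  eapply Rle_trans; [apply Rabs_triang|]; nra. }
assert (Hs : Rabs (sin t) <= 2 * m).
{ replace (sin t) with (E3 + t) by (unfold E3; ring).
  eapply Rle_trans; [apply Rabs_triang|]; nra. }
assert (Hc : Rabs (cos t) <= 1) by (apply Rabs_le, COS_bound).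
eapply Rle_trans; [apply Cmod_le_parts|]; unfold cexp; simpl.
replace (exp s * cos t - 0 * sin t + - (1) + - s) with (E1 * cos t + (E2 + s * E2))
  by (unfold E1, E2; ring).
replace (exp s * sin t + 0 * cos t + - 0 + - t) with ((exp s - 1) * sin t + E3)
  by (unfold E3; ring).
assert (T1 : Rabs (E1 * cos t + (E2 + s * E2)) <= e * m + (e * m + e * m)).
{ eapply Rle_trans; [apply Rabs_triang|]; apply Rplus_le_compat.
  - rewrite Rabs_mult, <- (Rmult_1_r (e * m)); apply Rmult_le_compat; try apply Rabs_pos; assumption.
  - eapply Rle_trans; [apply Rabs_triang|]; apply Rplus_le_compat; [exact K2'|].
    rewrite Rabs_mult, <- (Rmult_1_l (e * m)); apply Rmult_le_compat; try apply Rabs_pos; lra. }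
assert (T2 : Rabs ((exp s - 1) * sin t + E3) <= 4 * (e * m) + e * m).
{ eapply Rle_trans; [apply Rabs_triang|]; apply Rplus_le_compat; [|exact K3'].
  rewrite Rabs_mult; apply Rle_trans with (2 * m * (2 * m));
    [apply Rmult_le_compat; try apply Rabs_pos; assumption|]; nra. }
assert (T3 : e * m <= eps / 8 * m) by (apply Rmult_le_compat_r; assumption).
lra.
Qed.

Lemma cdiff_cexp z : cdiff_at cexp z.
Proof.
exists (cexp z); intros eps He.
assert (P := exp_pos (fst z)).
destruct (cexp_diff_0 (eps / exp (fst z))) as [d [Hd H]]; [now apply Rdiv_lt_0_compat|].
exists d; split; [exact Hd|]; intros w Hw.
replace (cexp w) with (cexp (z + (w - z)))%C by (f_equal; ring).
rewrite cexp_plus.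
replace (cexp z * cexp (w - z) - cexp z - cexp z * (w - z))%C
  with (cexp z * (cexp (w - z) - 1 - (w - z)))%C by ring.
rewrite Cmod_mult, Cmod_cexp.
assert (H' := Rmult_le_compat_l (exp (fst z)) _ _ (Rlt_le _ _ P) (H _ Hw)).
replace (exp (fst z) * (eps / exp (fst z) * Cmod (w - z)%C)) with (eps * Cmod (w - z)%C)
  in H' by (field; lra).
exact H'.
Qed.

(** The horizontal sides of the rectangle from [s1] to [s2] and from 0 to [2 * PI] have the same
    image under [cexp] and cancel; the vertical sides become the circles of radii [exp s1] and
    [exp s2]. *)
Lemma mean_value_radii F s1 s2 : (forall z, Cmod z < 1 -> cdiff_at F z) -> s1 <= s2 -> s2 < 0 ->
  CRInt (fun t => F (RtoC (exp s1) * cis t)%C) 0 (2 * PI)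
  = CRInt (fun t => F (RtoC (exp s2) * cis t)%C) 0 (2 * PI).
Proof.
intros HF H12 H2.
assert (P := PI_RGT_0).
assert (G := goursat (fun z => F (cexp z)) 0).
assert (HG : forall z, fst z < 0 -> cdiff_at (fun z => F (cexp z)) z).
{ intros z Hz; apply cdiff_comp; [apply cdiff_cexp|]; apply HF; rewrite Cmod_cexp.
  rewrite <- exp_0; now apply exp_increasing. }
specialize (G HG s1 s2 0 (2 * PI) H12 H2 ltac:(lra)).
unfold bdry in G.
rewrite (CRInt_ext (fun s => F (cexp (s, 2 * PI))) (fun s => F (cexp (s, 0)))) in G.
- unfold cexp in G; simpl in G.
  set (I1 := CRInt (fun t => F (RtoC (exp s1) * cis t)%C) 0 (2 * PI)) in *.
  set (I2 := CRInt (fun t => F (RtoC (exp s2) * cis t)%C) 0 (2 * PI)) in *.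
  set (A := CRInt _ s1 s2) in *.
  assert (E : (Ci * (I2 - I1))%C = RtoC 0) by (rewrite <- G; ring).
  replace I1 with (I2 - (I2 - I1))%C by ring.
  replace (I2 - I1)%C with (- Ci * (Ci * (I2 - I1)))%C.
  + rewrite E; ring.
  + replace (- Ci * (Ci * (I2 - I1)))%C with (- (Ci * Ci) * (I2 - I1))%C by ring.
    replace (Ci * Ci)%C with (- RtoC 1)%C by (unfold Ci, Cmult, Copp, RtoC; simpl; f_equal; ring).
    ring.
- exact H12.
- intros t _; unfold cexp; simpl; now rewrite cis_2PI, cis_0.
Qed.

(** Compactness is that of the square around the disk, applied to a gauge [delta] defined on the
    whole square. Points off the closed set [K] receive a ball missing [K], so that the tag attached
    to a point of [K] must itself lie in [K]. *)
Lemma uniform_continuity_compact (K : C -> Prop) f :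
  (forall z, K z -> Cmod z <= 1) ->
  (forall z, ~ K z -> exists d, 0 < d /\ forall w, Cmod (w - z)%C < d -> ~ K w) ->
  cont_on K f ->
  forall eps, 0 < eps -> exists delta, 0 < delta /\
    forall z w, K z -> K w -> Cmod (w - z)%C < delta -> Cmod (f w - f z)%C < eps.
Proof.
intros HK1 HK2 Hf eps He.
assert (D : forall u v, exists d : posreal,
  (K (u, v) -> forall w, K w -> Cmod (w - (u, v))%C < 4 * d -> Cmod (f w - f (u, v))%C < eps / 2) /\
  (~ K (u, v) -> forall w, Cmod (w - (u, v))%C < 4 * d -> ~ K w)).
{ intros u v; destruct (classic (K (u, v))) as [Y|Y].
  - destruct (Hf _ Y (eps / 2) ltac:(lra)) as [d [Hd H]].
    assert (Hd4 : 0 < d / 4) by lra.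
    exists (mkposreal _ Hd4); split; [|tauto]; simpl; intros _ w Hw Hd'; apply H; [exact Hw|lra].
  - destruct (HK2 _ Y) as [d [Hd H]]; assert (Hd4 : 0 < d / 4) by lra.
    exists (mkposreal _ Hd4); split; [tauto|]; simpl; intros _ w Hd'; apply H; lra. }
set (delta := fun u v => epsilon (inhabits (mkposreal 1 Rlt_0_1)) (fun d : posreal =>
  (K (u, v) -> forall w, K w -> Cmod (w - (u, v))%C < 4 * d -> Cmod (f w - f (u, v))%C < eps / 2) /\
  (~ K (u, v) -> forall w, Cmod (w - (u, v))%C < 4 * d -> ~ K w))).
assert (Hdelta := fun u v => epsilon_spec (inhabits (mkposreal 1 Rlt_0_1)) _ (D u v)).
destruct (compactness_value_2d (-1) 1 (-1) 1 delta) as [d Hd].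
exists d; split; [apply cond_pos|]; intros z w Hz Hw Hzw.
(* [compactness_value_2d] yields the tag [(u, v)] only under a double negation, hence the passage to
   a contradiction. The tag is within [2 * delta u v] of [z] and [3 * delta u v] of [w], which the
   factor 4 in the gauge absorbs. *)
destruct (Rlt_dec (Cmod (f w - f z)%C) eps) as [Y|Y]; [exact Y|exfalso].
assert (Hm := Rle_trans _ _ _ (Rmax_Cmod z) (HK1 z Hz)).
assert (M1 := Rmax_l (Rabs (fst z)) (Rabs (snd z))).
assert (M2 := Rmax_r (Rabs (fst z)) (Rabs (snd z))).
destruct z as [x y]; simpl fst in *; simpl snd in *.
apply (Hd x y); [apply Rabs_le_between; lra|apply Rabs_le_between; lra|].
intros (u & v & Hu & Hv & Hxu & Hyv & Hdd).
destruct (Hdelta u v) as [HA HB]; fold (delta u v) in HA, HB.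
assert (Hz' : Cmod ((x, y) - (u, v))%C < 2 * delta u v).
{ eapply Rle_lt_trans; [apply Cmod_le_parts|]; simpl; unfold Rminus in *; lra. }
assert (HKuv : K (u, v)).
{ destruct (classic (K (u, v))) as [Z|Z]; [exact Z|exfalso].
  assert (P := cond_pos (delta u v)); apply (HB Z (x, y)); [lra|exact Hz]. }
assert (P := cond_pos (delta u v)).
assert (E1 := HA HKuv (x, y) Hz ltac:(lra)).
assert (E2 : Cmod (f w - f (u, v))%C < eps / 2).
{ apply (HA HKuv w Hw).
  replace (w - (u, v))%C with ((w - (x, y)) + ((x, y) - (u, v)))%C by ring.
  eapply Rle_lt_trans; [apply Cmod_triangle|lra]. }
apply Y; eapply Rle_lt_trans; [apply (Cmod_dist_triangle _ _ (f (u, v)))|lra].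
Qed.

Lemma Cmod_minus_ge z w : Cmod z - Cmod w <= Cmod (z - w)%C.
Proof.
assert (E := Cmod_triangle (z - w) w); replace (z - w + w)%C with z in E by ring; lra.
Qed.

Lemma uniform_continuity_disk f : cont_on closed_disk f ->
  forall eps, 0 < eps -> exists delta, 0 < delta /\
    forall z w, Cmod z <= 1 -> Cmod w <= 1 -> Cmod (w - z)%C < delta -> Cmod (f w - f z)%C < eps.
Proof.
apply uniform_continuity_compact; [intros z Hz; exact Hz|].
intros z Hz; apply Rnot_le_lt in Hz; exists (Cmod z - 1); split; [lra|].
intros w Hw Hw1; unfold closed_disk in Hw1.
assert (E := Cmod_minus_ge z w); replace (z - w)%C with (- (w - z))%C in E by ring.
rewrite Cmod_opp in E; lra.
Qed.

Lemma uniform_continuity_circle f : cont_on circle f ->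
  forall eps, 0 < eps -> exists delta, 0 < delta /\
    forall z w, circle z -> circle w -> Cmod (w - z)%C < delta -> Cmod (f w - f z)%C < eps.
Proof.
apply uniform_continuity_compact; [intros z Hz; unfold circle in Hz; lra|].
intros z Hz; exists (Rabs (Cmod z - 1)); split.
- apply Rabs_pos_lt; intros E; apply Hz; unfold circle; lra.
- intros w Hw Hw1; unfold circle in Hw1.
  assert (E := Cmod_minus_ge z w); replace (z - w)%C with (- (w - z))%C in E by ring.
  rewrite Cmod_opp in E; assert (E' := Cmod_minus_ge w z).
  rewrite Hw1 in *; unfold Rabs in Hw; destruct (Rcase_abs (Cmod z - 1)); lra.
Qed.

Lemma center_bound F M : cont_on closed_disk F -> (forall z, Cmod z < 1 -> cdiff_at F z) ->
  (forall z, circle z -> Cmod (F z) <= M) -> Cmod (F 0) <= M.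
Proof.
intros Hc Hd HM; apply le_epsilon; intros eps He.
destruct (uniform_continuity_disk F Hc (eps / 2) ltac:(lra)) as [d [Hd0 H]].
assert (P := PI_RGT_0).
(* On the circle of radius [r1] the values are close to [F 0], on that of radius [r2] close to the
   boundary values; the averages over the two circles coincide. The bounds by 1/2 ensure
   [0 < r1 <= r2], so that both logarithms make sense and are ordered. *)
set (r1 := Rmin (1 / 2) (d / 2)); set (r2 := Rmax (1 / 2) (1 - d / 2)).
assert (R1 : 0 < r1 <= 1 / 2) by (split; [apply Rmin_pos; lra|apply Rmin_l]).
assert (R1' : r1 <= d / 2) by apply Rmin_r.
assert (R2 : 1 / 2 <= r2 < 1) by (split; [apply Rmax_l|apply Rmax_lub_lt; lra]).
assert (R2' : 1 - d / 2 <= r2) by apply Rmax_r.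
assert (Hln : ln r2 < 0) by (rewrite <- ln_1; apply ln_increasing; lra).
assert (Hln12 : ln r1 <= ln r2) by (apply ln_le; lra).
assert (MV := mean_value_radii F (ln r1) (ln r2) Hd Hln12 Hln).
rewrite !exp_ln in MV by lra.
assert (Md : forall r t, 0 <= r -> Cmod (RtoC r * cis t)%C = r).
{ intros r t Hr; rewrite Cmod_mult, Cmod_cis, Cmod_R, Rabs_pos_eq; lra. }
assert (Hcont : forall r t, 0 <= r < 1 -> cont_at (fun t => F (RtoC r * cis t)%C) t).
{ intros r t Hr e Hee.
  destruct (Hc (RtoC r * cis t)%C) with (eps := e) as [d' [Hd' H']]; [|exact Hee|].
  - unfold closed_disk; rewrite Md; lra.
  - destruct (cont_at_cis t d' Hd') as [d'' [Hd'' H'']].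
    exists d''; split; [exact Hd''|]; intros u Hu; apply H'.
    + unfold closed_disk; rewrite Md; lra.
    + replace (RtoC r * cis u - RtoC r * cis t)%C with (RtoC r * (cis u - cis t))%C by ring.
      rewrite Cmod_mult, Cmod_R, Rabs_pos_eq by lra.
      assert (E := H'' u Hu); assert (Q := Cmod_ge_0 (cis u - cis t)%C); nra. }
assert (B2 : Cmod (CRInt (fun t => F (RtoC r2 * cis t)%C) 0 (2 * PI)) <= (2 * PI - 0) * (M + eps / 2)).
{ apply CRInt_bound; [lra|intros; apply Hcont; lra|]; intros t _.
  assert (E := H (cis t) (RtoC r2 * cis t)%C).
  rewrite Cmod_cis, Md in E by lra.
  assert (E' : Cmod (F (RtoC r2 * cis t) - F (cis t))%C < eps / 2).
  { apply E; [lra|lra|].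
    replace (RtoC r2 * cis t - cis t)%C with (RtoC (- (1 - r2)) * cis t)%C
      by (rewrite RtoC_opp, RtoC_minus; ring).
    rewrite Cmod_mult, Cmod_cis, Cmod_R, Rabs_Ropp, Rabs_pos_eq; lra. }
  assert (E1 := HM (cis t) (Cmod_cis t)); assert (E2 := Cmod_minus_ge (F (RtoC r2 * cis t)%C) (F (cis t))).
  lra. }
assert (B1 : Cmod (CRInt (fun t => F (RtoC r1 * cis t) - F 0)%C 0 (2 * PI)) <= (2 * PI - 0) * (eps / 2)).
{ apply CRInt_bound; [lra| |].
  - intros t _; apply cont_at_minus; [apply Hcont; lra|apply cont_at_const].
  - intros t _; left; apply H; [rewrite Cmod_0; lra|rewrite Md; lra|].
    replace (RtoC r1 * cis t - 0)%C with (RtoC r1 * cis t)%C by ring; rewrite Md; lra. }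
rewrite CRInt_minus, CRInt_const in B1;
  [|lra|intros; apply Hcont; lra|intros; apply cont_at_const].
rewrite MV in B1; set (I := CRInt (fun t => F (RtoC r2 * cis t)%C) 0 (2 * PI)) in *.
assert (E := Cmod_minus_ge (RtoC (2 * PI - 0) * F 0)%C I).
replace (RtoC (2 * PI - 0) * F 0 - I)%C with (- (I - RtoC (2 * PI - 0) * F 0))%C in E by ring.
rewrite Cmod_opp, Cmod_mult, Cmod_R, Rabs_pos_eq in E by lra.
apply (Rmult_le_reg_l (2 * PI)); [lra|]; lra.
Qed.

Section Moebius.
Variable a : C.
Hypothesis Ha : Cmod a < 1.

Definition moebius (w : C) : C := ((w + a) / (1 + Cconj a * w))%C.

Lemma moebius_den_ge w : Cmod w <= 1 -> 1 - Cmod a <= Cmod (1 + Cconj a * w)%C.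
Proof.
intros Hw; assert (E := Cmod_minus_ge 1 (- (Cconj a * w))).
replace (1 - - (Cconj a * w))%C with (1 + Cconj a * w)%C in E by ring.
rewrite Cmod_opp, Cmod_1, Cmod_mult, Cmod_conj in E.
assert (P := Cmod_ge_0 a); assert (Q := Cmod_ge_0 w); nra.
Qed.

Lemma moebius_den_neq_0 w : Cmod w <= 1 -> (1 + Cconj a * w)%C <> 0.
Proof.
intros Hw; apply Cmod_gt_0; assert (E := moebius_den_ge w Hw); lra.
Qed.

(** Both mapping properties are read off here: the sign of the right side is that of
    [1 - Cmod w]. *)
Lemma moebius_identity w :
  Cmod (1 + Cconj a * w)%C ^ 2 - Cmod (w + a)%C ^ 2 = (1 - Cmod w ^ 2) * (1 - Cmod a ^ 2).
Proof.
rewrite !Cmod2_alt; destruct a as [x y], w as [u v]; unfold Re, Im, Cconj, Cplus, Cmult, RtoC; simpl; ring.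
Qed.

Lemma Cmod_moebius_lt w : Cmod w < 1 -> Cmod (moebius w) < 1.
Proof.
intros Hw; unfold moebius; rewrite Cmod_div by (apply moebius_den_neq_0; lra).
assert (E := moebius_identity w).
assert (D := moebius_den_ge w ltac:(lra)).
assert (P := Cmod_ge_0 a); assert (Q := Cmod_ge_0 w); assert (S := Cmod_ge_0 (w + a)%C).
set (x := Cmod (1 + Cconj a * w)%C) in *; set (y := Cmod (w + a)%C) in *.
apply (Rmult_lt_reg_r x); [lra|]; unfold Rdiv; rewrite Rmult_assoc, Rinv_l, Rmult_1_r by lra.
assert (0 < (1 - Cmod w ^ 2) * (1 - Cmod a ^ 2)) by (apply Rmult_lt_0_compat; simpl; nra).
nra.
Qed.

Lemma circle_moebius w : circle w -> circle (moebius w).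
Proof.
unfold circle; intros Hw; unfold moebius; rewrite Cmod_div by (apply moebius_den_neq_0; lra).
assert (E := moebius_identity w); rewrite Hw in E.
assert (D := moebius_den_ge w ltac:(lra)); assert (S := Cmod_ge_0 (w + a)%C).
set (x := Cmod (1 + Cconj a * w)%C) in *; set (y := Cmod (w + a)%C) in *.
assert (Exy : x = y) by nra; rewrite <- Exy; apply Rinv_r; lra.
Qed.

Lemma moebius_diff w z : Cmod w <= 1 -> Cmod z <= 1 ->
  (moebius w - moebius z)%C
  = ((1 - a * Cconj a) * (w - z) / ((1 + Cconj a * w) * (1 + Cconj a * z)))%C.
Proof.
intros Hw Hz; unfold moebius; field; split; now apply moebius_den_neq_0.
Qed.

Lemma Cmod_moebius_diff_le w z : Cmod w <= 1 -> Cmod z <= 1 ->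
  Cmod (moebius w - moebius z)%C <= 2 / (1 - Cmod a) ^ 2 * Cmod (w - z)%C.
Proof.
intros Hw Hz; rewrite moebius_diff by assumption.
assert (Dw := moebius_den_ge w Hw); assert (Dz := moebius_den_ge z Hz).
rewrite Cmod_div by (apply Cmult_neq_0; now apply moebius_den_neq_0).
rewrite !Cmod_mult.
assert (E : Cmod (1 - a * Cconj a)%C <= 2).
{ eapply Rle_trans; [apply Cmod_minus_le|].
  rewrite Cmod_1, Cmod_mult, Cmod_conj; assert (P := Cmod_ge_0 a); nra. }
assert (P := Cmod_ge_0 (w - z)%C); assert (P' := Cmod_ge_0 (1 - a * Cconj a)%C).
set (x := Cmod (1 + Cconj a * w)%C) in *; set (y := Cmod (1 + Cconj a * z)%C) in *.
replace (2 / (1 - Cmod a) ^ 2 * Cmod (w - z)%C) with (2 * Cmod (w - z)%C / (1 - Cmod a) ^ 2) by (field; lra).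
unfold Rdiv; apply Rmult_le_compat.
- now apply Rmult_le_pos.
- left; apply Rinv_0_lt_compat; nra.
- now apply Rmult_le_compat_r.
- apply Rinv_le_contravar; [nra|]; simpl; rewrite Rmult_1_r; apply Rmult_le_compat; lra.
Qed.

Lemma cdiff_moebius z : Cmod z < 1 -> cdiff_at moebius z.
Proof.
intros Hz; set (q := (1 + Cconj a * z)%C).
assert (Q0 : q <> 0) by (apply moebius_den_neq_0; lra).
assert (Dz := moebius_den_ge z ltac:(lra)); fold q in Dz.
set (b := Cmod (1 - a * Cconj a)%C * Cmod a / (1 - Cmod a) ^ 3).
apply cdiff_quadratic with (l := ((1 - a * Cconj a) / (q * q))%C) (K := b); [|intros w Hw|exact Hz].
{ apply Rmult_le_pos; [apply Rmult_le_pos; apply Cmod_ge_0|left; apply Rinv_0_lt_compat, pow_lt; lra]. }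
assert (Hwm : Cmod w <= 1) by (assert (E := Cmod_minus_ge w z); lra).
rewrite moebius_diff by (assumption || lra).
assert (Dw := moebius_den_ge w Hwm); assert (W0 := moebius_den_neq_0 w Hwm).
fold q; set (p := (1 + Cconj a * w)%C) in *.
replace ((1 - a * Cconj a) * (w - z) / (p * q) - (1 - a * Cconj a) / (q * q) * (w - z))%C
  with (- ((1 - a * Cconj a) * Cconj a * (w - z) * (w - z) / (p * (q * q))))%C.
2:{ replace ((1 - a * Cconj a) * (w - z) / (p * q) - (1 - a * Cconj a) / (q * q) * (w - z))%C
      with ((1 - a * Cconj a) * (w - z) * (q - p) / (p * (q * q)))%C by (field; split; assumption).
    replace (q - p)%C with (- (Cconj a * (w - z)))%C by (unfold p, q; ring).
    field; split; assumption. }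
rewrite Cmod_opp, Cmod_div by (repeat apply Cmult_neq_0; assumption).
rewrite !Cmod_mult, Cmod_conj.
assert (P := Cmod_ge_0 (w - z)%C).
set (h := Cmod (w - z)%C) in *.
unfold b, Rdiv.
replace (Cmod (1 - a * Cconj a)%C * Cmod a * / (1 - Cmod a) ^ 3 * h ^ 2)
  with (Cmod (1 - a * Cconj a)%C * Cmod a * h * h * / (1 - Cmod a) ^ 3) by ring.
apply Rmult_le_compat_l.
- repeat apply Rmult_le_pos; try apply Cmod_ge_0; exact P.
- apply Rinv_le_contravar; [apply pow_lt; lra|].
  replace ((1 - Cmod a) ^ 3) with ((1 - Cmod a) * ((1 - Cmod a) * (1 - Cmod a))) by ring.
  assert (X : (1 - Cmod a) * (1 - Cmod a) <= Cmod q * Cmod q) by (apply Rmult_le_compat; lra).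
  apply Rmult_le_compat; [lra|nra|exact Dw|exact X].
Qed.

End Moebius.

Theorem maximum_principle F M : cont_on closed_disk F ->
  (forall z, Cmod z < 1 -> cdiff_at F z) ->
  (forall z, circle z -> Cmod (F z) <= M) -> forall z, Cmod z <= 1 -> Cmod (F z) <= M.
Proof.
intros Hc Hd HM a Ha; destruct (Rle_lt_or_eq_dec _ _ Ha) as [Ha'|Ha']; [|now apply HM].
assert (Hmap : forall w, Cmod w <= 1 -> Cmod (moebius a w) <= 1).
{ intros w Hw; destruct (Rle_lt_or_eq_dec _ _ Hw) as [Hw'|Hw'].
  - left; now apply Cmod_moebius_lt.
  - right; now apply circle_moebius. }
replace a with (moebius a 0) by (unfold moebius; field; rewrite Cmult_0_r, Cplus_0_r; intros E; apply (f_equal fst) in E; simpl in E; lra).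
apply (center_bound (fun w => F (moebius a w))).
- intros z Hz eps He; destruct (Hc (moebius a z) (Hmap z Hz) eps He) as [d [Hd0 H]].
  assert (K : 0 < 2 / (1 - Cmod a) ^ 2) by (apply Rdiv_lt_0_compat; [lra|apply pow_lt; lra]).
  exists (d / (2 / (1 - Cmod a) ^ 2)); split; [now apply Rdiv_lt_0_compat|].
  intros w Hw Hwz; apply H; [now apply Hmap|].
  eapply Rle_lt_trans; [now apply Cmod_moebius_diff_le|].
  apply (Rmult_lt_compat_l (2 / (1 - Cmod a) ^ 2)) in Hwz; [|exact K].
  replace (2 / (1 - Cmod a) ^ 2 * (d / (2 / (1 - Cmod a) ^ 2))) with d in Hwz; [exact Hwz|].
  field; lra.
- intros z Hz; apply cdiff_comp; [now apply cdiff_moebius|apply Hd; now apply Cmod_moebius_lt].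
- intros z Hz; apply HM; now apply circle_moebius.
Qed.

(** * Von Neumann's inequality *)

Section Forms.
Context {V : NormedModule C_AbsRing}.
Variable B : V -> V -> C.
Hypothesis B_plus : forall x y z, B (plus x y) z = (B x z + B y z)%C.
Hypothesis B_scal : forall a x y, B (scal a x) y = (a * B x y)%C.
Hypothesis B_conj : forall x y, B y x = Cconj (B x y).

Lemma form_csum_l (c : nat -> C) (v : nat -> V) N y :
  B (vsum (fun k => scal (c k) (v k)) N) y = csum (fun k => (c k * B (v k) y)%C) N.
Proof.
induction N as [|N IH]; [now rewrite vsum_0, csum_0, B_scal|].
now rewrite vsum_S, csum_S, B_plus, B_scal, IH.
Qed.

Lemma form_csum_r (c : nat -> C) (v : nat -> V) N x :
  B x (vsum (fun k => scal (c k) (v k)) N)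
  = csum (fun k => (Cconj (c k) * B x (v k))%C) N.
Proof.
rewrite B_conj, form_csum_l, csum_conj; apply csum_ext; intros k _.
now rewrite Cmult_conj, <- B_conj.
Qed.

(** The unnormalized discrete Fourier transform on a cycle of length [S L], hence the factor
    [INR (S L)] in Parseval's identity. *)
Definition dft (L : nat) (v : nat -> V) (j : nat) : V :=
  vsum (fun k => scal (Cconj ((omega L ^ j) ^ k)%C) (v k)) L.

(** Summing over [j] first leaves the diagonal, by orthogonality of the characters. It is stated for
    a Hermitian form because it will be applied to the defect [inner x y - inner (T x) (T y)] and
    not to the inner product. *)
Lemma form_parseval L (v : nat -> V) :
  csum (fun j => B (dft L v j) (dft L v j)) L
  = (RtoC (INR (S L)) * csum (fun k => B (v k) (v k)) L)%C.
Proof.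
rewrite (csum_ext _ (fun j => csum (fun k => csum (fun l =>
   ((omega L ^ j) ^ l * Cconj ((omega L ^ j) ^ k) * B (v k) (v l))%C) L) L)).
2:{ intros j _; unfold dft; rewrite form_csum_l; apply csum_ext; intros k _.
    rewrite form_csum_r, <- csum_mult_l; apply csum_ext; intros l _.
    rewrite Cconj_conj; ring. }
rewrite csum_switch, <- csum_mult_l; apply csum_ext; intros k Hk.
rewrite csum_switch.
rewrite (csum_ext _ (fun l => if Nat.eqb l k then (RtoC (INR (S L)) * B (v k) (v l))%C else RtoC 0)).
- now rewrite csum_delta.
- intros l Hl; rewrite csum_mult_r; destruct (Nat.eqb_spec l k) as [->|E].
  + now rewrite omega_sum_diag.
  + rewrite omega_orthogonal by lia; ring.
Qed.

End Forms.

Section Cyclic.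
Context {V : NormedModule C_AbsRing}.

Lemma vsum_shift (g : nat -> V) L :
  plus (g 0%nat) (vsum (fun k => g (S k)) L) = vsum g (S L).
Proof.
induction L as [|L IH]; [now rewrite vsum_S, !vsum_0|].
rewrite vsum_S, plus_assoc, IH; symmetry; apply vsum_S.
Qed.

Lemma vsum_periodic (g : nat -> V) L i :
  (forall k, g (k + S L)%nat = g k) -> vsum (fun k => g (k + i)%nat) L = vsum g L.
Proof.
intros Hg; induction i as [|i IH].
- apply vsum_ext; intros k _; f_equal; lia.
- rewrite <- IH; apply (plus_reg_l (g i)).
  assert (E := vsum_shift (fun k => g (k + i)%nat) L).
  rewrite vsum_S in E; cbv beta in E.
  rewrite (vsum_ext _ (fun k => g (k + S i)%nat)) in E by (intros; f_equal; lia).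
  change (0 + i)%nat with i in E; etransitivity; [exact E|].
  etransitivity; [apply plus_comm|]; f_equal.
  rewrite Nat.add_comm; apply Hg.
Qed.

(** A cyclic correlation with the coefficients becomes multiplication by the value of the polynomial
    at [omega L ^ j]: periodicity of [u] lets the shift by [i] be absorbed into the summation at the
    price of the character value [(omega L ^ j) ^ i]. *)
Lemma dft_convolution (a : nat -> C) (u : nat -> V) N L j :
  (forall k, u (k + S L)%nat = u k) ->
  dft L (fun k => vsum (fun i => scal (a i) (u (k + i)%nat)) N) j
  = scal (csum (fun i => (a i * (omega L ^ j) ^ i)%C) N) (dft L u j).
Proof.
intros Hu; unfold dft; set (w := (omega L ^ j)%C).
assert (Hw : circle w) by apply circle_pow, circle_omega.
assert (Hp : forall i, (w ^ i * Cconj (w ^ i))%C = RtoC 1)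
  by (intros i; apply circle_conj, circle_pow, Hw).
rewrite <- vsum_scal_r.
rewrite (vsum_ext _ (fun k => vsum (fun i => scal (Cconj (w ^ k) * a i)%C (u (k + i)%nat)) N)).
2:{ intros k _; rewrite <- vsum_scal_l; apply vsum_ext; intros i _; apply scal_CC. }
rewrite vsum_switch; apply vsum_ext; intros i _.
assert (Hper : forall k, scal (Cconj (w ^ (k + S L))%C) (u (k + S L)%nat) = scal (Cconj (w ^ k)%C) (u k)).
{ intros k; rewrite Hu, Cpow_add_r; f_equal; f_equal.
  unfold w at 2; rewrite <- Cpow_mult_r, Nat.mul_comm, Cpow_mult_r, omega_order, Cpow_1_l; ring. }
etransitivity; [|exact (f_equal (scal (a i * w ^ i)%C) (vsum_periodic _ L i Hper))].
rewrite <- vsum_scal_l.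
apply vsum_ext; intros k _; rewrite scal_CC; f_equal.
rewrite Cpow_add_r, Cmult_conj.
replace (a i * w ^ i * (Cconj (w ^ k) * Cconj (w ^ i)))%C
  with (a i * Cconj (w ^ k) * (w ^ i * Cconj (w ^ i)))%C by ring.
rewrite Hp; ring.
Qed.

End Cyclic.

Section LinearMaps.
Context {U V : NormedModule C_AbsRing}.

Lemma linear_vsum (A : U -> V) (a : nat -> C) (v : nat -> U) N : is_linear A ->
  A (vsum (fun k => scal (a k) (v k)) N) = vsum (fun k => scal (a k) (A (v k))) N.
Proof.
intros HA; induction N as [|N IH].
- rewrite !vsum_0; apply (linear_scal A HA).
- rewrite !vsum_S, (linear_plus A HA), IH; f_equal; apply (linear_scal A HA).
Qed.

End LinearMaps.

Lemma is_linear_iter {V : NormedModule C_AbsRing} (T : V -> V) k :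
  is_linear T -> is_linear (Nat.iter k T).
Proof.
intros HT; induction k as [|k IH]; [apply is_linear_id|].
change (Nat.iter (S k) T) with (fun x => T (Nat.iter k T x)).
now apply (is_linear_comp (Nat.iter k T) T).
Qed.

Definition pop {V : NormedModule C_AbsRing} (N : nat) (a : nat -> C) (T : V -> V) (x : V) : V :=
  vsum (fun k => scal (a k) (Nat.iter k T x)) N.

Definition pev (N : nat) (a : nat -> C) (z : C) : C :=
  csum (fun k => (a k * z ^ k)%C) N.

Lemma iter_pop {V : NormedModule C_AbsRing} (T : V -> V) N a k x : is_linear T ->
  Nat.iter k T (pop N a T x) = vsum (fun i => scal (a i) (Nat.iter (k + i) T x)) N.
Proof.
intros HT; unfold pop.
rewrite (linear_vsum _ a (fun i => Nat.iter i T x) N (is_linear_iter T k HT)).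
apply vsum_ext; intros i _; f_equal; symmetry; apply Nat.iter_add.
Qed.

Lemma norm_iter_le {V : NormedModule C_AbsRing} (T : V -> V) r k x : 0 <= r ->
  (forall x, norm (T x) <= r * norm x) -> norm (Nat.iter k T x) <= r ^ k * norm x.
Proof.
intros Hr HT; induction k as [|k IH]; [simpl; lra|].
simpl; eapply Rle_trans; [apply HT|].
rewrite Rmult_assoc; now apply Rmult_le_compat_l.
Qed.

Section VonNeumann.
Context {H : HilbertSpace}.
Variable T : H -> H.
Hypothesis T_lin : is_linear T.

Let defect x y : C := (inner H x y - inner H (T x) (T y))%C.
Let dnorm x : R := norm x ^ 2 - norm (T x) ^ 2.

Lemma defect_diag x : defect x x = RtoC (dnorm x).
Proof.
unfold defect, dnorm; rewrite !inner_norm, RtoC_minus; reflexivity.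
Qed.

Lemma defect_telescope y K :
  rsum (fun k => dnorm (Nat.iter k T y)) K = norm y ^ 2 - norm (Nat.iter (S K) T y) ^ 2.
Proof.
induction K as [|K IH]; [now rewrite rsum_0|].
rewrite rsum_S, IH; unfold dnorm; simpl; ring.
Qed.

(* [I - T^*T] is a positive form in which the orbit of [x], wrapped around a
   cycle of length [S L], is moved by [p] as by a diagonal operator in the
   Fourier basis; wrapping does not affect the first [L - N] terms. *)
Lemma von_neumann_cyclic (N : nat) (a : nat -> C) (M : R) L x :
  (forall x, norm (T x) <= norm x) ->
  (forall z, circle z -> Cmod (pev N a z) <= M) -> (N <= L)%nat ->
  norm (pop N a T x) ^ 2 - norm (Nat.iter (S (L - N)) T (pop N a T x)) ^ 2
  <= M ^ 2 * norm x ^ 2.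
Proof.
intros T_contr HM HL.
assert (Hd : forall x, 0 <= dnorm x).
{ intros y; unfold dnorm; assert (0 <= norm (T y)) by apply norm_ge_0.
  assert (E := T_contr y); simpl; nra. }
assert (D1 : forall x y z, defect (plus x y) z = (defect x z + defect y z)%C).
{ intros; unfold defect; rewrite (linear_plus T T_lin), !inner_plus_l; ring. }
assert (D2 : forall c x y, defect (scal c x) y = (c * defect x y)%C).
{ intros; unfold defect; rewrite (linear_scal T T_lin), !inner_scal_l; ring. }
assert (D3 : forall x y, defect y x = Cconj (defect x y)).
{ intros y z; unfold defect; rewrite (inner_conj H y z), (inner_conj H (T y) (T z)).
  now rewrite <- Cminus_conj. }
set (u := fun k => Nat.iter (k mod S L) T x).
assert (Hu : forall k, u (k + S L)%nat = u k).
{ intros k; unfold u.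
  rewrite <- (Nat.Div0.mod_add k 1 (S L)), Nat.mul_1_l; reflexivity. }
set (v := fun k => vsum (fun i => scal (a i) (u (k + i)%nat)) N).
assert (Pv := form_parseval defect D1 D2 D3 L v).
assert (Pu := form_parseval defect D1 D2 D3 L u).
assert (R1 : forall w : nat -> H, csum (fun k => defect (w k) (w k)) L = RtoC (rsum (fun k => dnorm (w k)) L)).
{ intros w; rewrite <- csum_RtoC; apply csum_ext; intros; apply defect_diag. }
rewrite !R1, <- RtoC_mult in Pv, Pu; apply RtoC_inj in Pv, Pu.
assert (HS : 0 < INR (S L)) by (apply lt_0_INR; lia).
(* In each Fourier mode [v] is [u] multiplied by a value of the polynomial on the circle, and
   Parseval returns to the orbits. For [C2] and [C3] the defects along an orbit telescope. *)
assert (C1 : rsum (fun k => dnorm (v k)) L <= M ^ 2 * rsum (fun k => dnorm (u k)) L).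
{ apply (Rmult_le_reg_l (INR (S L))); [exact HS|].
  rewrite <- Pv.
  replace (INR (S L) * (M ^ 2 * rsum (fun k => dnorm (u k)) L))
    with (M ^ 2 * (INR (S L) * rsum (fun k => dnorm (u k)) L)) by ring.
  rewrite <- Pu, <- rsum_mult_l; apply rsum_le; intros j _.
  set (w := csum (fun i => (a i * (omega L ^ j) ^ i)%C) N); set (y := dft L u j).
  assert (Ev : dft L v j = scal w y) by exact (dft_convolution a u N L j Hu).
  rewrite Ev.
  assert (Hw : Cmod w <= M) by (apply HM, circle_pow, circle_omega).
  assert (E : dnorm (scal w y) = Cmod w ^ 2 * dnorm y).
  { unfold dnorm; rewrite (linear_scal T T_lin), !norm_scal_C; ring. }
  rewrite E; apply Rmult_le_compat_r; [apply Hd|].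
  apply pow_incr; split; [apply Cmod_ge_0|exact Hw]. }
assert (C2 : rsum (fun k => dnorm (u k)) L <= norm x ^ 2).
{ rewrite (rsum_ext _ (fun k => dnorm (Nat.iter k T x))).
  - rewrite defect_telescope; assert (0 <= norm (Nat.iter (S L) T x) ^ 2) by apply pow2_ge_0; lra.
  - intros k Hk; unfold u; rewrite Nat.mod_small by lia; reflexivity. }
assert (C3 : rsum (fun k => dnorm (Nat.iter k T (pop N a T x))) (L - N) <= rsum (fun k => dnorm (v k)) L).
{ rewrite (rsum_ext _ (fun k => dnorm (v k))).
  - apply rsum_le_index; [intros k; apply Hd|lia].
  - intros k Hk; f_equal; rewrite iter_pop by exact T_lin; unfold v.
    apply vsum_ext; intros i Hi; unfold u.
    rewrite Nat.mod_small by lia; reflexivity. }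
rewrite defect_telescope in C3.
assert (0 <= M ^ 2) by apply pow2_ge_0.
eapply Rle_trans; [exact C3|]; eapply Rle_trans; [exact C1|].
now apply Rmult_le_compat_l.
Qed.

(** On a cycle with [L = n + N] the loss term contains the power [S n] of [T], whatever the degree
    [N]; for [r < 1] it tends to 0 as [n] grows. *)
Lemma von_neumann_strict (N : nat) (a : nat -> C) (M r : R) x : 0 <= r < 1 ->
  (forall x, norm (T x) <= r * norm x) ->
  (forall z, circle z -> Cmod (pev N a z) <= M) ->
  norm (pop N a T x) <= M * norm x.
Proof.
intros Hr HT HM.
assert (M0 : 0 <= M).
{ eapply Rle_trans; [apply Cmod_ge_0|apply (HM (RtoC 1))].
  unfold circle; now rewrite Cmod_1. }
set (y := pop N a T x).
assert (Hy := norm_ge_0 y); assert (Hx := norm_ge_0 x).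
apply Rsqr_incr_0_var; [|now apply Rmult_le_pos].
unfold Rsqr.
apply le_epsilon; intros eps He.
assert (Hlim : exists n, r ^ n * norm y ^ 2 < eps).
{ destruct (pow_lt_1_zero r) with (y := eps / (1 + norm y ^ 2)) as [n Hn].
  - rewrite Rabs_pos_eq; lra.
  - apply Rdiv_lt_0_compat; [lra|]; assert (0 <= norm y ^ 2) by apply pow2_ge_0; lra.
  - exists n; specialize (Hn n (le_n n)).
    rewrite Rabs_pos_eq in Hn by (apply pow_le; lra).
    assert (0 <= norm y ^ 2) by apply pow2_ge_0.
    assert (0 <= r ^ n) by (apply pow_le; lra).
    apply (Rmult_lt_compat_r (1 + norm y ^ 2)) in Hn; [|lra].
    unfold Rdiv in Hn; rewrite Rmult_assoc, Rinv_l in Hn by lra; nra. }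
destruct Hlim as [n Hn].
assert (E := von_neumann_cyclic N a M (n + N) x).
fold y in E.
assert (E1 : norm y ^ 2 - norm (Nat.iter (S (n + N - N)) T y) ^ 2 <= M ^ 2 * norm x ^ 2).
{ apply E; [|exact HM|lia]; intros z; eapply Rle_trans; [apply HT|].
  assert (Hz := norm_ge_0 z); nra. }
assert (E2 : norm (Nat.iter (S (n + N - N)) T y) ^ 2 <= r ^ n * norm y ^ 2).
{ replace (n + N - N)%nat with n by lia.
  assert (E3 := norm_iter_le T r (S n) y (proj1 Hr) HT).
  assert (E4 : 0 <= norm (Nat.iter (S n) T y)) by apply norm_ge_0.
  assert (E5 : 0 <= r ^ n <= 1).
  { apply pow_unit; lra. }
  set (q := norm (Nat.iter (S n) T y)) in *; change (r ^ S n) with (r * r ^ n) in E3.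
  assert (q <= r ^ n * norm y).
  { eapply Rle_trans; [exact E3|]; apply Rmult_le_compat_r; [exact Hy|nra]. }
  assert (q ^ 2 <= (r ^ n * norm y) ^ 2) by (apply pow_incr; lra).
  eapply Rle_trans; [eassumption|].
  rewrite Rpow_mult_distr; apply Rmult_le_compat_r; [apply pow2_ge_0|]; simpl; nra. }
simpl in *; nra.
Qed.

End VonNeumann.

Definition op_scal {V : NormedModule C_AbsRing} (c : C) (T : V -> V) : V -> V :=
  fun y => scal c (T y).

Lemma iter_scal {V : NormedModule C_AbsRing} (T : V -> V) (c : C) k x : is_linear T ->
  Nat.iter k (op_scal c T) x = scal (c ^ k)%C (Nat.iter k T x).
Proof.
intros HT; induction k as [|k IH]; [simpl; now rewrite scal_C1|].
simpl; rewrite IH; unfold op_scal; rewrite (linear_scal T HT), scal_CC; reflexivity.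
Qed.

Lemma is_linear_scal_C {V : NormedModule C_AbsRing} (T : V -> V) (c : C) :
  is_linear T -> is_linear (op_scal c T).
Proof.
intros HT; split.
- intros x y; unfold op_scal; rewrite (linear_plus T HT); apply scal_plus.
- intros k x; unfold op_scal; rewrite (linear_scal T HT).
  change (scal c (scal (k : C) (T x)) = scal (k : C) (scal c (T x))).
  now rewrite !scal_CC, Cmult_comm.
- destruct (linear_norm T HT) as [K [HK1 HK2]]; exists ((1 + Cmod c) * K); split.
  + assert (E := Cmod_ge_0 c); nra.
  + intros x; unfold op_scal; rewrite norm_scal_C; specialize (HK2 x); assert (E := Cmod_ge_0 c).
    assert (E2 := norm_ge_0 (T x)); rewrite Rmult_assoc.
    apply Rmult_le_compat; lra.
Qed.

Lemma pop_scal {V : NormedModule C_AbsRing} (T : V -> V) (c : C) N a x : is_linear T ->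
  pop N a (op_scal c T) x = pop N (fun k => (a k * c ^ k)%C) T x.
Proof.
intros HT; unfold pop; apply vsum_ext; intros k _.
rewrite iter_scal by exact HT; apply scal_CC.
Qed.

Lemma pow_ge_linear r k : 0 <= r <= 1 -> 1 - r ^ k <= INR k * (1 - r).
Proof.
intros Hr; induction k as [|k IH]; [simpl; lra|].
rewrite S_INR; simpl; assert (0 <= r ^ k <= 1).
{ apply pow_unit; lra. }
nra.
Qed.

(** The powers of a contraction need not tend to 0, so the strict case is applied to [(1 - e) T] and
    [e] tends to 0. [K] is a Lipschitz constant in [e] of the polynomial of [(1 - e) T] at [x]. *)
Theorem von_neumann {H : HilbertSpace} (T : H -> H) (N : nat) (a : nat -> C) (M : R) x :
  is_linear T -> (forall x, norm (T x) <= norm x) ->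
  (forall z, circle z -> Cmod (pev N a z) <= M) ->
  norm (pop N a T x) <= M * norm x.
Proof.
intros HT HT1 HM.
set (K := rsum (fun k => INR k * Cmod (a k) * norm x) N).
assert (HK : 0 <= K).
{ apply rsum_nonneg; intros k _; assert (E1 := pos_INR k); assert (E2 := Cmod_ge_0 (a k)).
  assert (E3 := norm_ge_0 x); apply Rmult_le_pos; [now apply Rmult_le_pos|exact E3]. }
apply le_epsilon; intros eps He.
set (e := Rmin (1 / 2) (eps / (1 + K))).
assert (He' : 0 < e) by (apply Rmin_pos; [lra|apply Rdiv_lt_0_compat; lra]).
assert (He1 : e <= 1 / 2) by apply Rmin_l.
assert (He2 : e * K <= eps).
{ assert (E : e <= eps / (1 + K)) by apply Rmin_r.
  apply (Rmult_le_compat_r (1 + K)) in E; [|lra].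
  unfold Rdiv in E; rewrite Rmult_assoc, Rinv_l in E by lra; nra. }
assert (E1 := von_neumann_strict (op_scal (RtoC (1 - e)) T)
  (is_linear_scal_C T _ HT) N a M (1 - e) x).
assert (E2 : norm (pop N a (op_scal (RtoC (1 - e)) T) x) <= M * norm x).
{ apply E1; [lra| |exact HM]; intros y; unfold op_scal; rewrite norm_scal_C, Cmod_R, Rabs_pos_eq by lra.
  apply Rmult_le_compat_l; [lra|apply HT1]. }
rewrite pop_scal in E2 by exact HT.
assert (E3 : norm (minus (pop N a T x) (pop N (fun k => (a k * RtoC (1 - e) ^ k)%C) T x)) <= e * K).
{ unfold pop; rewrite <- vsum_minus; eapply Rle_trans; [apply norm_vsum_le|].
  unfold K; rewrite <- rsum_mult_l; apply rsum_le; intros k _.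
  rewrite <- scal_minus_C, norm_scal_C.
  replace (a k - a k * RtoC (1 - e) ^ k)%C with (a k * RtoC (1 - (1 - e) ^ k))%C
    by (rewrite RtoC_minus, RtoC_pow; ring).
  assert (Hp : 0 <= (1 - e) ^ k <= 1).
  { apply pow_unit; lra. }
  rewrite Cmod_mult, Cmod_R, Rabs_pos_eq by lra.
  assert (P := pow_ge_linear (1 - e) k ltac:(lra)).
  assert (I : norm (Nat.iter k T x) <= 1 ^ k * norm x).
  { apply norm_iter_le; [lra|]; intros y; rewrite Rmult_1_l; apply HT1. }
  rewrite pow1, Rmult_1_l in I.
  replace (e * (INR k * Cmod (a k) * norm x)) with (Cmod (a k) * (INR k * (1 - (1 - e))) * norm x) by ring.
  apply Rmult_le_compat; [apply Rmult_le_pos; [apply Cmod_ge_0|lra]|apply norm_ge_0| |exact I].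
  apply Rmult_le_compat_l; [apply Cmod_ge_0|exact P]. }
set (p1 := pop N a T x) in *; set (p2 := pop N _ T x) in *.
assert (E4 := norm_le_plus_minus p1 p2); lra.
Qed.

(** * A Bernstein inequality for operator differences *)

Lemma csum_S_l (f : nat -> C) N : csum f (S N) = (f 0%nat + csum (fun k => f (S k)) N)%C.
Proof.
induction N as [|N IH]; [now rewrite csum_S, !csum_0|].
rewrite csum_S, IH, csum_S; ring.
Qed.

Lemma csum_rev (f : nat -> C) N : csum f N = csum (fun k => f (N - k)%nat) N.
Proof.
induction N as [|N IH]; [now rewrite !csum_0|].
rewrite csum_S, csum_S_l, IH, Cplus_comm; f_equal.
Qed.

Lemma pev_horner N a z :
  pev (S N) a z = (a 0%nat + z * pev N (fun k => a (S k)) z)%C.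
Proof.
unfold pev; rewrite csum_S_l, <- csum_mult_l; f_equal; [simpl; ring|].
apply csum_ext; intros k _; simpl; ring.
Qed.

Lemma pev_minus N a b z : pev N (fun k => (a k - b k)%C) z = (pev N a z - pev N b z)%C.
Proof.
unfold pev; rewrite <- csum_minus; apply csum_ext; intros k _; ring.
Qed.

(** The quotient is again a polynomial of the same format, so the division can be repeated: one
    division gives continuity, two give the second-order remainder and hence differentiability, with
    no formula for the derivative. *)
Lemma pev_factor N a z : exists b, forall w, (pev N a w - pev N a z)%C = ((w - z) * pev N b w)%C.
Proof.
revert a; induction N as [|N IH]; intros a.
- exists (fun _ => RtoC 0); intros w; unfold pev; rewrite !csum_0; simpl; ring.
- destruct (IH (fun k => a (S k))) as [b Hb].
  set (g := pev N (fun k => a (S k)) z).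
  exists (fun k => match k with O => g | S k => b k end); intros w.
  rewrite !pev_horner; specialize (Hb w); fold g in Hb |- *.
  change (fun k => b k) with b.
  replace (pev N (fun k => a (S k)) w) with ((w - z) * pev N b w + g)%C by (rewrite <- Hb; ring).
  ring.
Qed.

Lemma Cmod_pev_le N a z r : Cmod z <= r -> Cmod (pev N a z) <= rsum (fun k => Cmod (a k) * r ^ k) N.
Proof.
intros Hz; unfold pev; eapply Rle_trans; [apply Cmod_csum_le|].
apply rsum_le; intros k _; rewrite Cmod_mult, Cmod_pow.
apply Rmult_le_compat_l; [apply Cmod_ge_0|].
apply pow_incr; split; [apply Cmod_ge_0|exact Hz].
Qed.

Lemma cdiff_pev N a z : Cmod z < 1 -> cdiff_at (pev N a) z.
Proof.
intros Hz; destruct (pev_factor N a z) as [b Hb]; destruct (pev_factor N b z) as [c Hc].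
apply cdiff_quadratic with (l := pev N b z) (K := rsum (fun k => Cmod (c k) * 1 ^ k) N);
  [|intros w Hw|exact Hz].
- apply rsum_nonneg; intros k _; apply Rmult_le_pos; [apply Cmod_ge_0|apply pow_le; lra].
- rewrite Hb.
  replace ((w - z) * pev N b w - pev N b z * (w - z))%C
    with ((pev N b w - pev N b z) * (w - z))%C by ring.
  rewrite Hc.
  replace ((w - z) * pev N c w * (w - z))%C with (pev N c w * (w - z) ^ 2)%C by (simpl; ring).
  rewrite Cmod_mult, Cmod_pow; apply Rmult_le_compat_r; [apply pow2_ge_0|].
  apply Cmod_pev_le; assert (E := Cmod_minus_ge w z); lra.
Qed.

Lemma cont_pev N a : cont_on closed_disk (pev N a).
Proof.
intros z Hz eps He; destruct (pev_factor N a z) as [b Hb].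
set (K := rsum (fun k => Cmod (b k) * 1 ^ k) N).
assert (HK : 0 <= K).
{ apply rsum_nonneg; intros k _; apply Rmult_le_pos; [apply Cmod_ge_0|apply pow_le; lra]. }
exists (eps / (1 + K)); split; [apply Rdiv_lt_0_compat; lra|]; intros w Hw Hwz.
rewrite Hb, Cmod_mult.
assert (E := Cmod_pev_le N b w 1 Hw); fold K in E.
apply lt_div_mult in Hwz; [|lra].
assert (P := Cmod_ge_0 (w - z)%C); assert (Q := Cmod_ge_0 (pev N b w)); nra.
Qed.

Lemma maximum_principle_pev N a M :
  (forall z, circle z -> Cmod (pev N a z) <= M) ->
  forall z, Cmod z <= 1 -> Cmod (pev N a z) <= M.
Proof.
apply maximum_principle; [apply cont_pev|intros z Hz; now apply cdiff_pev].
Qed.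

Lemma pev_reverse N a z : z <> RtoC 0 ->
  pev N a z = (z ^ N * pev N (fun k => a (N - k)%nat) (/ z))%C.
Proof.
intros Hz; unfold pev; rewrite csum_rev, <- csum_mult_l; apply csum_ext; intros k Hk.
rewrite <- (Cmult_1_r (a (N - k)%nat * z ^ (N - k))%C).
replace (RtoC 1) with (z ^ k * (/ z) ^ k)%C.
- replace (z ^ N)%C with (z ^ (N - k) * z ^ k)%C by (rewrite <- Cpow_add_r; f_equal; lia); ring.
- rewrite <- Cpow_mult_l, Cinv_r by exact Hz; apply Cpow_1_l.
Qed.

(** The polynomial with reversed coefficients inherits the bound [M] on the circle, hence on the
    disk by the maximum principle, and the disk contains [/ z]. *)
Lemma pev_growth N a M z :
  (forall z, circle z -> Cmod (pev N a z) <= M) -> 1 <= Cmod z ->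
  Cmod (pev N a z) <= Cmod z ^ N * M.
Proof.
intros HM Hz.
assert (Z : forall w : C, 1 <= Cmod w -> w <> RtoC 0) by (intros w Hw E; rewrite E, Cmod_0 in Hw; lra).
rewrite pev_reverse by (now apply Z).
rewrite Cmod_mult, Cmod_pow; apply Rmult_le_compat_l; [apply pow_le; lra|].
apply maximum_principle_pev.
- intros w Hw; assert (Hw1 : 1 <= Cmod w) by (unfold circle in Hw; lra).
  assert (Hw' : circle (/ w)%C).
  { unfold circle; rewrite Cmod_inv by (now apply Z); rewrite Hw; field. }
  specialize (HM _ Hw'); rewrite pev_reverse in HM.
  + replace (/ / w)%C with w in HM by (field; now apply Z).
    rewrite Cmod_mult, Cmod_pow, Hw', pow1, Rmult_1_l in HM; exact HM.
  + apply Z; unfold circle in Hw'; lra.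
- rewrite Cmod_inv by (now apply Z); rewrite <- Rinv_1; apply Rinv_le_contravar; lra.
Qed.

(** Dividing [A] by [r] gives a contraction; the factor is moved into the polynomial, whose growth
    on the circle of radius [r] is known. *)
Lemma pop_growth {H : HilbertSpace} (A : H -> H) N a M r x : is_linear A -> 1 <= r ->
  (forall x, norm (A x) <= r * norm x) ->
  (forall z, circle z -> Cmod (pev N a z) <= M) ->
  norm (pop N a A x) <= r ^ N * M * norm x.
Proof.
intros HA Hr Hn HM.
assert (Rr : RtoC r <> RtoC 0) by (intros E; apply RtoC_inj in E; lra).
assert (E : pop N a A x = pop N (fun k => (a k * RtoC r ^ k)%C) (op_scal (/ RtoC r)%C A) x).
{ rewrite pop_scal by exact HA; unfold pop; apply vsum_ext; intros k _; f_equal.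
  rewrite <- Cmult_assoc, <- Cpow_mult_l, Cinv_r, Cpow_1_l by exact Rr; ring. }
rewrite E; apply von_neumann; [now apply is_linear_scal_C| |].
- intros y; unfold op_scal; rewrite norm_scal_C, Cmod_inv, Cmod_R, Rabs_pos_eq by (exact Rr || lra).
  apply (Rmult_le_reg_l r); [lra|]; rewrite <- Rmult_assoc, Rinv_r, Rmult_1_l by lra; apply Hn.
- intros z Hz.
  replace (pev N (fun k => (a k * RtoC r ^ k)%C) z) with (pev N a (RtoC r * z)%C).
  + eapply Rle_trans; [apply (pev_growth N a M)|].
    * exact HM.
    * rewrite Cmod_mult, Hz, Cmod_R, Rabs_pos_eq; lra.
    * rewrite Cmod_mult, Hz, Cmod_R, Rabs_pos_eq, Rmult_1_r; lra.
  + unfold pev; apply csum_ext; intros k _; rewrite Cpow_mult_l; ring.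
Qed.

(** [op_segment T Q t] is convertible to such a path with direction [op_minus Q T] and real
    parameter; Cauchy's estimates require complex parameters. *)
Definition op_path {V : NormedModule C_AbsRing} (T D : V -> V) (l : C) : V -> V :=
  fun y => plus (T y) (scal l (D y)).

Section Path.
Context {V : NormedModule C_AbsRing}.
Variables T D : V -> V.
Hypothesis T_lin : is_linear T.
Hypothesis D_lin : is_linear D.

Lemma op_path_linear l : is_linear (op_path T D l).
Proof.
split.
- intros x y; unfold op_path; rewrite (linear_plus T T_lin), (linear_plus D D_lin), scal_plus.
  rewrite <- !plus_assoc; f_equal; rewrite !plus_assoc; f_equal; apply plus_comm.
- intros k x; unfold op_path; rewrite (linear_scal T T_lin), (linear_scal D D_lin).
  etransitivity; [|symmetry; apply scal_plus]; f_equal.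
  etransitivity; [apply scal_CC|]; etransitivity; [|symmetry; apply scal_CC].
  f_equal; apply Cmult_comm.
- destruct (linear_norm T T_lin) as [K [K0 HK]]; destruct (linear_norm D D_lin) as [K' [K0' HK']].
  assert (L0 := Cmod_ge_0 l); exists (K + Cmod l * K'); split; [nra|].
  intros x; unfold op_path; eapply Rle_trans; [apply norm_triangle|].
  rewrite norm_scal_C, Rmult_plus_distr_r, Rmult_assoc; apply Rplus_le_compat; [apply HK|].
  apply Rmult_le_compat_l; [exact L0|apply HK'].
Qed.

Lemma norm_op_path_le l d x : norm (T x) <= norm x -> norm (D x) <= d * norm x ->
  norm (op_path T D l x) <= (1 + Cmod l * d) * norm x.
Proof.
intros HT HD; unfold op_path; eapply Rle_trans; [apply norm_triangle|].
rewrite norm_scal_C, Rmult_plus_distr_r, Rmult_1_l, Rmult_assoc.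
apply Rplus_le_compat; [exact HT|]; apply Rmult_le_compat_l; [apply Cmod_ge_0|exact HD].
Qed.

(** [T] and [D] may fail to commute, so the coefficients come from a recursion and not from the
    binomial formula. Their vanishing beyond [k] allows expansions of different lengths to be
    added. *)
Lemma iter_path_expansion k x : exists g : nat -> V,
  (forall j, (k < j)%nat -> g j = zero) /\
  forall l, Nat.iter k (op_path T D l) x = vsum (fun j => scal (l ^ j)%C (g j)) k.
Proof.
induction k as [|k [g [Hg1 Hg2]]].
- exists (fun j => match j with O => x | _ => zero end); split.
  + intros [|j] Hj; [lia|reflexivity].
  + intros l; rewrite vsum_0; symmetry; apply scal_C1.
- set (sh := fun j => match j with O => zero | S j => D (g j) end).
  exists (fun j => plus (T (g j)) (sh j)).
  assert (T0 : T zero = zero) by apply (linear_zero (K := C_AbsRing) T T_lin).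
  assert (D0 : D zero = zero) by apply (linear_zero (K := C_AbsRing) D D_lin).
  split.
  + intros [|j] Hj; [lia|]; simpl; rewrite !Hg1 by lia; rewrite T0, D0; apply plus_zero_l.
  + intros l; simpl; rewrite Hg2; unfold op_path at 1.
    rewrite (linear_vsum T) by exact T_lin; rewrite (linear_vsum D) by exact D_lin.
    rewrite (vsum_ext (fun j => scal (l ^ j)%C (plus (T (g j)) (sh j)))
       (fun j => plus (scal (l ^ j)%C (T (g j)) : V) (scal (l ^ j)%C (sh j) : V)))
      by (intros j _; apply scal_plus).
    rewrite vsum_plus; f_equal.
    * rewrite vsum_S, Hg1 by lia; rewrite T0.
      assert (Z : scal (l ^ S k)%C (zero : V) = zero) by apply (@scal_zero_r C_Ring V).
      rewrite Z; symmetry; apply plus_zero_r.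
    * rewrite <- vsum_shift; unfold sh at 1.
      assert (Z : scal (l ^ 0)%C (zero : V) = zero) by apply (@scal_zero_r C_Ring V).
      rewrite Z; rewrite <- vsum_scal_l.
      etransitivity; [|symmetry; apply plus_zero_l].
      apply vsum_ext; intros j _; rewrite scal_CC; reflexivity.
Qed.

Lemma pop_path_expansion N a x : exists g : nat -> V,
  (forall j, (N < j)%nat -> g j = zero) /\
  forall l, pop N a (op_path T D l) x = vsum (fun j => scal (l ^ j)%C (g j)) N.
Proof.
assert (Z0 : forall c : C, scal c (zero : V) = zero) by (intros c; apply (@scal_zero_r C_Ring V)).
induction N as [|N [g [Hg1 Hg2]]].
- exists (fun j => match j with O => scal (a 0%nat) x | _ => zero end); split.
  + intros [|j] Hj; [lia|reflexivity].
  + intros l; unfold pop; rewrite !vsum_0; symmetry; apply scal_C1.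
- destruct (iter_path_expansion (S N) x) as [h [Hh1 Hh2]].
  exists (fun j => plus (g j) (scal (a (S N)) (h j))); split.
  + intros j Hj; rewrite Hg1, Hh1, Z0 by lia; apply plus_zero_l.
  + intros l; unfold pop; rewrite vsum_S; fold (pop N a (op_path T D l) x).
    rewrite Hg2, Hh2.
    rewrite (vsum_ext (fun j => scal (l ^ j)%C (plus (g j) (scal (a (S N)) (h j))))
       (fun j => plus (scal (l ^ j)%C (g j) : V) (scal (a (S N)) (scal (l ^ j)%C (h j)) : V))).
    2:{ intros j _; rewrite scal_plus, !scal_CC; f_equal; f_equal; ring. }
    rewrite vsum_plus, vsum_scal_l; f_equal.
    rewrite vsum_S, Hg1, Z0 by lia; symmetry; apply plus_zero_r.
Qed.

End Path.

(** Averaging over the [S N] points [r * omega N ^ s] against the conjugate character recovers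
    [r ^ i * g i] exactly, since the degree [N] is below the number of nodes. *)
Lemma cauchy_estimate {V : NormedModule C_AbsRing} (g : nat -> V) N r B i : 0 <= r -> (i <= N)%nat ->
  (forall l, Cmod l = r -> norm (vsum (fun j => scal (l ^ j)%C (g j)) N) <= B) ->
  r ^ i * norm (g i) <= B.
Proof.
intros Hr Hi HB.
set (w := fun s => (omega N ^ s)%C).
assert (Hw : forall s, circle (w s)) by (intros s; apply circle_pow, circle_omega).
assert (HS : 0 < INR (S N)) by (apply lt_0_INR; lia).
assert (E : vsum (fun s => scal (Cconj (w s ^ i)%C)
    (vsum (fun j => scal ((RtoC r * w s) ^ j)%C (g j)) N)) N
  = scal (RtoC (INR (S N) * r ^ i)) (g i)).
{ rewrite (vsum_ext _ (fun s => vsum (fun j =>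
     scal (RtoC (r ^ j) * (w s ^ j * Cconj (w s ^ i)))%C (g j)) N)).
  2:{ intros s _; rewrite <- vsum_scal_l; apply vsum_ext; intros j _.
      rewrite scal_CC, Cpow_mult_l, RtoC_pow; f_equal; ring. }
  rewrite vsum_switch.
  rewrite (vsum_ext _ (fun j => if Nat.eqb j i then scal (RtoC (INR (S N) * r ^ j)) (g j) else zero)).
  - exact (vsum_delta (fun j => scal (RtoC (INR (S N) * r ^ j)) (g j)) i N Hi).
  - intros j Hj; rewrite (vsum_scal_r (fun s => (RtoC (r ^ j) * (w s ^ j * Cconj (w s ^ i)))%C)).
    rewrite csum_mult_l; destruct (Nat.eqb_spec j i) as [->|Hne].
    + unfold w; rewrite omega_sum_diag, RtoC_mult; f_equal; ring.
    + unfold w; rewrite omega_orthogonal by lia.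
      rewrite Cmult_0_r; apply scal_C0. }
apply (f_equal norm) in E; rewrite norm_scal_C, Cmod_R, Rabs_pos_eq in E
  by (apply Rmult_le_pos; [lra|now apply pow_le]).
apply (Rmult_le_reg_l (INR (S N))); [exact HS|].
rewrite <- Rmult_assoc, <- E, <- rsum_const.
eapply Rle_trans; [apply norm_vsum_le|]; apply rsum_le; intros s _.
rewrite norm_scal_C, Cmod_conj, (circle_pow _ i (Hw s)), Rmult_1_l.
apply HB; rewrite Cmod_mult, (Hw s), Cmod_R, Rabs_pos_eq; lra.
Qed.

(** [Binomial.C m k] does not vanish for [k > m], because [m - k] is truncated; extended by 0,
    Pascal's rule holds without side conditions. *)
Definition binom (m k : nat) : R := if le_dec k m then Binomial.C m k else 0.

Lemma binom_pascal m k : binom (S m) (S k) = binom m k + binom m (S k).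
Proof.
unfold binom; destruct (le_dec (S k) (S m)), (le_dec k m), (le_dec (S k) m); try lia.
- symmetry; apply Binomial.pascal; lia.
- replace k with m by lia; unfold Binomial.C; rewrite !Nat.sub_diag; simpl.
  field; split; [apply INR_fact_neq_0|].
  apply (not_0_INR (fact (S m))), fact_neq_0.
- ring.
Qed.

Lemma binom_0 m : binom m 0 = 1.
Proof.
unfold binom; destruct (le_dec 0 m); [|lia]; unfold Binomial.C; rewrite Nat.sub_0_r; simpl.
field; apply INR_fact_neq_0.
Qed.

Lemma binom_gt m k : (m < k)%nat -> binom m k = 0.
Proof. intros H; unfold binom; destruct (le_dec k m); [lia|reflexivity]. Qed.

(** Up to the sign [(-1) ^ m], the [m]-th forward difference of [phi] at 0. *)
Definition alt_sum (m : nat) (phi : nat -> R) : R :=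
  rsum (fun k => (-1) ^ k * Binomial.C m k * phi k) m.

Lemma alt_sum_binom m phi : alt_sum m phi = rsum (fun k => (-1) ^ k * binom m k * phi k) m.
Proof.
apply rsum_ext; intros k Hk; unfold binom; destruct (le_dec k m); [reflexivity|lia].
Qed.

Lemma rsum_S_l (f : nat -> R) N : rsum f (S N) = f 0%nat + rsum (fun k => f (S k)) N.
Proof.
induction N as [|N IH]; [now rewrite rsum_S, !rsum_0|].
rewrite rsum_S, IH, rsum_S; ring.
Qed.

Lemma alt_sum_S m phi : alt_sum (S m) phi = - alt_sum m (fun k => phi (S k) - phi k).
Proof.
rewrite !alt_sum_binom, rsum_S_l.
rewrite (rsum_ext _ (fun k => -1 * ((-1) ^ k * binom m k * phi (S k))
                              + (-1) ^ S k * binom m (S k) * phi (S k))).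
2:{ intros k _; rewrite binom_pascal; simpl; ring. }
rewrite rsum_plus, rsum_mult_l.
assert (E : rsum (fun k => (-1) ^ k * binom m k * phi k) (S m)
  = rsum (fun k => (-1) ^ k * binom m k * phi k) m).
{ rewrite rsum_S, binom_gt by lia; ring. }
rewrite rsum_S_l in E; rewrite binom_0 in E |- *.
rewrite (rsum_ext (fun k => (-1) ^ k * binom m k * (phi (S k) - phi k))
  (fun k => (-1) ^ k * binom m k * phi (S k) + -1 * ((-1) ^ k * binom m k * phi k)))
  by (intros; ring).
rewrite rsum_plus, rsum_mult_l, <- E; ring.
Qed.

(** The [d]-th forward difference vanishes identically: [phi] is a polynomial of degree less than
    [d] on the natural numbers. *)
Fixpoint low_degree (d : nat) (phi : nat -> R) : Prop :=
  match d with
  | O => forall k, phi k = 0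
  | S d => low_degree d (fun k => phi (S k) - phi k)
  end.

Lemma low_degree_ext d phi psi : (forall k, phi k = psi k) -> low_degree d phi -> low_degree d psi.
Proof.
revert phi psi; induction d as [|d IH]; intros phi psi E; simpl.
- intros H k; now rewrite <- E.
- apply IH; intros k; now rewrite !E.
Qed.

Lemma low_degree_plus d phi psi :
  low_degree d phi -> low_degree d psi -> low_degree d (fun k => phi k + psi k).
Proof.
revert phi psi; induction d as [|d IH]; intros phi psi; simpl.
- intros H1 H2 k; rewrite H1, H2; ring.
- intros H1 H2; eapply low_degree_ext; [|exact (IH _ _ H1 H2)]; intros k; simpl; ring.
Qed.

Lemma low_degree_S d phi : low_degree d phi -> low_degree (S d) phi.
Proof.
revert phi; induction d as [|d IH]; intros phi; simpl.
- intros H k; rewrite !H; ring.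
- intros H; exact (IH _ H).
Qed.

Lemma low_degree_shift d phi : low_degree d phi -> low_degree d (fun k => phi (S k)).
Proof.
revert phi; induction d as [|d IH]; intros phi; simpl.
- intros H k; apply H.
- intros H; apply (IH _ H).
Qed.

(** Leibniz's rule for differences: that of [k * phi k] is [k] times the difference of [phi], plus
    the shift [phi (S k)]. *)
Lemma low_degree_mult d phi : low_degree d phi -> low_degree (S d) (fun k => INR k * phi k).
Proof.
revert phi; induction d as [|d IH]; intros phi H.
- intros k; simpl in H; rewrite !H; ring.
- change (low_degree (S d) (fun k => INR (S k) * phi (S k) - INR k * phi k)).
  apply low_degree_ext with (fun k => INR k * (phi (S k) - phi k) + phi (S k)).
  + intros k; rewrite S_INR; ring.
  + apply low_degree_plus; [apply IH; exact H|apply (low_degree_shift (S d)); exact H].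
Qed.

Lemma low_degree_pow j : low_degree (S j) (fun k => INR k ^ j).
Proof.
induction j as [|j IH]; [intros k; simpl; ring|].
apply (low_degree_mult (S j)); exact IH.
Qed.

Lemma alt_sum_low_degree m phi : low_degree m phi -> alt_sum m phi = 0.
Proof.
revert phi; induction m as [|m IH]; intros phi H.
- unfold alt_sum; rewrite rsum_0, H; ring.
- rewrite alt_sum_S, IH; [ring|exact H].
Qed.

Lemma alt_sum_pow m j c : (j < m)%nat -> alt_sum m (fun k => (INR k * c) ^ j) = 0.
Proof.
intros Hj; unfold alt_sum.
rewrite (rsum_ext _ (fun k => c ^ j * ((-1) ^ k * Binomial.C m k * INR k ^ j))).
- rewrite rsum_mult_l; fold (alt_sum m (fun k => INR k ^ j)).
  rewrite alt_sum_low_degree; [ring|].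
  assert (P := low_degree_pow j); induction Hj as [|m Hj IH]; [exact P|now apply low_degree_S].
- intros k _; rewrite Rpow_mult_distr; ring.
Qed.

Lemma Rabs_rsum_le (f : nat -> R) N : Rabs (rsum f N) <= rsum (fun k => Rabs (f k)) N.
Proof.
induction N as [|N IH]; [rewrite !rsum_0; lra|].
rewrite !rsum_S; eapply Rle_trans; [apply Rabs_triang|lra].
Qed.

(** Equal to [2 ^ m]: what an [m]-th difference can gain on a bounded sequence. *)
Definition alt_mass (m : nat) : R := rsum (fun k => Rabs ((-1) ^ k * Binomial.C m k)) m.

Lemma alt_mass_nonneg m : 0 <= alt_mass m.
Proof. apply rsum_nonneg; intros; apply Rabs_pos. Qed.

Lemma alt_sum_bound m phi B : (forall k, (k <= m)%nat -> Rabs (phi k) <= B) ->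
  Rabs (alt_sum m phi) <= alt_mass m * B.
Proof.
intros HB; unfold alt_sum, alt_mass; rewrite Rmult_comm, <- rsum_mult_l.
eapply Rle_trans; [apply Rabs_rsum_le|]; apply rsum_le; intros k Hk.
rewrite Rabs_mult, Rmult_comm; apply Rmult_le_compat_r; [apply Rabs_pos|now apply HB].
Qed.

Definition vdiff {V : NormedModule C_AbsRing} (m : nat) (h : nat -> V) : V :=
  vsum (fun k => scal (RtoC ((-1) ^ k * Binomial.C m k)) (h k)) m.

Lemma vdiff_bound {V : NormedModule C_AbsRing} m (h : nat -> V) B :
  (forall k, (k <= m)%nat -> norm (h k) <= B) -> norm (vdiff m h) <= alt_mass m * B.
Proof.
intros HB; unfold vdiff; eapply Rle_trans; [apply norm_vsum_le|].
unfold alt_mass; rewrite Rmult_comm, <- rsum_mult_l; apply rsum_le; intros k Hk.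
rewrite norm_scal_C, Cmod_R, Rmult_comm; apply Rmult_le_compat_r; [apply Rabs_pos|now apply HB].
Qed.

Lemma geometric_tail q m N : 0 <= q <= 1 / 2 ->
  rsum (fun j => if le_dec m j then q ^ j else 0) N <= 2 * q ^ m.
Proof.
intros Hq.
assert (P : forall k, 0 <= q ^ k) by (intros k; apply pow_le; lra).
(* The claim is strengthened by a second copy of the last term: in the induction step two copies of
   [q ^ S N] are paid for by one [q ^ N]. *)
assert (S : rsum (fun j => if le_dec m j then q ^ j else 0) N
   + (if le_dec m N then q ^ N else 0) <= 2 * q ^ m).
{ induction N as [|N IH].
  - rewrite rsum_0; destruct (le_dec m 0); [replace m with 0%nat by lia; simpl; lra|].
    specialize (P m); lra.
  - rewrite rsum_S; destruct (le_dec m (S N)), (le_dec m N); try lia.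
    + assert (q ^ S N <= q ^ N / 2) by (simpl; specialize (P N); nra); lra.
    + replace m with (S N) in * by lia.
      assert (Z : rsum (fun j => if le_dec (S N) j then q ^ j else 0) N = 0).
      { rewrite (rsum_ext _ (fun _ => 0)); [rewrite rsum_const; ring|].
        intros j Hj; destruct (le_dec (S N) j); [lia|reflexivity]. }
      rewrite Z; lra.
    + lra. }
destruct (le_dec m N); [specialize (P N)|]; lra.
Qed.

Lemma one_plus_inv_pow_le N : (0 < N)%nat -> (1 + / INR N) ^ N <= 3.
Proof.
intros HN; assert (H0 : 0 < INR N) by (now apply lt_0_INR).
assert (Hi : 0 < / INR N) by (now apply Rinv_0_lt_compat).
apply Rle_trans with (exp (/ INR N) ^ N).
- apply pow_incr; split; [lra|apply exp_ineq1_le].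
- assert (E : forall n t, exp t ^ n = exp (INR n * t)).
  { intros n t; induction n as [|n IH]; [simpl; now rewrite Rmult_0_l, exp_0|].
    rewrite S_INR, Rmult_plus_distr_r, Rmult_1_l, exp_plus, <- IH; simpl; ring. }
  rewrite E, Rinv_r by lra; apply exp_le_3.
Qed.

Section Bernstein.
Context {H : HilbertSpace}.
Variables T Q : H -> H.
Hypothesis T_lin : is_linear T.
Hypothesis Q_lin : is_linear Q.
Hypothesis T_contr : forall x, norm (T x) <= norm x.
Hypothesis Q_contr : forall x, norm (Q x) <= norm x.

Lemma op_minus_linear : is_linear (op_minus Q T).
Proof.
change (op_minus Q T) with (fun x : H => minus (Q x) (T x)).
split.
- intros x y; rewrite (linear_plus Q Q_lin), (linear_plus T T_lin).
  exact (minus_plus_plus (Q x) (Q y) (T x) (T y)).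
- intros k x; rewrite (linear_scal Q Q_lin), (linear_scal T T_lin).
  symmetry; exact (scal_minus k (Q x) (T x)).
- exists 2; split; [lra|]; intros x.
  eapply Rle_trans; [exact (norm_minus_le (Q x) (T x))|].
  assert (E1 := T_contr x); assert (E2 := Q_contr x); lra.
Qed.

Lemma op_segment_linear t : is_linear (op_segment T Q t).
Proof. apply (op_path_linear T (op_minus Q T) T_lin op_minus_linear). Qed.

Lemma op_segment_contr t x : 0 <= t <= 1 -> norm (op_segment T Q t x) <= norm x.
Proof.
intros Ht; exact (norm_segment_le t _ _ _ Ht (T_contr x) (Q_contr x)).
Qed.

(** Put [q = N * d]. If [q <= 1/2], Cauchy's estimates on [Cmod l = / q], where [Cmod l * d = / N]
    and [(1 + / N) ^ N <= 3], bound the coefficients by [3 * M * q ^ j], and the terms from [j = m]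
    on sum to at most twice the first one: this is the 6. If [q > 1/2], the bound by von Neumann's
    inequality is enough since [1 <= (2 * q) ^ m]: this is the [2 ^ m]. *)
Theorem operator_bernstein m N a M d x : (0 < m)%nat -> 0 < d ->
  (forall x, norm (minus (Q x) (T x)) <= d * norm x) ->
  (forall z, circle z -> Cmod (pev N a z) <= M) ->
  norm (vdiff m (fun k => pop N a (op_segment T Q (INR k / INR m)) x))
  <= alt_mass m * (6 + 2 ^ m) * (INR N * d) ^ m * M * norm x.
Proof.
intros Hm Hd HD HM.
assert (M0 : 0 <= M).
{ eapply Rle_trans; [apply Cmod_ge_0|apply (HM (RtoC 1))]; unfold circle; now rewrite Cmod_1. }
assert (X0 := norm_ge_0 x); assert (A0 := alt_mass_nonneg m); assert (N0 := pos_INR N).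
assert (Hmr : 0 < INR m) by (now apply lt_0_INR).
assert (P2 : 0 < 2 ^ m) by (apply pow_lt; lra).
assert (Hq : 0 <= INR N * d) by (apply Rmult_le_pos; lra).
assert (Hqm : 0 <= (INR N * d) ^ m) by (now apply pow_le).
assert (HMX : 0 <= M * norm x) by (now apply Rmult_le_pos).
destruct (Rle_dec (INR N * d) (1 / 2)) as [Hs|Hs].
- set (D := op_minus Q T).
  destruct (pop_path_expansion T D T_lin op_minus_linear N a x) as [g [_ Hg]].
  (* After interchanging the sums the difference acts on the scalars [(k / m) ^ j] only, and kills
     those with [j < m]. *)
  assert (E : vdiff m (fun k => pop N a (op_segment T Q (INR k / INR m)) x)
    = vsum (fun j => scal (RtoC (alt_sum m (fun k => (INR k * / INR m) ^ j))) (g j)) N).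
  { unfold vdiff.
    rewrite (vsum_ext _ (fun k => vsum (fun j =>
      scal (RtoC ((-1) ^ k * Binomial.C m k * (INR k * / INR m) ^ j)) (g j)) N)).
    - rewrite vsum_switch; apply vsum_ext; intros j _.
      rewrite (vsum_scal_r (fun k => RtoC ((-1) ^ k * Binomial.C m k * (INR k * / INR m) ^ j))).
      now rewrite csum_RtoC.
    - intros k _; change (op_segment T Q (INR k / INR m)) with (op_path T D (RtoC (INR k / INR m))).
      rewrite Hg, <- vsum_scal_l; apply vsum_ext; intros j _.
      now rewrite scal_CC, <- RtoC_pow, <- RtoC_mult. }
  rewrite E.
  (* In degree 0 the radius [/ q] is meaningless, but the operator is then constant along the
     segment. *)
  destruct (Nat.eq_dec N 0) as [->|HN].
  { rewrite vsum_0, alt_sum_pow, scal_C0 by exact Hm.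
    eapply Rle_trans; [right; exact (norm_zero (K := C_AbsRing) (V := H))|].
    repeat apply Rmult_le_pos; try assumption; lra. }
  set (q := INR N * d) in *.
  assert (HN' : 0 < INR N) by (apply lt_0_INR; lia).
  assert (Hq' : 0 < q) by (apply Rmult_lt_0_compat; lra).
  assert (G : forall j, (j <= N)%nat -> norm (g j) <= 3 * M * norm x * q ^ j).
  { intros j Hj.
    assert (CE := cauchy_estimate g N (/ q) (3 * M * norm x) j).
    assert (Hqj : 0 < q ^ j) by (now apply pow_lt).
    apply (Rmult_le_reg_l (/ q ^ j)); [now apply Rinv_0_lt_compat|].
    replace (/ q ^ j * (3 * M * norm x * q ^ j)) with (3 * M * norm x) by (field; lra).
    rewrite <- pow_inv; apply CE; [left; now apply Rinv_0_lt_compat|exact Hj|].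
    intros l Hl; rewrite <- Hg.
    assert (Ed : / q * d = / INR N) by (unfold q; field; lra).
    eapply Rle_trans; [apply (pop_growth _ N a M (1 + / INR N))|].
    - apply op_path_linear; [exact T_lin|exact op_minus_linear].
    - assert (Z := Rinv_0_lt_compat _ HN'); lra.
    - intros y; rewrite <- Ed, <- Hl; apply norm_op_path_le; [apply T_contr|apply HD].
    - exact HM.
    - rewrite !Rmult_assoc; apply Rmult_le_compat_r; [exact HMX|].
      apply one_plus_inv_pow_le; lia. }
  eapply Rle_trans; [apply norm_vsum_le|].
  apply Rle_trans with (rsum (fun j => (alt_mass m * (3 * M * norm x))
                                        * (if le_dec m j then q ^ j else 0)) N).
  + apply rsum_le; intros j Hj; rewrite norm_scal_C, Cmod_R.
    destruct (le_dec m j) as [Hmj|Hmj].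
    * rewrite Rmult_assoc; apply Rmult_le_compat;
        [apply Rabs_pos|apply norm_ge_0| |now apply G].
      rewrite <- (Rmult_1_r (alt_mass m)); apply alt_sum_bound; intros k Hk.
      assert (Hk1 := fraction_unit k m Hm Hk); unfold Rdiv in Hk1.
      assert (U := pow_unit _ j Hk1); rewrite Rabs_pos_eq; lra.
    * rewrite alt_sum_pow by lia; rewrite Rabs_R0; lra.
  + rewrite rsum_mult_l.
    assert (GT := geometric_tail q m N (conj Hq Hs)).
    apply Rle_trans with (alt_mass m * (3 * M * norm x) * (2 * q ^ m)).
    * apply Rmult_le_compat_l; [|exact GT].
      apply Rmult_le_pos; [exact A0|]; rewrite Rmult_assoc; lra.
    * replace (alt_mass m * (3 * M * norm x) * (2 * q ^ m))
        with (alt_mass m * 6 * q ^ m * (M * norm x)) by ring.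
      rewrite (Rmult_assoc (alt_mass m * (6 + 2 ^ m) * q ^ m)).
      apply Rmult_le_compat_r; [exact HMX|]; apply Rmult_le_compat_r; [exact Hqm|].
      apply Rmult_le_compat_l; lra.
- apply Rnot_le_lt in Hs.
  eapply Rle_trans; [apply (vdiff_bound m _ (M * norm x))|].
  + intros k Hk; apply von_neumann; [apply op_segment_linear| |exact HM].
    intros y; apply op_segment_contr.
    now apply fraction_unit.
  + rewrite (Rmult_assoc (alt_mass m * (6 + 2 ^ m) * (INR N * d) ^ m)).
    apply Rmult_le_compat_r; [exact HMX|].
    rewrite <- (Rmult_1_r (alt_mass m)) at 1; rewrite Rmult_assoc.
    apply Rmult_le_compat_l; [exact A0|].
    assert (K : 1 <= (2 * (INR N * d)) ^ m) by (apply pow_R1_Rle; lra).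
    rewrite Rpow_mult_distr in K; nra.
Qed.

End Bernstein.

(** * Jackson approximation *)

Definition poly_le (d : nat) (f : C -> C) : Prop := exists c, forall z, f z = pev d c z.

Lemma poly_le_weaken d e f : (d <= e)%nat -> poly_le d f -> poly_le e f.
Proof.
intros Hde [c Hc]; exists (fun k => if le_dec k d then c k else RtoC 0); intros z.
rewrite Hc; unfold pev; rewrite (csum_support _ d e Hde).
- apply csum_ext; intros k Hk; destruct (le_dec k d); [reflexivity|lia].
- intros k Hk; destruct (le_dec k d); [lia|ring].
Qed.

Lemma poly_le_plus d f g : poly_le d f -> poly_le d g -> poly_le d (fun z => (f z + g z)%C).
Proof.
intros [a Ha] [b Hb]; exists (fun k => (a k + b k)%C); intros z.
rewrite Ha, Hb; unfold pev; rewrite <- csum_plus; apply csum_ext; intros; ring.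
Qed.

Lemma poly_le_scal d (c : C) f : poly_le d f -> poly_le d (fun z => (c * f z)%C).
Proof.
intros [a Ha]; exists (fun k => (c * a k)%C); intros z.
rewrite Ha; unfold pev; rewrite <- csum_mult_l; apply csum_ext; intros; ring.
Qed.

Lemma poly_le_shift d f : poly_le d f -> poly_le (S d) (fun z => (z * f z)%C).
Proof.
intros [a Ha]; exists (fun k => match k with O => RtoC 0 | S k => a k end); intros z.
rewrite pev_horner, Ha; change (fun k : nat => a k) with a; ring.
Qed.

Lemma poly_le_ext d f g : (forall z, f z = g z) -> poly_le d f -> poly_le d g.
Proof. intros E [a Ha]; exists a; intros z; now rewrite <- E. Qed.

Lemma poly_le_mult d e f g : poly_le d f -> poly_le e g -> poly_le (d + e) (fun z => (f z * g z)%C).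
Proof.
intros [a Ha] Hg; revert f a Ha; induction d as [|d IH]; intros f a Ha.
- apply poly_le_ext with (fun z => (a 0%nat * g z)%C); [|now apply poly_le_scal].
  intros z; rewrite Ha; unfold pev; rewrite csum_0; simpl; ring.
- apply poly_le_ext with (fun z => (a 0%nat * g z + z * (pev d (fun k => a (S k)) z * g z))%C).
  + intros z; rewrite Ha, pev_horner; ring.
  + apply poly_le_plus.
    * apply poly_le_weaken with e; [lia|now apply poly_le_scal].
    * apply (poly_le_shift (d + e)); apply (IH _ (fun k => a (S k))); reflexivity.
Qed.

Lemma poly_le_pow d f r : poly_le d f -> poly_le (r * d) (fun z => (f z ^ r)%C).
Proof.
intros Hf; induction r as [|r IH].
- exists (fun _ => RtoC 1); intros z; unfold pev; simpl; rewrite csum_0; simpl; ring.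
- exact (poly_le_mult d (r * d) _ _ Hf IH).
Qed.

Lemma omega_parseval L d c : (d <= L)%nat ->
  rsum (fun s => Cmod (pev d c (omega L ^ s)%C) ^ 2) L
  = INR (S L) * rsum (fun k => Cmod (c k) ^ 2) d.
Proof.
intros Hd; apply RtoC_inj; rewrite RtoC_mult, <- !csum_RtoC.
rewrite (csum_ext _ (fun s => csum (fun k => csum (fun l =>
   (c k * Cconj (c l) * ((omega L ^ s) ^ k * Cconj ((omega L ^ s) ^ l)))%C) d) d)).
2:{ intros s _; rewrite Cmod2_conj; unfold pev at 1; rewrite <- csum_mult_r.
    apply csum_ext; intros k _; unfold pev; rewrite csum_conj, <- csum_mult_l.
    apply csum_ext; intros l _; rewrite Cmult_conj; ring. }
rewrite csum_switch, <- csum_mult_l; apply csum_ext; intros k Hk.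
rewrite csum_switch.
rewrite (csum_ext _ (fun l => if Nat.eqb l k then (RtoC (INR (S L)) * RtoC (Cmod (c l) ^ 2))%C else RtoC 0)).
- now rewrite csum_delta.
- intros l Hl; rewrite csum_mult_l; destruct (Nat.eqb_spec l k) as [->|E].
  + rewrite omega_sum_diag, Cmod2_conj; ring.
  + rewrite omega_orthogonal by lia; ring.
Qed.

Lemma rsum_square_le (f : nat -> R) d :
  rsum f d ^ 2 <= INR (S d) * rsum (fun k => f k ^ 2) d.
Proof.
induction d as [|d IH]; [rewrite !rsum_0; simpl; lra|].
rewrite !rsum_S, (S_INR (S d)).
set (x := rsum f d) in *; set (y := rsum (fun k => f k ^ 2) d) in *; set (t := f (S d)).
assert (P : 0 < INR (S d)) by (apply lt_0_INR; lia); set (n := INR (S d)) in *.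
assert (K : 2 * x * t <= y + n * t ^ 2).
{ assert (K1 : 2 * x * t * n <= x ^ 2 + (n * t) ^ 2) by (assert (Z := pow2_ge_0 (x - n * t)); nra).
  apply (Rmult_le_reg_r n); [exact P|]; nra. }
nra.
Qed.

(** Fractional moments of the Jackson kernel are thereby reduced to its mass and one even moment,
    both of which Parseval's identity handles. *)
Lemma nnpow_le_even y a s : 0 <= y -> 0 < a <= INR (2 * s) -> nnpow y a <= 1 + y ^ (2 * s).
Proof.
intros Hy Ha; unfold nnpow; destruct (Req_EM_T y 0) as [E|E].
- assert (0 <= y ^ (2 * s)) by (now apply pow_le); lra.
- assert (Hy' : 0 < y) by lra; destruct (Rle_dec y 1) as [H|H].
  + assert (0 <= y ^ (2 * s)) by (now apply pow_le).
    assert (Rpower y a <= 1); [|lra].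
    assert (Hl : ln y <= 0) by (rewrite <- ln_1; apply ln_le; lra).
    unfold Rpower; rewrite <- exp_0; destruct (Req_dec (a * ln y) 0) as [Z|Z].
    * rewrite Z; lra.
    * left; apply exp_increasing; nra.
  + assert (Rpower y a <= y ^ (2 * s)); [|lra].
    rewrite <- Rpower_pow by exact Hy'; apply Rle_Rpower; lra.
Qed.

Lemma nnpow_mult x y a : 0 < x -> 0 <= y -> nnpow (x * y) a = Rpower x a * nnpow y a.
Proof.
intros Hx Hy; unfold nnpow; destruct (Req_EM_T y 0) as [->|E].
- rewrite Rmult_0_r; destruct (Req_EM_T 0 0); [ring|lra].
- destruct (Req_EM_T (x * y) 0) as [E'|E']; [apply Rmult_integral in E'; lra|].
  apply Rpower_mult_distr_r || (rewrite Rpower_mult_distr; lra).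
Qed.

(** * The generalized Jackson kernel on roots of unity *)

Definition dirichlet (M : nat) (z : C) : C := csum (fun k => (z ^ k)%C) M.

Lemma dirichlet_pev M z : dirichlet M z = pev M (fun _ => RtoC 1) z.
Proof. apply csum_ext; intros; ring. Qed.

Section JacksonKernel.
Variables (s M L : nat).
Let r := S s.
Let d := (r * M)%nat.
Hypothesis HL : (d <= L)%nat.

(** For [z = cis t] other than 1 this is the power [2 * S s] of [sin ((M + 1) t / 2) / sin (t / 2)].
    It is left unnormalized; averages are divided by its sum over the nodes. *)
Definition jackson_kernel (z : C) : R := Cmod (dirichlet M z) ^ (2 * r).

Let J (k : nat) : R := jackson_kernel (omega L ^ k)%C.

(** As a squared modulus of a polynomial of degree [d] the kernel is open to Parseval and
    orthogonality; the value of that polynomial at 1 enters the lower bound for the mass. *)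
Lemma jackson_kernel_square : exists c, forall z,
  jackson_kernel z = Cmod (pev d c z) ^ 2 /\ pev d c 1 = RtoC (INR (S M) ^ r).
Proof.
destruct (poly_le_pow M (dirichlet M) r) as [c Hc].
{ exists (fun _ => RtoC 1); apply dirichlet_pev. }
exists c; intros z; split.
- unfold jackson_kernel; rewrite Nat.mul_comm, pow_mult, <- Cmod_pow; now rewrite Hc.
- unfold d; rewrite <- Hc; unfold dirichlet.
  rewrite (csum_ext _ (fun _ => RtoC 1)) by (intros; apply Cpow_1_l).
  rewrite csum_const, Cmult_1_r; symmetry; apply RtoC_pow.
Qed.

Lemma jackson_kernel_nonneg z : 0 <= jackson_kernel z.
Proof. apply pow_le, Cmod_ge_0. Qed.

(** By Parseval the mass is [S L] times the sum of the squared coefficients, and Cauchy-Schwarz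
    bounds that sum from below by the squared value at 1 divided by the number [S d] of
    coefficients. *)
Lemma jackson_mass_ge :
  INR (S L) * INR (S M) ^ (2 * r) <= INR (S d) * rsum J L.
Proof.
destruct jackson_kernel_square as [c Hc].
unfold J; rewrite (rsum_ext _ (fun k => Cmod (pev d c (omega L ^ k)%C) ^ 2))
  by (intros k _; apply Hc).
rewrite omega_parseval by exact HL.
assert (E : Cmod (pev d c 1) <= rsum (fun k => Cmod (c k)) d).
{ unfold pev; eapply Rle_trans; [apply Cmod_csum_le|]; right; apply rsum_ext; intros k _.
  rewrite Cpow_1_l; f_equal; ring. }
rewrite (proj2 (Hc 0)), Cmod_R, Rabs_pos_eq in E by (apply pow_le, pos_INR).
assert (E2 := rsum_square_le (fun k => Cmod (c k)) d).
assert (E3 : (INR (S M) ^ r) ^ 2 <= rsum (fun k => Cmod (c k)) d ^ 2).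
{ apply pow_incr; split; [apply pow_le, pos_INR|exact E]. }
rewrite <- pow_mult, Nat.mul_comm in E3.
assert (P := pos_INR (S L)).
replace (INR (S d) * (INR (S L) * rsum (fun k => Cmod (c k) ^ 2) d))
  with (INR (S L) * (INR (S d) * rsum (fun k => Cmod (c k) ^ 2) d)) by ring.
apply Rmult_le_compat_l; [exact P|lra].
Qed.

(** Since [Cmod (1 - z) * Cmod (dirichlet M z) <= 2], the weight consumes [2 * s] of the [2 * S s]
    factors; the remaining square is summed by Parseval. *)
Lemma jackson_moment_le :
  rsum (fun k => J k * Cmod (1 - omega L ^ k)%C ^ (2 * s)) L <= 4 ^ s * (INR (S L) * INR (S M)).
Proof.
assert (ML : (M <= L)%nat) by (unfold d, r in HL; nia).
apply Rle_trans with (rsum (fun k => 4 ^ s * Cmod (pev M (fun _ => RtoC 1) (omega L ^ k)%C) ^ 2) L).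
- apply rsum_le; intros k _; unfold J, jackson_kernel; rewrite <- dirichlet_pev.
  set (z := (omega L ^ k)%C); set (D := dirichlet M z).
  assert (G : Cmod (1 - z)%C * Cmod D <= 2).
  { rewrite <- Cmod_mult; unfold D, dirichlet; rewrite geometric_csum.
    eapply Rle_trans; [apply Cmod_minus_le|].
    rewrite Cmod_1, (circle_pow z (S M)); [lra|apply circle_pow, circle_omega]. }
  replace (Cmod D ^ (2 * r) * Cmod (1 - z)%C ^ (2 * s))
    with ((Cmod (1 - z)%C * Cmod D) ^ (2 * s) * Cmod D ^ 2).
  + apply Rmult_le_compat_r; [apply pow2_ge_0|].
    replace (4 ^ s) with (2 ^ (2 * s)) by (rewrite pow_mult; f_equal; ring).
    apply pow_incr; split; [apply Rmult_le_pos; apply Cmod_ge_0|exact G].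
  + unfold r; replace (2 * S s)%nat with (2 * s + 2)%nat by lia.
    rewrite pow_add, Rpow_mult_distr; ring.
- rewrite rsum_mult_l, omega_parseval by exact ML.
  rewrite (rsum_ext _ (fun _ => 1)) by (intros; rewrite Cmod_1; ring).
  rewrite rsum_const; right; ring.
Qed.

Lemma jackson_mass_pos : 0 < rsum J L.
Proof.
assert (E := jackson_mass_ge).
assert (P1 : 0 < INR (S L) * INR (S M) ^ (2 * r)).
{ apply Rmult_lt_0_compat; [apply lt_0_INR; lia|apply pow_lt, lt_0_INR; lia]. }
assert (P2 : 0 < INR (S d)) by (apply lt_0_INR; lia).
apply (Rmult_lt_reg_l (INR (S d))); [exact P2|]; lra.
Qed.

(** The distance is measured in units of [/ S M], the width of the peak. On that scale the power
    [al] is at most [1 + y ^ (2 * s)], and the even moment is compared with the mass through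
    [S d <= S s * S M]. *)
Lemma jackson_zygmund_moment al : 0 < al <= INR (2 * s) ->
  rsum (fun k => J k * nnpow (Cmod (1 - omega L ^ k)%C) al) L
  <= (1 + 4 ^ s * INR r) * Rpower (INR (S M)) (- al) * rsum J L.
Proof.
intros Hal; set (m := INR (S M)).
assert (Hm : 1 <= m) by (unfold m; rewrite S_INR; assert (P := pos_INR M); lra).
assert (Hml : 0 < m) by lra.
assert (Rp : 0 < Rpower m (- al)) by apply exp_pos.
apply Rle_trans with (rsum (fun k => Rpower m (- al) *
  (J k + m ^ (2 * s) * (J k * Cmod (1 - omega L ^ k)%C ^ (2 * s)))) L).
- apply rsum_le; intros k _; set (x := Cmod (1 - omega L ^ k)%C).
  assert (X0 : 0 <= x) by apply Cmod_ge_0.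
  assert (E : nnpow x al = Rpower m (- al) * nnpow (m * x) al).
  { rewrite nnpow_mult by assumption; rewrite <- Rmult_assoc, <- Rpower_plus.
    rewrite Rplus_opp_l, Rpower_O by lra; ring. }
  rewrite E.
  assert (B := nnpow_le_even (m * x) al s ltac:(apply Rmult_le_pos; lra) Hal).
  rewrite Rpow_mult_distr in B.
  assert (J0 : 0 <= J k) by apply jackson_kernel_nonneg.
  replace (J k * (Rpower m (- al) * nnpow (m * x) al))
    with (Rpower m (- al) * (J k * nnpow (m * x) al)) by ring.
  apply Rmult_le_compat_l; [lra|].
  replace (J k + m ^ (2 * s) * (J k * x ^ (2 * s))) with (J k * (1 + m ^ (2 * s) * x ^ (2 * s))) by ring.
  now apply Rmult_le_compat_l.
- rewrite rsum_mult_l, rsum_plus, rsum_mult_l.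
  assert (MM := jackson_moment_le); assert (MG := jackson_mass_ge); fold m in MM, MG.
  set (S0 := rsum J L) in *; set (S1 := rsum _ L) in *.
  assert (Hd : INR (S d) <= INR r * m).
  { unfold m; rewrite <- mult_INR; apply le_INR; unfold d, r; nia. }
  assert (Sp : 0 < S0) by apply jackson_mass_pos.
  assert (K : m ^ (2 * s) * S1 <= 4 ^ s * INR r * S0).
  { assert (P4 : 0 < 4 ^ s) by (apply pow_lt; lra).
    assert (Pm : 0 < m ^ (2 * s)) by (now apply pow_lt).
    assert (K1 : INR (S L) * m ^ (2 * r) <= INR r * m * S0).
    { eapply Rle_trans; [exact MG|]; apply Rmult_le_compat_r; lra. }
    assert (K2 : INR (S L) * m * m ^ (2 * s) <= INR r * S0).
    { apply (Rmult_le_reg_r m); [exact Hml|].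
      replace (INR (S L) * m * m ^ (2 * s) * m) with (INR (S L) * m ^ (2 * r)).
      - lra.
      - unfold r; replace (2 * S s)%nat with (S (S (2 * s)))%nat by lia; simpl; ring. }
    apply Rle_trans with (m ^ (2 * s) * (4 ^ s * (INR (S L) * m))).
    - apply Rmult_le_compat_l; lra.
    - replace (m ^ (2 * s) * (4 ^ s * (INR (S L) * m)))
        with (4 ^ s * (INR (S L) * m * m ^ (2 * s))) by ring.
      apply Rle_trans with (4 ^ s * (INR r * S0)); [apply Rmult_le_compat_l; lra|right; ring]. }
  replace ((1 + 4 ^ s * INR r) * Rpower m (- al) * S0)
    with (Rpower m (- al) * (S0 + 4 ^ s * INR r * S0)) by ring.
  apply Rmult_le_compat_l; lra.
Qed.

(** The kernel has frequencies between [- d] and [d] only, so multiplied by the frequency [l > d] it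
    has no constant term; [l + d <= L] excludes aliasing on the [S L] nodes. *)
Lemma jackson_orthogonal l : (d < l)%nat -> (l + d <= L)%nat ->
  csum (fun k => (RtoC (J k) * (omega L ^ k) ^ l)%C) L = RtoC 0.
Proof.
intros H1 H2; destruct jackson_kernel_square as [c Hc].
rewrite (csum_ext _ (fun k => csum (fun i => csum (fun j =>
   (c i * Cconj (c j) * ((omega L ^ k) ^ (i + l) * Cconj ((omega L ^ k) ^ j)))%C) d) d)).
2:{ intros k _; unfold J; rewrite (proj1 (Hc _)), Cmod2_conj; unfold pev at 1.
    rewrite <- csum_mult_r, <- csum_mult_r; apply csum_ext; intros i _.
    unfold pev; rewrite csum_conj, <- csum_mult_l, <- csum_mult_r.
    apply csum_ext; intros j _; rewrite Cmult_conj, Cpow_add_r; ring. }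
rewrite csum_switch, (csum_ext _ (fun _ => RtoC 0)), csum_zero; [reflexivity|].
intros i Hi; rewrite csum_switch, (csum_ext _ (fun _ => RtoC 0)), csum_zero; [reflexivity|].
intros j Hj; rewrite csum_mult_l, omega_orthogonal by lia; ring.
Qed.

End JacksonKernel.

(* [q - p] is the average of the [n]-th differences of [q] against the Jackson
   kernel of degree [S s * M], so [p] is a multiplier transform of [q]. *)
Theorem jackson_approximation (n s M N : nat) (a : nat -> C) (A al : R) :
  0 < al <= INR (2 * s) ->
  (forall tau zeta, circle tau -> circle zeta ->
    Cmod (csum (fun j => (a j * (tau ^ j - 1) ^ n * zeta ^ j)%C) N)
    <= A * nnpow (Cmod (1 - tau)%C) al) ->
  exists b : nat -> C,
    (forall j, (S s * M < j <= N)%nat -> b j = RtoC 0) /\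
    forall zeta, circle zeta -> Cmod (pev N a zeta - pev N b zeta)%C
      <= A * ((1 + 4 ^ s * INR (S s)) * Rpower (INR (S M)) (- al)).
Proof.
intros Hal HA.
(* The frequencies that occur are [j * S i] with [j <= N] and [i <= n]; adding the degree [d] of the
   kernel must not exceed [L]. *)
set (d := (S s * M)%nat); set (L := (N * (n + 1) + d)%nat).
assert (HL : (d <= L)%nat) by (unfold L; lia).
set (w := fun k => (omega L ^ k)%C).
set (J := fun k => jackson_kernel s M (w k)).
assert (J0 : forall k, 0 <= J k) by (intros k; apply jackson_kernel_nonneg).
assert (Sp : 0 < rsum J L) by exact (jackson_mass_pos s M L HL).
set (sg := ((- RtoC 1) ^ n)%C).
assert (Hsg : (sg * sg)%C = RtoC 1).
{ unfold sg; rewrite <- Cpow_mult_l; replace (- RtoC 1 * - RtoC 1)%C with (RtoC 1) by ring.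
  apply Cpow_1_l. }
assert (Hsg1 : Cmod sg = 1) by (unfold sg; rewrite Cmod_pow, Cmod_m1; apply pow1).
(* [mu j] is the kernel average of [(tau ^ j - 1) ^ n]. For [j > d] every frequency in that power
   other than the constant term [sg] is annihilated by the kernel, so [mu j = sg] and the multiplier
   [1 - sg * mu j] vanishes. *)
set (mu := fun j => (csum (fun k => (RtoC (J k) * (w k ^ j - 1) ^ n)%C) L / RtoC (rsum J L))%C).
assert (Sn : RtoC (rsum J L) <> RtoC 0) by (intros E; apply RtoC_inj in E; lra).
exists (fun j => (a j * (1 - sg * mu j))%C); split.
- intros j Hj; assert (Emu : mu j = sg); [|rewrite Emu, Hsg; ring].
  unfold mu; destruct (poly_le_pow 1 (fun z => z - 1)%C n) as [c Hc].
  { exists (fun k => match k with O => (- RtoC 1)%C | _ => RtoC 1 end); intros z.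
    unfold pev; rewrite csum_S, csum_0; simpl; ring. }
  rewrite Nat.mul_1_r in Hc.
  destruct (pev_factor n c 0) as [b Hb].
  assert (E : forall z, ((z - 1) ^ n)%C = (sg + z * pev n b z)%C).
  { intros z; specialize (Hb z); rewrite <- !Hc in Hb.
    replace (RtoC 0 - 1)%C with (- RtoC 1)%C in Hb by ring; fold sg in Hb.
    replace ((z - 1) ^ n)%C with ((z - 1) ^ n - sg + sg)%C by ring; rewrite Hb; ring. }
  rewrite (csum_ext _ (fun k => (RtoC (J k) * sg
     + csum (fun i => b i * (RtoC (J k) * w k ^ (j * S i))) n)%C)).
  2:{ intros k _; rewrite E, Cmult_plus_distr_l; f_equal; unfold pev.
      rewrite <- !csum_mult_l; apply csum_ext; intros i _.
      rewrite Cpow_mult_r; simpl; ring. }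
  rewrite csum_plus, csum_mult_r, csum_RtoC, csum_switch.
  rewrite (csum_ext _ (fun _ => RtoC 0)), csum_zero.
  + field; exact Sn.
  + intros i Hi; rewrite csum_mult_l.
    assert (O : csum (fun k => (RtoC (J k) * w k ^ (j * S i))%C) L = RtoC 0).
    { apply (jackson_orthogonal s M L HL).
      - fold d; nia.
      - fold d; unfold L; nia. }
    rewrite O; ring.
- intros zeta Hz.
  assert (E : (pev N a zeta - pev N (fun j => a j * (1 - sg * mu j)) zeta)%C
    = (sg / RtoC (rsum J L) * csum (fun k => RtoC (J k) *
         csum (fun j => a j * (w k ^ j - 1) ^ n * zeta ^ j) N) L)%C).
  { rewrite <- pev_minus; unfold pev.
    rewrite (csum_ext (fun k => (RtoC (J k) * csum (fun j => (a j * (w k ^ j - 1) ^ n * zeta ^ j)%C) N)%C)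
       (fun k => csum (fun j => (RtoC (J k) * (w k ^ j - 1) ^ n * (a j * zeta ^ j))%C) N)).
    2:{ intros k _; rewrite <- csum_mult_l; apply csum_ext; intros; ring. }
    rewrite csum_switch, <- csum_mult_l; apply csum_ext; intros j _.
    rewrite csum_mult_r; unfold mu; field; exact Sn. }
  rewrite E, Cmod_mult, Cmod_div by exact Sn.
  rewrite Hsg1, Cmod_R, Rabs_pos_eq by lra.
  assert (B : Cmod (csum (fun k => (RtoC (J k) *
         csum (fun j => a j * (w k ^ j - 1) ^ n * zeta ^ j) N)%C) L)
    <= A * rsum (fun k => J k * nnpow (Cmod (1 - w k)%C) al) L).
  { eapply Rle_trans; [apply Cmod_csum_le|]; rewrite <- rsum_mult_l; apply rsum_le; intros k _.
    rewrite Cmod_mult, Cmod_R, Rabs_pos_eq by apply J0.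
    replace (A * (J k * nnpow (Cmod (1 - w k)%C) al))
      with (J k * (A * nnpow (Cmod (1 - w k)%C) al)) by ring.
    apply Rmult_le_compat_l; [apply J0|]; apply HA; [apply circle_pow, circle_omega|exact Hz]. }
  assert (A0 : 0 <= A).
  { specialize (HA (- RtoC 1)%C (RtoC 1)).
    assert (X : 0 <= A * nnpow (Cmod (1 - - RtoC 1)%C) al).
    { eapply Rle_trans; [apply Cmod_ge_0|apply HA]; unfold circle; [apply Cmod_m1|apply Cmod_1]. }
    replace (1 - - RtoC 1)%C with (RtoC 2) in X by (unfold Cminus, Copp, Cplus, RtoC; simpl; f_equal; ring).
    rewrite Cmod_R, Rabs_pos_eq in X by lra.
    assert (X1 : 0 < nnpow 2 al).
    { unfold nnpow; destruct (Req_EM_T 2 0); [lra|apply exp_pos]. }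
    destruct (Rle_dec 0 A); [assumption|nra]. }
  assert (ZM := jackson_zygmund_moment s M L HL al Hal).
  apply (Rmult_le_reg_l (rsum J L)); [exact Sp|].
  rewrite <- Rmult_assoc; unfold Rdiv at 1; rewrite Rmult_1_l, Rinv_r, Rmult_1_l by lra.
  eapply Rle_trans; [exact B|].
  replace (rsum J L * (A * ((1 + 4 ^ s * INR (S s)) * Rpower (INR (S M)) (- al))))
    with (A * ((1 + 4 ^ s * INR (S s)) * Rpower (INR (S M)) (- al) * rsum J L)) by ring.
  now apply Rmult_le_compat_l.
Qed.

(** * The estimate for polynomials *)

Lemma pop_minus {V : NormedModule C_AbsRing} N b c (T : V -> V) x :
  pop N (fun j => (b j - c j)%C) T x = minus (pop N b T x) (pop N c T x).
Proof.
unfold pop; rewrite <- vsum_minus; apply vsum_ext; intros j _; apply scal_minus_C.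
Qed.

Lemma vdiff_minus {V : NormedModule C_AbsRing} m (g h : nat -> V) :
  vdiff m (fun k => minus (g k) (h k)) = minus (vdiff m g) (vdiff m h).
Proof.
unfold vdiff; rewrite <- vsum_minus; apply vsum_ext; intros j _; apply scal_minus.
Qed.

Lemma pop_truncate {V : NormedModule C_AbsRing} N e b (T : V -> V) x : (e <= N)%nat ->
  (forall j, (e < j <= N)%nat -> b j = RtoC 0) -> pop N b T x = pop e b T x.
Proof.
intros He Hb; apply vsum_support; [exact He|]; intros k Hk; rewrite Hb by exact Hk; apply scal_C0.
Qed.

Lemma pev_truncate N e b z : (e <= N)%nat ->
  (forall j, (e < j <= N)%nat -> b j = RtoC 0) -> pev N b z = pev e b z.
Proof.
intros He Hb; apply csum_support; [exact He|]; intros k Hk; rewrite Hb by exact Hk; ring.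
Qed.

Lemma vdiff_const {V : NormedModule C_AbsRing} m (x : V) : (0 < m)%nat -> vdiff m (fun _ => x) = zero.
Proof.
intros Hm; unfold vdiff.
rewrite (vsum_scal_r (fun k => RtoC ((-1) ^ k * Binomial.C m k))), csum_RtoC.
assert (E := alt_sum_pow m 0 1 Hm); unfold alt_sum in E.
rewrite (rsum_ext _ (fun k => (-1) ^ k * Binomial.C m k * (INR k * 1) ^ 0))
  by (intros; simpl; ring).
rewrite E; apply scal_C0.
Qed.

Lemma dyadic_scale d : 0 < d <= 1 -> exists J, 2 ^ J * d <= 1 < 2 ^ S J * d.
Proof.
intros Hd.
assert (Hn : exists n, 1 < 2 ^ n * d).
{ destruct (Pow_x_infinity 2) with (b := / d + 1) as [n Hn].
  - rewrite Rabs_pos_eq; lra.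
  - exists n; specialize (Hn n (le_n n)).
    rewrite Rabs_pos_eq in Hn by (apply pow_le; lra).
    assert (Hi : / d * d = 1) by (apply Rinv_l; lra); nra. }
destruct Hn as [n Hn]; induction n as [|n IH]; [simpl in Hn; lra|].
destruct (Rle_dec (2 ^ n * d) 1) as [Y|Y]; [now exists n|apply IH; lra].
Qed.

Lemma Rpower_inv_scale J d al : 0 < d -> 0 < al -> 1 < 2 ^ S J * d ->
  Rpower (2 ^ J) (- al) <= Rpower 2 al * Rpower d al.
Proof.
intros Hd Ha HJ.
assert (P : 0 < 2 ^ J) by (apply pow_lt; lra).
rewrite Rpower_Ropp, Rpower_mult_distr by lra.
rewrite <- (Rmult_1_r (Rpower (2 * d) al)).
apply (Rmult_le_reg_l (Rpower (2 ^ J) al)); [apply exp_pos|].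
rewrite Rinv_r by (apply Rgt_not_eq, exp_pos).
rewrite <- Rmult_assoc, Rpower_mult_distr, Rmult_1_r by lra.
unfold Rpower; rewrite <- exp_0; left; apply exp_increasing.
apply Rmult_lt_0_compat; [exact Ha|]; rewrite <- ln_1; apply ln_increasing; [lra|].
simpl in HJ; lra.
Qed.

(** The quantifiers matter: [c] precedes the difference order [n], the degree [N], the Hilbert space
    and the operators, so the estimate survives a passage to the limit along polynomials of growing
    degree. *)
Theorem polynomial_zygmund_estimate (m : nat) (al : R) : (0 < m)%nat -> 0 < al < INR m ->
  exists c, 0 < c /\ forall (n N : nat) (a : nat -> C) (A : R),
    (forall tau zeta, circle tau -> circle zeta ->
      Cmod (csum (fun j => (a j * (tau ^ j - 1) ^ n * zeta ^ j)%C) N)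
      <= A * nnpow (Cmod (1 - tau)%C) al) -> 0 <= A ->
    forall (H : HilbertSpace) (T Q : H -> H), is_linear T -> is_linear Q ->
    (forall x, norm (T x) <= norm x) -> (forall x, norm (Q x) <= norm x) ->
    forall d, 0 < d -> (forall x, norm (minus (Q x) (T x)) <= d * norm x) ->
    forall x, norm (vdiff m (fun k => pop N a (op_segment T Q (INR k / INR m)) x))
              <= c * A * Rpower d al * norm x.
Proof.
intros Hm Hal.
(* [K0] is the Jackson constant for [s = m], admissible since [al < m <= 2 * m]. Doubling the degree
   improves the approximation by [u] and multiplies the bound for a block by [v]; [al < m] means
   [v > 1]. [Cb] collects the Bernstein constant, the degree [S m * 2 ^ S j] of a block and its size
   [2 * K0 * u ^ j]. *)
set (K0 := 1 + 4 ^ m * INR (S m)).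
set (u := Rpower 2 (- al)); set (v := 2 ^ m * u).
set (Cb := alt_mass m * (6 + 2 ^ m) * (2 * INR (S m)) ^ m * (2 * K0)).
assert (M0 := alt_mass_nonneg m).
assert (P2 : 0 < 2 ^ m) by (apply pow_lt; lra).
assert (K0p : 0 < K0).
{ unfold K0; assert (0 <= 4 ^ m * INR (S m)); [|lra].
  apply Rmult_le_pos; [apply pow_le; lra|apply pos_INR]. }
assert (SMp : 0 <= INR (S m)) by apply pos_INR.
assert (Cb0 : 0 <= Cb).
{ unfold Cb; repeat apply Rmult_le_pos; try lra; apply pow_le; lra. }
assert (up : 0 < u) by apply exp_pos.
assert (u1 : u <= 1).
{ unfold u, Rpower; rewrite <- exp_0; left; apply exp_increasing.
  assert (0 < ln 2) by (rewrite <- ln_1; apply ln_increasing; lra); nra. }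
assert (v1 : 1 < v).
{ unfold v, u; rewrite <- Rpower_pow, <- Rpower_plus by lra.
  unfold Rpower; rewrite <- exp_0; apply exp_increasing.
  assert (0 < ln 2) by (rewrite <- ln_1; apply ln_increasing; lra).
  apply Rmult_lt_0_compat; lra. }
assert (Hal2 : 0 < al <= INR (2 * m)).
{ split; [lra|]; apply Rle_trans with (INR m); [lra|apply le_INR; lia]. }
assert (R2 : 0 < Rpower 2 al) by apply exp_pos.
assert (v1i : 0 < / (v - 1)) by (apply Rinv_0_lt_compat; lra).
(* The leading 1 makes the constant positive. In the last factor, 1 serves [d > 1], and
   [Rpower 2 al] is the loss from choosing a dyadic scale when [d <= 1]. *)
exists (1 + (alt_mass m * K0 + Cb * / (v - 1)) * (1 + Rpower 2 al)); split.
{ assert (0 <= (alt_mass m * K0 + Cb * / (v - 1)) * (1 + Rpower 2 al)); [|lra].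
  apply Rmult_le_pos; [apply Rplus_le_le_0_compat; apply Rmult_le_pos|]; lra. }
intros n N a A HA A0 H T Q HT HQ HT1 HQ1 d Hd HD x.
set (B := alt_mass m * K0 + Cb * / (v - 1)).
assert (B0 : 0 <= B).
{ unfold B; apply Rplus_le_le_0_compat; apply Rmult_le_pos; lra. }
assert (X0 := norm_ge_0 x).
assert (AX0 : 0 <= A * norm x) by (now apply Rmult_le_pos).
(* The kernel parameter [2 ^ j - 1] makes [S M] equal to [2 ^ j], and level 0 consists of constants,
   which the difference kills: the telescoping sum starts at zero. *)
assert (App : forall j, exists b : nat -> C,
  (forall i, (S m * (2 ^ j - 1) < i <= N)%nat -> b i = RtoC 0) /\
  forall z, circle z -> Cmod (pev N a z - pev N b z)%C <= A * (K0 * u ^ j)).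
{ intros j; destruct (jackson_approximation n m (2 ^ j - 1) N a A al Hal2 HA) as [b [Hb1 Hb2]].
  exists b; split; [exact Hb1|]; intros z Hz; eapply Rle_trans; [now apply Hb2|].
  right; unfold K0; do 2 f_equal.
  assert (E : (S (2 ^ j - 1) = 2 ^ j)%nat) by (assert (Z := Nat.pow_nonzero 2 j); lia).
  rewrite E, pow_INR; change (INR 2) with 2; unfold u.
  rewrite <- !Rpower_pow by (lra || apply exp_pos).
  rewrite !Rpower_mult; f_equal; ring. }
set (p := fun j => epsilon (inhabits a) (fun b =>
  (forall i, (S m * (2 ^ j - 1) < i <= N)%nat -> b i = RtoC 0) /\
  forall z, circle z -> Cmod (pev N a z - pev N b z)%C <= A * (K0 * u ^ j))).
assert (Hp : forall j, (forall i, (S m * (2 ^ j - 1) < i <= N)%nat -> p j i = RtoC 0) /\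
  forall z, circle z -> Cmod (pev N a z - pev N (p j) z)%C <= A * (K0 * u ^ j))
  by (intros j; exact (epsilon_spec (inhabits a) _ (App j))).
clearbody p.
set (Dp := fun b => vdiff m (fun k => pop N b (op_segment T Q (INR k / INR m)) x)).
change (norm (Dp a) <= (1 + B * (1 + Rpower 2 al)) * A * Rpower d al * norm x).
assert (Dsub : forall b c, norm (Dp b) <= norm (Dp c) + norm (Dp (fun j => (b j - c j)%C))).
{ intros b c.
  assert (E : Dp (fun j => (b j - c j)%C) = minus (Dp b) (Dp c)).
  { unfold Dp; rewrite <- vdiff_minus; unfold vdiff; apply vsum_ext; intros k _.
    now rewrite pop_minus. }
  rewrite E; apply norm_le_plus_minus. }
assert (D0 : norm (Dp (p 0%nat)) = 0).
{ assert (Ez : Dp (p 0%nat) = vdiff m (fun _ => scal (p 0%nat 0%nat) x)).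
  { unfold Dp, vdiff; apply vsum_ext; intros k _; f_equal.
    rewrite (pop_truncate N 0) by (lia || (intros j Hj; apply (Hp 0%nat); simpl; lia)).
    unfold pop; rewrite vsum_0; reflexivity. }
  rewrite Ez; etransitivity; [exact (f_equal norm (vdiff_const m _ Hm))|].
  exact (norm_zero (K := C_AbsRing) (V := H)). }
assert (Dstep : forall j, norm (Dp (fun i => (p (S j) i - p j i)%C))
   <= Cb * d ^ m * v ^ j * (A * norm x)).
{ intros j; set (b := fun i => (p (S j) i - p j i)%C).
  (* The coefficients are known to vanish only up to index [N]; beyond it they are arbitrary, hence
     the minimum. *)
  set (e := Nat.min (S m * 2 ^ S j) N).
  assert (Hb : forall i, (e < i <= N)%nat -> b i = RtoC 0).
  { intros i Hi; unfold b; rewrite (proj1 (Hp (S j))), (proj1 (Hp j)); [ring| |].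
    - unfold e in Hi; simpl in Hi; nia.
    - unfold e in Hi; simpl in Hi |- *; nia. }
  assert (He : (e <= N)%nat) by apply Nat.le_min_r.
  assert (Hsup : forall z, circle z -> Cmod (pev e b z) <= A * (2 * K0 * u ^ j)).
  { intros z Hz; rewrite <- (pev_truncate N e) by assumption.
    unfold b; rewrite pev_minus.
    replace (pev N (p (S j)) z - pev N (p j) z)%C
      with ((pev N a z - pev N (p j) z) + - (pev N a z - pev N (p (S j)) z))%C by ring.
    eapply Rle_trans; [apply Cmod_triangle|]; rewrite Cmod_opp.
    assert (E1 := proj2 (Hp j) z Hz); assert (E2 := proj2 (Hp (S j)) z Hz).
    assert (U0 : 0 < u ^ j) by (now apply pow_lt).
    assert (E3 : A * (K0 * u ^ S j) <= A * (K0 * u ^ j)).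
    { apply Rmult_le_compat_l; [exact A0|]; apply Rmult_le_compat_l; [lra|]; simpl; nra. }
    lra. }
  assert (OB := operator_bernstein T Q HT HQ HT1 HQ1 m e b _ d x Hm Hd HD Hsup).
  replace (Dp b) with (vdiff m (fun k => pop e b (op_segment T Q (INR k / INR m)) x)).
  2:{ unfold Dp, vdiff; apply vsum_ext; intros k _; f_equal; symmetry; now apply pop_truncate. }
  eapply Rle_trans; [exact OB|].
  assert (E1 : (INR e * d) ^ m <= (INR (S m * 2 ^ S j) * d) ^ m).
  { apply pow_incr; split; [apply Rmult_le_pos; [apply pos_INR|lra]|].
    apply Rmult_le_compat_r; [lra|]; apply le_INR, Nat.le_min_l. }
  assert (E2 : (INR (S m * 2 ^ S j) * d) ^ m = (2 * INR (S m)) ^ m * (2 ^ m) ^ j * d ^ m).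
  { rewrite mult_INR, pow_INR; change (INR 2) with 2; rewrite !Rpow_mult_distr.
    rewrite <- !pow_mult; replace (S j * m)%nat with (m + m * j)%nat by lia.
    rewrite pow_add; ring. }
  rewrite E2 in E1.
  apply Rle_trans with (alt_mass m * (6 + 2 ^ m) * ((2 * INR (S m)) ^ m * (2 ^ m) ^ j * d ^ m)
                        * (A * (2 * K0 * u ^ j)) * norm x).
  - assert (U0 : 0 < u ^ j) by (now apply pow_lt).
    apply Rmult_le_compat_r; [exact X0|]; apply Rmult_le_compat_r.
    + apply Rmult_le_pos; [exact A0|apply Rmult_le_pos; lra].
    + apply Rmult_le_compat_l; [apply Rmult_le_pos; lra|exact E1].
  - right; unfold Cb, v; rewrite (Rpow_mult_distr (2 ^ m) u); ring. }
assert (d0 : 0 < d ^ m) by (now apply pow_lt).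
assert (Dsum : forall J, norm (Dp (p J)) <= Cb * / (v - 1) * d ^ m * (v ^ J - 1) * (A * norm x)).
{ induction J as [|J IH].
  - rewrite D0; simpl; right; ring.
  - eapply Rle_trans; [apply (Dsub _ (p J))|].
    eapply Rle_trans; [apply Rplus_le_compat; [exact IH|apply Dstep]|].
    right; simpl; field; lra. }
assert (Dtail : forall J, norm (Dp (fun i => (a i - p J i)%C)) <= alt_mass m * (A * (K0 * u ^ J) * norm x)).
{ intros J; apply vdiff_bound; intros k Hk.
  apply von_neumann.
  - now apply op_segment_linear.
  - intros y; apply op_segment_contr; try assumption.
    now apply fraction_unit.
  - intros z Hz; rewrite pev_minus; now apply Hp. }
assert (Rd : 0 < Rpower d al) by apply exp_pos.
(* For [d <= 1], [J] is the last level with [2 ^ J * d <= 1]; for [d > 1] no block is used, as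
   [Rpower d al] is already at least 1. *)
assert (Key : exists J, 2 ^ J * d <= 1 /\ u ^ J <= Rpower 2 al * Rpower d al
   \/ J = 0%nat /\ 1 <= Rpower d al).
{ destruct (Rle_dec d 1) as [Y|Y].
  - destruct (dyadic_scale d ltac:(lra)) as [J [HJ1 HJ2]]; exists J; left; split; [exact HJ1|].
    replace (u ^ J) with (Rpower (2 ^ J) (- al)).
    + apply Rpower_inv_scale; lra.
    + unfold u; rewrite <- !Rpower_pow by (lra || apply exp_pos).
      rewrite !Rpower_mult; f_equal; ring.
  - exists 0%nat; right; split; [reflexivity|]; unfold Rpower; rewrite <- exp_0; left.
    apply exp_increasing, Rmult_lt_0_compat; [lra|]; rewrite <- ln_1; apply ln_increasing; lra. }
assert (RBd : 0 <= B * Rpower d al * (A * norm x)).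
{ apply Rmult_le_pos; [apply Rmult_le_pos; lra|exact AX0]. }
assert (RAd : 0 <= Rpower d al * (A * norm x)) by (apply Rmult_le_pos; lra).
assert (RBd2 : 0 <= Rpower 2 al * (B * Rpower d al * (A * norm x))) by (apply Rmult_le_pos; lra).
destruct Key as [J [[HJ1 HJ2]|[-> HJ]]].
- assert (Fin : norm (Dp a) <= B * u ^ J * (A * norm x)).
  { eapply Rle_trans; [apply (Dsub a (p J))|].
    assert (E1 := Dsum J); assert (E2 := Dtail J).
    assert (U0 : 0 < u ^ J) by (now apply pow_lt).
    (* As [v > 1], the sum of the blocks is governed by its last term, and there
       [d ^ m * v ^ J = (2 ^ J * d) ^ m * u ^ J]: blocks and tail have the same order. *)
    assert (E3 : d ^ m * v ^ J <= u ^ J).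
    { unfold v; rewrite Rpow_mult_distr, <- pow_mult, Nat.mul_comm, pow_mult.
      replace (d ^ m * ((2 ^ J) ^ m * u ^ J)) with ((2 ^ J * d) ^ m * u ^ J)
        by (rewrite Rpow_mult_distr; ring).
      assert (Z : 0 <= 2 ^ J * d <= 1) by (split; [apply Rmult_le_pos; [apply pow_le|]; lra|exact HJ1]).
      assert (Z' := pow_unit _ m Z); nra. }
    assert (E4 : Cb * / (v - 1) * d ^ m * (v ^ J - 1) * (A * norm x)
                 <= Cb * / (v - 1) * u ^ J * (A * norm x)).
    { apply Rmult_le_compat_r; [exact AX0|].
      rewrite (Rmult_assoc (Cb * / (v - 1))); apply Rmult_le_compat_l; [apply Rmult_le_pos; lra|].
      nra. }
    unfold B; lra. }
  eapply Rle_trans; [exact Fin|].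
  apply Rle_trans with (B * (Rpower 2 al * Rpower d al) * (A * norm x)).
  + apply Rmult_le_compat_r; [exact AX0|]; now apply Rmult_le_compat_l.
  + lra.
- assert (E1 := Dsub a (p 0%nat)); rewrite D0 in E1; assert (E2 := Dtail 0%nat).
  assert (E3 : alt_mass m * (A * (K0 * u ^ 0) * norm x) <= B * (A * norm x)).
  { simpl; unfold B; assert (0 <= Cb * / (v - 1) * (A * norm x)); [|lra].
    apply Rmult_le_pos; [apply Rmult_le_pos; lra|exact AX0]. }
  assert (E4 : B * 1 * (A * norm x) <= B * Rpower d al * (A * norm x)).
  { apply Rmult_le_compat_r; [exact AX0|]; now apply Rmult_le_compat_l. }
  lra.
Qed.

(** * Fejer means *)

Lemma cont_at_csum (f : nat -> R -> C) N t :
  (forall k, cont_at (f k) t) -> cont_at (fun u => csum (fun k => f k u) N) t.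
Proof.
intros Hf; induction N as [|N IH].
- apply (cont_at_ext (f 0%nat)); [intros u; now rewrite csum_0|apply Hf].
- apply (cont_at_ext (fun u => (csum (fun k => f k u) N + f (S N) u)%C)).
  + intros u; now rewrite csum_S.
  + now apply cont_at_plus.
Qed.

Lemma CRInt_csum (f : nat -> R -> C) N a b : a <= b -> (forall k t, cont_at (f k) t) ->
  CRInt (fun t => csum (fun k => f k t) N) a b = csum (fun k => CRInt (f k) a b) N.
Proof.
intros Hab Hf; induction N as [|N IH].
- rewrite csum_0; apply CRInt_ext; [exact Hab|]; intros t _; now rewrite csum_0.
- rewrite csum_S, <- IH, <- CRInt_plus; [|exact Hab|intros; now apply cont_at_csum|intros; apply Hf].
  apply CRInt_ext; [exact Hab|]; intros t _; now rewrite csum_S.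
Qed.

Lemma cis_2PI_Z j : cis (IZR j * (2 * PI)) = RtoC 1.
Proof.
assert (Hn : forall n, cis (INR n * (2 * PI)) = RtoC 1).
{ intros n; rewrite <- cis_pow, cis_2PI; apply Cpow_1_l. }
destruct (Z.le_ge_cases 0 j) as [H|H].
- rewrite <- (Z2Nat.id j H), <- INR_IZR_INZ; apply Hn.
- replace (IZR j * (2 * PI)) with (- (INR (Z.to_nat (- j)) * (2 * PI))).
  + rewrite cis_opp, Hn; unfold Cconj, RtoC; simpl; f_equal; ring.
  + rewrite INR_IZR_INZ, Z2Nat.id by lia; rewrite opp_IZR; ring.
Qed.

Lemma cis_PI : cis PI = (- RtoC 1)%C.
Proof. unfold cis, Copp, RtoC; simpl; rewrite cos_PI, sin_PI; f_equal; ring. Qed.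

(** For [j <> 0] a shift by half a period, [PI / j], changes the sign of the integrand but not the
    integral, which therefore vanishes. *)
Lemma fourier_coef_1 j : fourier_coef (fun _ => RtoC 1) j = if Z.eqb j 0 then RtoC 1 else RtoC 0.
Proof.
assert (P := PI_RGT_0).
unfold fourier_coef.
change (RtoC (/ (2 * PI)) * CRInt (fun t => RtoC 1 * cis (- (IZR j * t)))%C 0 (2 * PI)
  = if Z.eqb j 0 then RtoC 1 else RtoC 0)%C.
destruct (Z.eqb_spec j 0) as [->|Hj].
- rewrite (CRInt_ext _ (fun _ => RtoC 1)), CRInt_const, <- !RtoC_mult.
  + f_equal; field; lra.
  + lra.
  + intros t _; replace (- (0 * t)) with 0 by ring; rewrite cis_0; ring.
- set (g := fun t => (RtoC 1 * cis (- (IZR j * t)))%C).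
  assert (Hg : forall t, cont_at g t).
  { intros t; apply (cont_at_ext (fun u => cis (- IZR j * u + 0))).
    - intros u; unfold g; rewrite Cmult_1_l; f_equal; ring.
    - apply cont_at_cis_lin. }
  assert (Hp : forall t, g (t + 2 * PI) = g t).
  { intros t; unfold g; rewrite !Cmult_1_l.
    replace (- (IZR j * (t + 2 * PI))) with (- (IZR j * t) + IZR (- j) * (2 * PI))
      by (rewrite opp_IZR; ring).
    rewrite cis_plus, cis_2PI_Z; ring. }
  assert (Hj' : IZR j <> 0) by (now apply not_0_IZR).
  assert (E := CRInt_periodic g (2 * PI) (- PI / IZR j) ltac:(lra) Hg Hp).
  rewrite (CRInt_ext _ (fun t => (- RtoC 1 * g t)%C)) in E.
  + rewrite CRInt_mult_l in E by (lra || (intros; apply Hg)).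
    fold g; set (I := CRInt g 0 (2 * PI)) in *.
    assert (Z : (RtoC 2 * I)%C = RtoC 0).
    { replace (RtoC 2 * I)%C with (I + I)%C by (rewrite RtoC_plus || idtac; ring).
      rewrite <- E at 1; ring. }
    replace I with (RtoC (/ 2) * (RtoC 2 * I))%C.
    * rewrite Z; ring.
    * rewrite Cmult_assoc, <- RtoC_mult, Rinv_l by lra; ring.
  + lra.
  + intros t _; unfold g.
    replace (- (IZR j * (t + - PI / IZR j))) with (- (IZR j * t) + PI) by (field; exact Hj').
    rewrite cis_plus, cis_PI; ring.
Qed.

(** For [z] on the circle, [S M] times the Fejer kernel in the angle between [cis t] and [z]. *)
Definition fejer_kernel (M : nat) (z : C) (t : R) : R :=
  Cmod (dirichlet M (z * cis (- t))%C) ^ 2.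

Lemma fejer_kernel_expansion M z t : RtoC (fejer_kernel M z t)
  = csum (fun k => csum (fun l =>
      (z ^ k * Cconj (z ^ l) * cis (- (IZR (Z.of_nat k - Z.of_nat l) * t)))%C) M) M.
Proof.
unfold fejer_kernel; rewrite Cmod2_conj; unfold dirichlet at 1.
rewrite <- csum_mult_r; apply csum_ext; intros k _.
unfold dirichlet; rewrite csum_conj, <- csum_mult_l; apply csum_ext; intros l _.
rewrite !Cpow_mult_l, Cmult_conj, !cis_pow, <- cis_opp.
replace (- (IZR (Z.of_nat k - Z.of_nat l) * t)) with (INR k * - t + - (INR l * - t))
  by (rewrite minus_IZR, <- !INR_IZR_INZ; ring).
rewrite cis_plus; ring.
Qed.

Lemma cont_at_fejer_kernel M z t : cont_at (fun t => RtoC (fejer_kernel M z t)) t.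
Proof.
eapply cont_at_ext; [intros u; symmetry; apply fejer_kernel_expansion|].
apply cont_at_csum; intros k; apply cont_at_csum; intros l.
apply cont_at_mult; [apply cont_at_const|].
apply (cont_at_ext (fun u => cis (- IZR (Z.of_nat k - Z.of_nat l) * u + 0)));
  [intros u; f_equal; ring|apply cont_at_cis_lin].
Qed.

Definition fejer (M : nat) (f : C -> C) (z : C) : C :=
  (RtoC (/ (2 * PI * INR (S M))) *
   CRInt (fun t => f (cis t) * RtoC (fejer_kernel M z t))%C 0 (2 * PI))%C.

Lemma cont_on_circle_cis f t : cont_on circle f -> cont_at (fun t => f (cis t)) t.
Proof.
intros Hf eps He; destruct (Hf (cis t) (Cmod_cis t) eps He) as [d [Hd H]].
destruct (cont_at_cis t d Hd) as [d' [Hd' H']]; exists d'; split; [exact Hd'|].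
intros u Hu; apply H; [apply Cmod_cis|now apply H'].
Qed.

Lemma fejer_expansion M f z : cont_on circle f ->
  fejer M f z = (RtoC (/ INR (S M)) * csum (fun k => csum (fun l =>
     (z ^ k * Cconj (z ^ l) * fourier_coef f (Z.of_nat k - Z.of_nat l))%C) M) M)%C.
Proof.
intros Hf; assert (P := PI_RGT_0).
assert (SM : 0 < INR (S M)) by (apply lt_0_INR; lia).
assert (Hc : forall j t, cont_at (fun t => f (cis t) * cis (- (IZR j * t)))%C t).
{ intros j t; apply cont_at_mult; [now apply cont_on_circle_cis|].
  apply (cont_at_ext (fun u => cis (- IZR j * u + 0))); [intros u; f_equal; ring|apply cont_at_cis_lin]. }
unfold fejer.
rewrite (CRInt_ext _ (fun t => csum (fun k => csum (fun l => z ^ k * Cconj (z ^ l) *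
   (f (cis t) * cis (- (IZR (Z.of_nat k - Z.of_nat l) * t)))) M) M)%C).
2: lra.
2:{ intros t _; rewrite fejer_kernel_expansion, <- csum_mult_l; apply csum_ext; intros k _.
    rewrite <- csum_mult_l; apply csum_ext; intros l _; ring. }
assert (Hcl : forall k l t, cont_at (fun t => z ^ k * Cconj (z ^ l) *
   (f (cis t) * cis (- (IZR (Z.of_nat k - Z.of_nat l) * t))))%C t).
{ intros k l t; apply cont_at_mult; [apply cont_at_const|apply Hc]. }
rewrite (CRInt_csum (fun k t => csum (fun l => z ^ k * Cconj (z ^ l) *
   (f (cis t) * cis (- (IZR (Z.of_nat k - Z.of_nat l) * t)))) M)%C);
  [|lra|intros; apply cont_at_csum; intros; apply Hcl].
rewrite <- !csum_mult_l; apply csum_ext; intros k _.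
rewrite CRInt_csum; [|lra|intros; apply Hcl].
rewrite <- !csum_mult_l; apply csum_ext; intros l _.
rewrite CRInt_mult_l; [|lra|intros; apply Hc].
unfold fourier_coef; fold (CRInt (fun t => f (cis t) * cis (- (IZR (Z.of_nat k - Z.of_nat l) * t)))%C 0 (2 * PI)).
replace (/ (2 * PI * INR (S M))) with (/ INR (S M) * / (2 * PI)) by (field; lra).
rewrite RtoC_mult; ring.
Qed.

Lemma fejer_1 M z : circle z -> fejer M (fun _ => RtoC 1) z = RtoC 1.
Proof.
intros Hz; rewrite fejer_expansion.
2:{ intros w Hw eps He; exists 1; split; [lra|]; intros.
    replace (RtoC 1 - RtoC 1)%C with (RtoC 0) by ring; now rewrite Cmod_0. }
rewrite (csum_ext _ (fun _ => RtoC 1)).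
- rewrite csum_const, Cmult_1_r, <- RtoC_mult, Rinv_l; [reflexivity|].
  apply not_0_INR; lia.
- intros k Hk; rewrite (csum_ext _ (fun l => if Nat.eqb l k then (z ^ k * Cconj (z ^ l))%C else RtoC 0)).
  + rewrite csum_delta by exact Hk; now apply circle_conj, circle_pow.
  + intros l Hl; rewrite fourier_coef_1.
    destruct (Nat.eqb_spec l k) as [->|E].
    * rewrite Z.sub_diag; simpl; ring.
    * destruct (Z.eqb_spec (Z.of_nat k - Z.of_nat l) 0); [lia|ring].
Qed.

Lemma fejer_kernel_nonneg M z t : 0 <= fejer_kernel M z t.
Proof. apply pow2_ge_0. Qed.

Lemma is_RInt_fejer_kernel M z : circle z ->
  is_RInt (fejer_kernel M z) 0 (2 * PI) (2 * PI * INR (S M)).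
Proof.
intros Hz; assert (P := PI_RGT_0).
assert (SM : 0 < INR (S M)) by (apply lt_0_INR; lia).
assert (E := fejer_1 M z Hz); unfold fejer in E.
rewrite (CRInt_ext _ (fun t => RtoC (fejer_kernel M z t))) in E by (lra || (intros; ring)).
assert (Hi := CRInt_correct (fun t => RtoC (fejer_kernel M z t)) 0 (2 * PI) ltac:(lra)
  (fun t _ => cont_at_fejer_kernel M z t)).
set (I := CRInt _ 0 (2 * PI)) in *.
assert (EI : I = RtoC (2 * PI * INR (S M))).
{ replace I with (RtoC (2 * PI * INR (S M)) * (RtoC (/ (2 * PI * INR (S M))) * I))%C.
  - rewrite E; ring.
  - rewrite Cmult_assoc, <- RtoC_mult, Rinv_r; [ring|].
    apply Rgt_not_eq, Rmult_lt_0_compat; lra. }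
rewrite EI in Hi.
exact (is_RInt_fct_extend_fst (U := R_NormedModule) (V := R_NormedModule) _ _ _ _ Hi).
Qed.

(** The form of the majorant serves two purposes: [B = 0] shows that the means preserve bounds,
    while a nonzero [B], divided by [S M], disappears in the limit. *)
Lemma fejer_bound M f z e B : circle z -> cont_on circle f ->
  (forall t, Cmod (f (cis t)) * fejer_kernel M z t <= e * fejer_kernel M z t + B) ->
  Cmod (fejer M f z) <= e + B / INR (S M).
Proof.
intros Hz Hf HB; assert (P := PI_RGT_0).
assert (SM : 0 < INR (S M)) by (apply lt_0_INR; lia).
assert (PS : 0 < 2 * PI * INR (S M)) by (apply Rmult_lt_0_compat; lra).
unfold fejer; rewrite Cmod_mult, Cmod_R, Rabs_pos_eq by (left; now apply Rinv_0_lt_compat).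
assert (Hi : is_RInt (fun t => e * fejer_kernel M z t + B) 0 (2 * PI)
   (e * (2 * PI * INR (S M)) + (2 * PI - 0) * B)).
{ apply (is_RInt_plus (V := R_NormedModule)).
  - apply (is_RInt_scal (V := R_NormedModule)); now apply is_RInt_fejer_kernel.
  - apply (is_RInt_const (V := R_NormedModule)). }
apply (Rmult_le_reg_l (2 * PI * INR (S M))); [exact PS|].
rewrite <- Rmult_assoc, Rinv_r, Rmult_1_l by lra.
eapply Rle_trans; [eapply CRInt_bound_fun; [lra| | |exact Hi]|].
- intros t _; apply cont_at_mult; [now apply cont_on_circle_cis|apply cont_at_fejer_kernel].
- intros t _; rewrite Cmod_mult, Cmod_R, Rabs_pos_eq by apply fejer_kernel_nonneg; apply HB.
- right; field; lra.
Qed.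

Lemma fejer_kernel_away M z t :
  circle z -> Cmod (cis t - z)%C ^ 2 * fejer_kernel M z t <= 4.
Proof.
intros Hz; unfold fejer_kernel; set (w := (z * cis (- t))%C).
assert (Hw : circle w) by (apply circle_mult; [exact Hz|apply Cmod_cis]).
assert (E : Cmod (cis t - z)%C = Cmod (1 - w)%C).
{ replace (cis t - z)%C with (cis t * (1 - w))%C.
  - rewrite Cmod_mult, Cmod_cis; ring.
  - unfold w; replace (cis t * (1 - z * cis (- t)))%C with (cis t - z * (cis t * cis (- t)))%C by ring.
    rewrite <- cis_plus, Rplus_opp_r, cis_0; ring. }
rewrite E, <- Rpow_mult_distr, <- Cmod_mult; unfold dirichlet; rewrite geometric_csum.
assert (B : Cmod (1 - w ^ S M)%C <= 2).
{ eapply Rle_trans; [apply Cmod_minus_le|].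
  rewrite Cmod_1, (circle_pow w (S M) Hw); lra. }
assert (B0 := Cmod_ge_0 (1 - w ^ S M)%C); nra.
Qed.

Lemma circle_bounded f : cont_on circle f -> exists F, 0 <= F /\ forall z, circle z -> Cmod (f z) <= F.
Proof.
intros Hf; assert (P := PI_RGT_0).
destruct (continuity_ab_maj (fun t => Cmod (f (cis t))) 0 (2 * PI)) as [tm [H1 _]]; [lra| |].
- intros t _; apply continuity_pt_locally; intros eps.
  destruct (cont_on_circle_cis f t Hf eps (cond_pos eps)) as [d [Hd H]].
  exists (mkposreal d Hd); intros u Hu.
  assert (E := H u Hu); assert (E1 := Cmod_minus_ge (f (cis u)) (f (cis t))).
  assert (E2 := Cmod_minus_ge (f (cis t)) (f (cis u))).
  replace (f (cis t) - f (cis u))%C with (- (f (cis u) - f (cis t)))%C in E2 by ring.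
  rewrite Cmod_opp in E2; apply Rabs_def1; lra.
- exists (Cmod (f (cis tm))); split; [apply Cmod_ge_0|]; intros z Hz.
  destruct (circle_cis z Hz) as [t [Ht ->]]; now apply H1.
Qed.

Lemma cont_on_minus D f g : cont_on D f -> cont_on D g -> cont_on D (fun z => (f z - g z)%C).
Proof.
intros Hf Hg z Hz eps He.
destruct (Hf z Hz (eps / 2) ltac:(lra)) as [d1 [H1 H1']].
destruct (Hg z Hz (eps / 2) ltac:(lra)) as [d2 [H2 H2']].
exists (Rmin d1 d2); split; [now apply Rmin_pos|]; intros w Hw Hwz.
assert (E1 := H1' w Hw (Rlt_le_trans _ _ _ Hwz (Rmin_l _ _))).
assert (E2 := H2' w Hw (Rlt_le_trans _ _ _ Hwz (Rmin_r _ _))).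
replace (f w - g w - (f z - g z))%C with ((f w - f z) + - (g w - g z))%C by ring.
eapply Rle_lt_trans; [apply Cmod_triangle|]; rewrite Cmod_opp; lra.
Qed.

Lemma cont_on_const D c : cont_on D (fun _ => c).
Proof.
intros z _ eps He; exists 1; split; [lra|]; intros.
replace (c - c)%C with (RtoC 0) by ring; now rewrite Cmod_0.
Qed.

Lemma fejer_minus M f g z : cont_on circle f -> cont_on circle g ->
  fejer M (fun w => (f w - g w)%C) z = (fejer M f z - fejer M g z)%C.
Proof.
intros Hf Hg; assert (P := PI_RGT_0); unfold fejer.
assert (Hc : forall h t, cont_on circle h ->
  cont_at (fun t => h (cis t) * RtoC (fejer_kernel M z t))%C t).
{ intros h t Hh; apply cont_at_mult; [now apply cont_on_circle_cis|apply cont_at_fejer_kernel]. }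
rewrite (CRInt_ext _ (fun t => (f (cis t) * RtoC (fejer_kernel M z t)
   - g (cis t) * RtoC (fejer_kernel M z t))%C)) by (lra || (intros; ring)).
rewrite CRInt_minus by (lra || (intros; now apply Hc)); ring.
Qed.

Lemma fejer_const M c z : circle z -> fejer M (fun _ => c) z = c.
Proof.
intros Hz; assert (P := PI_RGT_0).
assert (E := fejer_1 M z Hz); unfold fejer in *.
rewrite (CRInt_ext _ (fun t => (c * (RtoC 1 * RtoC (fejer_kernel M z t)))%C)) by (lra || (intros; ring)).
rewrite CRInt_mult_l; [|lra|].
- rewrite Cmult_assoc, (Cmult_comm _ c), <- Cmult_assoc, E; ring.
- intros t _; apply cont_at_mult; [apply cont_at_const|apply cont_at_fejer_kernel].
Qed.

Theorem fejer_convergence f : cont_on circle f -> forall eps, 0 < eps ->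
  exists M0, forall M, (M0 <= M)%nat -> forall z, circle z -> Cmod (fejer M f z - f z)%C <= eps.
Proof.
intros Hf eps He.
destruct (circle_bounded f Hf) as [F [F0 HF]].
destruct (uniform_continuity_circle f Hf (eps / 2) ltac:(lra)) as [d [Hd H]].
(* With this [B] the single majorant [eps / 2 + B * Cmod (cis t - z) ^ 2] is valid near [z] by
   uniform continuity and far from it by boundedness, so the integral need not be split. The kernel
   turns the square into the constant 4. *)
set (B := 2 * F / d ^ 2).
assert (d2 : 0 < d ^ 2) by (now apply pow_lt).
assert (B0 : 0 <= B) by (apply Rmult_le_pos; [lra|left; now apply Rinv_0_lt_compat]).
destruct (INR_unbounded (8 * B / eps)) as [M0 HM0].
exists M0; intros M HM z Hz.
assert (HM' : 8 * B / eps < INR (S M)).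
{ eapply Rlt_le_trans; [exact HM0|]; apply le_INR; lia. }
rewrite <- (fejer_const M (f z) z Hz) at 1.
rewrite <- fejer_minus by (exact Hf || apply cont_on_const).
assert (SM : 0 < INR (S M)) by (apply lt_0_INR; lia).
apply Rle_trans with (eps / 2 + 4 * B / INR (S M)).
- apply fejer_bound; [exact Hz|apply cont_on_minus; [exact Hf|apply cont_on_const]|].
  intros t; assert (K0 := fejer_kernel_nonneg M z t).
  assert (Hb : Cmod (f (cis t) - f z)%C <= eps / 2 + B * Cmod (cis t - z)%C ^ 2).
  { assert (Sq : 0 <= Cmod (cis t - z)%C ^ 2) by apply pow2_ge_0.
    destruct (Rlt_dec (Cmod (cis t - z)%C) d) as [Y|Y].
    - assert (E := H z (cis t) Hz (Cmod_cis t) Y).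
      assert (0 <= B * Cmod (cis t - z)%C ^ 2) by (now apply Rmult_le_pos); lra.
    - apply Rnot_lt_le in Y.
      assert (E : Cmod (f (cis t) - f z)%C <= 2 * F).
      { eapply Rle_trans; [apply Cmod_minus_le|].
        assert (E1 := HF (cis t) (Cmod_cis t)); assert (E2 := HF z Hz); lra. }
      assert (E2 : d ^ 2 <= Cmod (cis t - z)%C ^ 2) by (apply pow_incr; lra).
      assert (E3 : B * d ^ 2 = 2 * F) by (unfold B; field; lra).
      assert (B * d ^ 2 <= B * Cmod (cis t - z)%C ^ 2) by (now apply Rmult_le_compat_l); lra. }
  assert (A := fejer_kernel_away M z t Hz).
  apply Rle_trans with ((eps / 2 + B * Cmod (cis t - z)%C ^ 2) * fejer_kernel M z t).
  + now apply Rmult_le_compat_r.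
  + assert (B * (Cmod (cis t - z)%C ^ 2 * fejer_kernel M z t) <= B * 4)
      by (now apply Rmult_le_compat_l).
    lra.
- apply (Rmult_lt_compat_r eps) in HM'; [|exact He].
  unfold Rdiv in HM'; rewrite Rmult_assoc, Rinv_l, Rmult_1_r in HM' by lra.
  assert (4 * B / INR (S M) <= eps / 2); [|lra].
  apply (Rmult_le_reg_r (INR (S M))); [exact SM|].
  unfold Rdiv at 1; rewrite Rmult_assoc, Rinv_l by lra; lra.
Qed.

(** On the circle [z ^ k * Cconj (z ^ l)] is [z ^ (k - l)] when [l <= k], and for [l > k] its
    Fourier coefficient has negative index. The identity is confined to the circle, since [fejer]
    itself is not analytic in [z]. *)
Lemma fejer_polynomial M f : cont_on circle f ->
  (forall j, (j < 0)%Z -> fourier_coef f j = RtoC 0) ->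
  exists a, forall z, circle z -> fejer M f z = pev M a z.
Proof.
intros Hf Hneg.
assert (Pm : forall (g : nat -> C -> C) N, (forall k, (k <= N)%nat -> poly_le M (g k)) ->
  poly_le M (fun z => csum (fun k => g k z) N)).
{ intros g N; induction N as [|N IH]; intros Hg.
  - apply poly_le_ext with (g 0%nat); [intros; now rewrite csum_0|apply Hg; lia].
  - apply poly_le_ext with (fun z => (csum (fun k => g k z) N + g (S N) z)%C).
    + intros; now rewrite csum_S.
    + apply poly_le_plus; [apply IH; intros; apply Hg; lia|apply Hg; lia]. }
assert (Pj : forall c j, (j <= M)%nat -> poly_le M (fun z => (c * z ^ j)%C)).
{ intros c j Hj; apply poly_le_weaken with j; [exact Hj|]; apply poly_le_scal.
  exists (fun k => if Nat.eqb k j then RtoC 1 else RtoC 0); intros z; unfold pev.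
  rewrite (csum_ext _ (fun k => if Nat.eqb k j then (z ^ k)%C else RtoC 0)).
  - now rewrite csum_delta.
  - intros k _; destruct (Nat.eqb_spec k j); ring. }
destruct (Pm (fun k z => csum (fun l => if le_dec l k
     then (fourier_coef f (Z.of_nat k - Z.of_nat l) * z ^ (k - l))%C else RtoC 0) M) M) as [a Ha].
{ intros k Hk; apply (Pm (fun l z => if le_dec l k
     then (fourier_coef f (Z.of_nat k - Z.of_nat l) * z ^ (k - l))%C else RtoC 0)).
  intros l Hl; destruct (le_dec l k).
  - apply Pj; lia.
  - apply poly_le_ext with (fun z => (RtoC 0 * z ^ 0)%C); [intros; ring|apply Pj; lia]. }
exists (fun j => (RtoC (/ INR (S M)) * a j)%C); intros z Hz.
rewrite fejer_expansion by exact Hf.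
transitivity (RtoC (/ INR (S M)) * pev M a z)%C.
- rewrite <- Ha; f_equal; apply csum_ext; intros k _; apply csum_ext; intros l _.
  destruct (le_dec l k) as [Hl|Hl].
  + replace (z ^ k)%C with (z ^ (k - l) * z ^ l)%C by (rewrite <- Cpow_add_r; f_equal; lia).
    replace (z ^ (k - l) * z ^ l * Cconj (z ^ l))%C with (z ^ (k - l) * (z ^ l * Cconj (z ^ l)))%C by ring.
    rewrite circle_conj by (now apply circle_pow); ring.
  + rewrite Hneg by lia; ring.
- unfold pev; rewrite <- csum_mult_l; apply csum_ext; intros; ring.
Qed.

Lemma cont_on_Delta tau f : circle tau -> cont_on circle f -> cont_on circle (Defs.Delta tau f).
Proof.
intros Ht Hf; apply cont_on_minus; [|exact Hf].
intros z Hz eps He; destruct (Hf (tau * z)%C (circle_mult _ _ Ht Hz) eps He) as [d [Hd H]].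
exists d; split; [exact Hd|]; intros w Hw Hwz; apply H; [now apply circle_mult|].
replace (tau * w - tau * z)%C with (tau * (w - z))%C by ring.
rewrite Cmod_mult, Ht; lra.
Qed.

Lemma fejer_rotation M f tau z : circle tau -> cont_on circle f ->
  fejer M f (tau * z)%C = fejer M (fun w => f (tau * w)%C) z.
Proof.
intros Ht Hf; assert (P := PI_RGT_0); destruct (circle_cis tau Ht) as [s [_ ->]].
unfold fejer; f_equal.
rewrite <- (CRInt_periodic _ (2 * PI) s).
- apply CRInt_ext; [lra|]; intros t _; unfold fejer_kernel.
  rewrite (Rplus_comm t s), cis_plus; do 4 f_equal.
  replace (- (s + t)) with (- s + - t) by ring; rewrite cis_plus.
  replace (cis s * z * (cis (- s) * cis (- t)))%C with (cis s * cis (- s) * z * cis (- t))%C by ring.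
  rewrite <- cis_plus, Rplus_opp_r, cis_0; f_equal; ring.
- lra.
- intros t; apply cont_at_mult; [now apply cont_on_circle_cis|apply cont_at_fejer_kernel].
- intros t; unfold fejer_kernel.
  replace (- (t + 2 * PI)) with (- t + - (2 * PI)) by ring.
  rewrite !cis_plus, !cis_opp, cis_2PI.
  replace (Cconj 1) with (RtoC 1) by (unfold Cconj, RtoC; simpl; f_equal; ring).
  now rewrite !Cmult_1_r.
Qed.

Lemma fejer_Delta M f tau z n : circle tau -> circle z -> cont_on circle f ->
  Nat.iter n (Defs.Delta tau) (fejer M f) z = fejer M (Nat.iter n (Defs.Delta tau) f) z.
Proof.
intros Ht Hz; revert f z Hz; induction n as [|n IH]; intros f z Hz Hf; [reflexivity|].
assert (Hn : cont_on circle (Nat.iter n (Defs.Delta tau) f)).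
{ clear IH; induction n as [|n IHn]; [exact Hf|now apply cont_on_Delta]. }
simpl; unfold Defs.Delta at 1; rewrite !IH by (assumption || now apply circle_mult).
rewrite fejer_rotation by assumption.
unfold Defs.Delta at 3; rewrite fejer_minus; [reflexivity| |exact Hn].
intros w Hw eps He; destruct (Hn (tau * w)%C (circle_mult _ _ Ht Hw) eps He) as [d [Hd H]].
exists d; split; [exact Hd|]; intros y Hy Hyw; apply H; [now apply circle_mult|].
replace (tau * y - tau * w)%C with (tau * (y - w))%C by ring.
rewrite Cmod_mult, Ht; lra.
Qed.

Lemma iter_Delta_ext n tau f g z : circle tau -> circle z ->
  (forall w, circle w -> f w = g w) ->
  Nat.iter n (Defs.Delta tau) f z = Nat.iter n (Defs.Delta tau) g z.
Proof.
intros Ht Hz E; revert z Hz; induction n as [|n IH]; intros z Hz; [now apply E|].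
simpl; unfold Defs.Delta at 1 3; rewrite !IH by (assumption || now apply circle_mult); reflexivity.
Qed.

Lemma iter_Delta_pev n tau N a z :
  Nat.iter n (Defs.Delta tau) (pev N a) z = csum (fun j => (a j * (tau ^ j - 1) ^ n * z ^ j)%C) N.
Proof.
revert z; induction n as [|n IH]; intros z.
- apply csum_ext; intros; simpl; ring.
- simpl; unfold Defs.Delta at 1; rewrite !IH, <- csum_minus; apply csum_ext; intros j _.
  rewrite Cpow_mult_l; simpl; ring.
Qed.

(** The means commute with rotations, hence with the differences, and average against a positive
    kernel of mean one: the constant [A] is kept unchanged. On the polynomial side [Delta tau]
    multiplies [z ^ j] by [tau ^ j - 1]. *)
Theorem fejer_zygmund M f n al A a : cont_on circle f ->
  (forall z, circle z -> fejer M f z = pev M a z) ->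
  (forall tau z, circle tau -> circle z ->
     Cmod (Nat.iter n (Defs.Delta tau) f z) <= A * nnpow (Cmod (1 - tau)%C) al) ->
  forall tau z, circle tau -> circle z ->
    Cmod (csum (fun j => (a j * (tau ^ j - 1) ^ n * z ^ j)%C) M) <= A * nnpow (Cmod (1 - tau)%C) al.
Proof.
intros Hf Ha HA tau z Ht Hz.
rewrite <- iter_Delta_pev, <- (iter_Delta_ext n tau (fejer M f)) by assumption.
rewrite fejer_Delta by assumption.
assert (Hn : cont_on circle (Nat.iter n (Defs.Delta tau) f)).
{ clear HA; induction n as [|k IHn]; [exact Hf|now apply cont_on_Delta]. }
rewrite <- (Rplus_0_r (A * _)).
replace 0 with (0 / INR (S M)) by (field; apply not_0_INR; lia).
apply fejer_bound; [exact Hz|exact Hn|]; intros t; rewrite Rplus_0_r.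
apply Rmult_le_compat_r; [apply fejer_kernel_nonneg|]; apply HA; [exact Ht|apply Cmod_cis].
Qed.

(** * Disk algebra extension and functional calculus *)

Lemma cauchy_limit {V : CompleteNormedModule C_AbsRing} (u : nat -> V) :
  (forall eps, 0 < eps -> exists N, forall n p, (N <= n)%nat -> (N <= p)%nat ->
     norm (minus (u n) (u p)) <= eps) ->
  exists l, forall eps, 0 < eps -> exists N, forall n, (N <= n)%nat -> norm (minus (u n) l) <= eps.
Proof.
intros Hu.
set (F := filtermap u eventually).
assert (PF : ProperFilter F) by apply filtermap_proper_filter, eventually_filter.
assert (CF : cauchy F).
{ intros eps; destruct (Hu (eps / 2)) as [N HN]; [apply is_pos_div_2|].
  exists (u N); exists N; intros n Hn; apply (norm_compat1 (K := C_AbsRing) (V := V)).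
  eapply Rle_lt_trans; [exact (HN n N Hn (le_n N))|].
  assert (P := cond_pos eps); lra. }
exists (lim F); intros eps He.
assert (Hf := norm_factor_gt_0 (V := V)).
assert (He' : 0 < eps / norm_factor (V := V)) by (now apply Rdiv_lt_0_compat).
destruct (complete_cauchy F PF CF (mkposreal _ He')) as [N HN].
exists N; intros n Hn; left.
assert (E := norm_compat2 (V := V) (lim F) (u n) (mkposreal _ He') (HN n Hn)).
simpl in E; replace (norm_factor * (eps / norm_factor)) with eps in E by (field; lra); exact E.
Qed.

Lemma cauchy_limit_C (u : nat -> C) :
  (forall eps, 0 < eps -> exists N, forall n p, (N <= n)%nat -> (N <= p)%nat ->
     Cmod (u n - u p)%C <= eps) ->
  exists l, forall eps, 0 < eps -> exists N, forall n, (N <= n)%nat -> Cmod (u n - l)%C <= eps.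
Proof. exact (cauchy_limit (V := C_CompleteNormedModule) u). Qed.

Lemma maximum_principle_poly d f M : poly_le d f ->
  (forall z, circle z -> Cmod (f z) <= M) -> forall z, Cmod z <= 1 -> Cmod (f z) <= M.
Proof.
intros [c Hc] HM z Hz; rewrite Hc; apply maximum_principle_pev; [|exact Hz].
intros w Hw; rewrite <- Hc; now apply HM.
Qed.

Lemma poly_le_pev N a : poly_le N (pev N a).
Proof. now exists a. Qed.

Lemma poly_le_pev_minus N a P b : poly_le (Nat.max N P) (fun z => (pev N a z - pev P b z)%C).
Proof.
apply poly_le_ext with (fun z => (pev N a z + (- RtoC 1) * pev P b z)%C); [intros; ring|].
apply poly_le_plus.
- apply poly_le_weaken with N; [lia|apply poly_le_pev].
- apply poly_le_weaken with P; [lia|apply poly_le_scal, poly_le_pev].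
Qed.

(** On the circle [w - z] is at least [1 - Cmod z] in modulus and can be divided out; the maximum
    principle carries the bound to the interior, including the neighbourhood of [z]. *)
Lemma factor_bound d f g B z : poly_le d g -> Cmod z < 1 ->
  (forall w, (f w - f z)%C = ((w - z) * g w)%C) ->
  (forall w, Cmod w <= 1 -> Cmod (f w) <= B) ->
  forall w, Cmod w <= 1 -> Cmod (g w) <= 2 * B / (1 - Cmod z).
Proof.
intros Hg Hz E HB; apply (maximum_principle_poly d); [exact Hg|]; intros w Hw.
assert (D : 1 - Cmod z <= Cmod (w - z)%C).
{ assert (E' := Cmod_minus_ge w z); rewrite Hw in E'; exact E'. }
assert (G := Cmod_ge_0 (g w)).
assert (K : Cmod (w - z)%C * Cmod (g w) <= 2 * B).
{ rewrite <- Cmod_mult, <- E; eapply Rle_trans; [apply Cmod_minus_le|].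
  unfold circle in Hw.
  assert (B1 := HB w ltac:(lra)); assert (B2 := HB z ltac:(lra)); lra. }
apply (Rmult_le_reg_l (1 - Cmod z)); [lra|].
replace ((1 - Cmod z) * (2 * B / (1 - Cmod z))) with (2 * B) by (field; lra); nra.
Qed.

Section UniformLimit.
Variables (N : nat -> nat) (a : nat -> nat -> C) (f : C -> C).
Let q (i : nat) : C -> C := pev (N i) (a i).
Hypothesis f_cont : cont_on circle f.
Hypothesis q_conv : forall eps, 0 < eps -> exists i0, forall i, (i0 <= i)%nat ->
  forall z, circle z -> Cmod (q i z - f z)%C <= eps.

Lemma q_cauchy eps : 0 < eps -> exists i0, forall i j, (i0 <= i)%nat -> (i0 <= j)%nat ->
  forall z, Cmod z <= 1 -> Cmod (q i z - q j z)%C <= eps.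
Proof.
intros He; destruct (q_conv (eps / 2) ltac:(lra)) as [i0 H]; exists i0; intros i j Hi Hj.
apply (maximum_principle_poly _ _ _ (poly_le_pev_minus (N i) (a i) (N j) (a j))).
intros z Hz; change (Cmod (q i z - q j z)%C <= eps).
eapply Rle_trans; [apply (Cmod_dist_triangle _ _ (f z))|].
assert (E1 := H i Hi z Hz); assert (E2 := H j Hj z Hz); lra.
Qed.

Lemma uniform_limit_exists : exists F : C -> C,
  forall eps, 0 < eps -> exists i0, forall i, (i0 <= i)%nat ->
    forall z, Cmod z <= 1 -> Cmod (q i z - F z)%C <= eps.
Proof.
assert (E : forall z, exists l, Cmod z <= 1 -> forall eps, 0 < eps ->
  exists i0, forall i, (i0 <= i)%nat -> Cmod (q i z - l)%C <= eps).
{ intros z; destruct (Rle_dec (Cmod z) 1) as [Hz|Hz]; [|exists (RtoC 0); tauto].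
  destruct (cauchy_limit_C (fun i => q i z)) as [l Hl].
  - intros eps He; destruct (q_cauchy eps He) as [i0 H]; exists i0; intros i j Hi Hj; now apply H.
  - exists l; intros _; exact Hl. }
exists (fun z => epsilon (inhabits (RtoC 0)) (fun l => Cmod z <= 1 -> forall eps, 0 < eps ->
  exists i0, forall i, (i0 <= i)%nat -> Cmod (q i z - l)%C <= eps)).
intros eps He; destruct (q_cauchy eps He) as [i0 H]; exists i0; intros i Hi z Hz.
assert (HF := epsilon_spec (inhabits (RtoC 0)) _ (E z) Hz); cbv beta in HF.
set (l := epsilon _ _) in *; apply le_epsilon; intros e He'.
destruct (HF e He') as [j0 Hj].
replace (q i z - l)%C with ((q i z - q (Nat.max i0 j0) z) + (q (Nat.max i0 j0) z - l))%C by ring.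
eapply Rle_trans; [apply Cmod_triangle|].
apply Rplus_le_compat; [apply H; lia || exact Hz|apply Hj; lia].
Qed.

Lemma uniform_limit_bounded : exists B i0, forall i, (i0 <= i)%nat ->
  forall z, Cmod z <= 1 -> Cmod (q i z) <= B.
Proof.
destruct (circle_bounded f f_cont) as [B [_ HB]].
destruct (q_conv 1 Rlt_0_1) as [i0 H]; exists (1 + B), i0; intros i Hi.
apply maximum_principle_pev; intros z Hz; change (Cmod (q i z) <= 1 + B).
replace (q i z) with ((q i z - f z) + f z)%C by ring.
eapply Rle_trans; [apply Cmod_triangle|]; apply Rplus_le_compat; [now apply H|now apply HB].
Qed.

Variable F : C -> C.
Hypothesis F_lim : forall eps, 0 < eps -> exists i0, forall i, (i0 <= i)%nat ->
    forall z, Cmod z <= 1 -> Cmod (q i z - F z)%C <= eps.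

Lemma uniform_limit_circle z : circle z -> F z = f z.
Proof.
intros Hz; assert (E : Cmod (F z - f z)%C = 0).
{ apply Rle_antisym; [|apply Cmod_ge_0]; apply le_epsilon; intros eps He; rewrite Rplus_0_l.
  destruct (F_lim (eps / 2) ltac:(lra)) as [i1 H1]; destruct (q_conv (eps / 2) ltac:(lra)) as [i2 H2].
  set (i := Nat.max i1 i2).
  replace (F z - f z)%C with (- (q i z - F z) + (q i z - f z))%C by ring.
  eapply Rle_trans; [apply Cmod_triangle|]; rewrite Cmod_opp.
  assert (E1 := H1 i ltac:(lia) z); assert (E2 := H2 i ltac:(lia) z Hz).
  unfold circle in Hz; specialize (E1 ltac:(lra)); lra. }
apply Cmod_eq_0 in E; replace (F z) with ((F z - f z) + f z)%C by ring; rewrite E; ring.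
Qed.

Lemma uniform_limit_cont : cont_on closed_disk F.
Proof.
intros z Hz eps He; destruct (F_lim (eps / 4) ltac:(lra)) as [i0 H].
destruct (cont_pev (N i0) (a i0) z Hz (eps / 4) ltac:(lra)) as [d [Hd Hc]].
exists d; split; [exact Hd|]; intros w Hw Hwz.
assert (E := Hc w Hw Hwz); fold (q i0) in E.
assert (E1 := H i0 (le_n _) z Hz); assert (E2 := H i0 (le_n _) w Hw).
replace (F w - F z)%C with (- (q i0 w - F w) + ((q i0 w - q i0 z) + (q i0 z - F z)))%C by ring.
eapply Rle_lt_trans; [apply Cmod_triangle|]; rewrite Cmod_opp.
assert (T := Cmod_triangle (q i0 w - q i0 z) (q i0 z - F z)); lra.
Qed.

(* Dividing out [w - z] twice and applying the maximum principle bounds the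
   second-order remainder of every [q i] at [z], uniformly in [i]. *)
Lemma uniform_limit_cdiff z : Cmod z < 1 -> cdiff_at F z.
Proof.
intros Hz; destruct uniform_limit_bounded as [B [i1 HB]].
assert (B0 : 0 <= B).
{ eapply Rle_trans; [apply Cmod_ge_0|apply (HB i1 (le_n _) z); lra]. }
set (phi := fun i => epsilon (inhabits (fun _ : nat => RtoC 0))
  (fun b => forall w, (q i w - q i z)%C = ((w - z) * pev (N i) b w)%C)).
assert (Hphi : forall i w, (q i w - q i z)%C = ((w - z) * pev (N i) (phi i) w)%C).
{ intros i; exact (epsilon_spec (inhabits (fun _ : nat => RtoC 0)) _ (pev_factor (N i) (a i) z)). }
clearbody phi.
(* [pev (N i) (phi i) z] is the derivative of [q i] at [z]. These derivatives form a Cauchy sequence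
   because [factor_bound] applies to differences of the [q i], with loss [2 / (1 - Cmod z)]. *)
destruct (cauchy_limit_C (fun i => pev (N i) (phi i) z)) as [l Hl].
{ intros eps He.
  destruct (q_cauchy (eps * (1 - Cmod z) / 2)) as [i0 H].
  { apply Rdiv_lt_0_compat; [apply Rmult_lt_0_compat|]; lra. }
  exists i0; intros i j Hi Hj.
  eapply Rle_trans.
  - apply (factor_bound _ (fun w => q i w - q j w)%C
      (fun w => pev (N i) (phi i) w - pev (N j) (phi j) w)%C (eps * (1 - Cmod z) / 2) z
      (poly_le_pev_minus (N i) (phi i) (N j) (phi j)) Hz).
    + intros w.
      replace (q i w - q j w - (q i z - q j z))%C with ((q i w - q i z) - (q j w - q j z))%C by ring.
      rewrite !Hphi; ring.
    + intros w Hw; now apply H.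
    + lra.
  - right; field; lra. }
set (K := 2 * (2 * B / (1 - Cmod z)) / (1 - Cmod z)).
assert (K0 : 0 <= K).
{ unfold K, Rdiv; assert (0 < / (1 - Cmod z)) by (apply Rinv_0_lt_compat; lra).
  repeat apply Rmult_le_pos; lra. }
apply cdiff_quadratic with (l := l) (K := K); [exact K0| |exact Hz].
intros w Hwz.
assert (Hw : Cmod w <= 1) by (assert (E := Cmod_minus_ge w z); lra).
assert (R : forall i, (i1 <= i)%nat ->
  Cmod (q i w - q i z - pev (N i) (phi i) z * (w - z))%C <= K * Cmod (w - z)%C ^ 2).
{ intros i Hi; destruct (pev_factor (N i) (phi i) z) as [c Hc].
  rewrite Hphi.
  replace ((w - z) * pev (N i) (phi i) w - pev (N i) (phi i) z * (w - z))%C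
    with ((pev (N i) (phi i) w - pev (N i) (phi i) z) * (w - z))%C by ring.
  rewrite Hc.
  replace ((w - z) * pev (N i) c w * (w - z))%C with (pev (N i) c w * (w - z) ^ 2)%C by (simpl; ring).
  rewrite Cmod_mult, Cmod_pow; apply Rmult_le_compat_r; [apply pow2_ge_0|].
  apply (factor_bound (N i) (pev (N i) (phi i)) _ _ z (poly_le_pev _ _) Hz Hc); [|exact Hw].
  apply (factor_bound (N i) (q i) _ _ z (poly_le_pev _ _) Hz (Hphi i)).
  intros y Hy; now apply HB. }
apply le_epsilon; intros eps He.
destruct (F_lim (eps / 4) ltac:(lra)) as [i2 H2]; destruct (Hl (eps / 4) ltac:(lra)) as [i3 H3].
set (i := Nat.max i1 (Nat.max i2 i3)).
assert (E1 := R i ltac:(lia)); assert (E2 := H2 i ltac:(lia) w Hw).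
assert (E3 := H2 i ltac:(lia) z ltac:(lra)); assert (E4 := H3 i ltac:(lia)).
cbv beta in E4; set (s := pev (N i) (phi i) z) in *.
replace (F w - F z - l * (w - z))%C
  with ((q i w - q i z - s * (w - z)) + (- (q i w - F w) + ((q i z - F z) + (s - l) * (w - z))))%C by ring.
eapply Rle_trans; [apply Cmod_triangle|]; apply Rplus_le_compat; [exact E1|].
eapply Rle_trans; [apply Cmod_triangle|]; rewrite Cmod_opp.
assert (T := Cmod_triangle (q i z - F z) ((s - l) * (w - z))); rewrite Cmod_mult in T.
assert (P := Cmod_ge_0 (s - l)%C); assert (P' := Cmod_ge_0 (w - z)%C); assert (P'' := Cmod_ge_0 z).
nra.
Qed.

End UniformLimit.

Lemma cdiff_minus f g z : cdiff_at f z -> cdiff_at g z -> cdiff_at (fun w => (f w - g w)%C) z.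
Proof.
intros [lf Hf] [lg Hg]; exists (lf - lg)%C; intros eps He.
destruct (Hf (eps / 2) ltac:(lra)) as [d1 [D1 H1]]; destruct (Hg (eps / 2) ltac:(lra)) as [d2 [D2 H2]].
exists (Rmin d1 d2); split; [now apply Rmin_pos|]; intros w Hw.
assert (E1 := H1 w (Rlt_le_trans _ _ _ Hw (Rmin_l _ _))).
assert (E2 := H2 w (Rlt_le_trans _ _ _ Hw (Rmin_r _ _))).
replace (f w - g w - (f z - g z) - (lf - lg) * (w - z))%C
  with ((f w - f z - lf * (w - z)) + - (g w - g z - lg * (w - z)))%C by ring.
eapply Rle_trans; [apply Cmod_triangle|]; rewrite Cmod_opp; lra.
Qed.

(** The limit constructed above proves that an extension exists; the one picked by [epsilon] is then
    reached by applying the maximum principle to its difference with the polynomials. *)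
Lemma disk_extension_uniform (N : nat -> nat) (a : nat -> nat -> C) f : cont_on circle f ->
  (forall eps, 0 < eps -> exists i0, forall i, (i0 <= i)%nat ->
     forall z, circle z -> Cmod (pev (N i) (a i) z - f z)%C <= eps) ->
  forall eps, 0 < eps -> exists i0, forall i, (i0 <= i)%nat ->
     forall z, Cmod z <= 1 -> Cmod (pev (N i) (a i) z - disk_extension f z)%C <= eps.
Proof.
intros Hf Hq.
assert (Ex : exists F, disk_algebra F /\ forall zeta, circle zeta -> F zeta = f zeta).
{ destruct (uniform_limit_exists N a f Hq) as [F HF]; exists F; split; [split|].
  - apply continuous_on_iff; exact (uniform_limit_cont N a F HF).
  - intros z Hz; apply ex_derive_cdiff; exact (uniform_limit_cdiff N a f Hf Hq F HF z Hz).
  - exact (uniform_limit_circle N a f Hq F HF). }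
assert (Sp := epsilon_spec (inhabits (fun _ : C => RtoC 0)) _ Ex).
fold (disk_extension f) in Sp; destruct Sp as [[Hc Hd] Hb].
intros eps He; destruct (Hq eps He) as [i0 H]; exists i0; intros i Hi.
apply (maximum_principle (fun z => pev (N i) (a i) z - disk_extension f z)%C).
- apply cont_on_minus; [apply cont_pev|now apply continuous_on_iff].
- intros z Hz; apply cdiff_minus; [now apply cdiff_pev|apply ex_derive_cdiff; now apply Hd].
- intros z Hz; rewrite Hb by exact Hz; now apply H.
Qed.

(** Zero padding: a coefficient sequence is arbitrary beyond its degree, so it must be cut before
    two polynomials are brought to a common length. *)
Definition truncate (N : nat) (a : nat -> C) (k : nat) : C := if le_dec k N then a k else RtoC 0.

Lemma pev_extend N P a z : (N <= P)%nat -> pev P (truncate N a) z = pev N a z.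
Proof.
intros H; rewrite (pev_truncate P N) by
  (exact H || (intros j Hj; unfold truncate; destruct (le_dec j N); [lia|reflexivity])).
apply csum_ext; intros k Hk; unfold truncate; destruct (le_dec k N); [reflexivity|lia].
Qed.

Lemma pop_extend {V : NormedModule C_AbsRing} N P a (T : V -> V) x :
  (N <= P)%nat -> pop P (truncate N a) T x = pop N a T x.
Proof.
intros H; rewrite (pop_truncate P N) by
  (exact H || (intros j Hj; unfold truncate; destruct (le_dec j N); [lia|reflexivity])).
apply vsum_ext; intros k Hk; unfold truncate; destruct (le_dec k N); [reflexivity|lia].
Qed.

Lemma von_neumann_minus {H : HilbertSpace} (T : H -> H) N a P b M x :
  is_linear T -> (forall x, norm (T x) <= norm x) ->
  (forall z, circle z -> Cmod (pev N a z - pev P b z)%C <= M) ->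
  norm (minus (pop N a T x) (pop P b T x)) <= M * norm x.
Proof.
intros HT HT1 HM; set (R := Nat.max N P).
assert (E : minus (pop N a T x) (pop P b T x)
  = pop R (fun j => (truncate N a j - truncate P b j)%C) T x).
{ rewrite pop_minus, !pop_extend by lia; reflexivity. }
rewrite E; apply von_neumann; [exact HT|exact HT1|]; intros z Hz.
rewrite pev_minus, !pev_extend by lia; now apply HM.
Qed.

(** * Operator norms and the functional calculus of a contraction *)

Lemma op_norm_le {H : HilbertSpace} (A : H -> H) K :
  Rbar_le (op_norm A) (Finite K) <-> forall x, norm x <= 1 -> norm (A x) <= K.
Proof.
unfold op_norm; set (E := fun r : R => exists x : H, norm x <= 1 /\ r = norm (A x)).
destruct (Lub_Rbar_correct E) as [U L]; split.
- intros HK x Hx; assert (Ex : E (norm (A x))) by (now exists x).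
  exact (Rbar_le_trans (Finite (norm (A x))) _ _ (U _ Ex) HK).
- intros HK; apply L; intros r [x [Hx ->]]; exact (HK x Hx).
Qed.

Lemma op_norm_finite {H : HilbertSpace} (A : H -> H) K :
  (forall x, norm x <= 1 -> norm (A x) <= K) -> op_norm A = Finite (real (op_norm A)).
Proof.
intros HK; apply op_norm_le in HK.
assert (Z : Rbar_le (Finite 0) (op_norm A)).
{ unfold op_norm; set (E := fun r : R => exists x : H, norm x <= 1 /\ r = norm (A x)).
  destruct (Lub_Rbar_correct E) as [U _].
  apply Rbar_le_trans with (Finite (norm (A zero))); [apply norm_ge_0|].
  apply U; exists zero; split; [|reflexivity].
  eapply Rle_trans; [right; exact (norm_zero (K := C_AbsRing) (V := H))|lra]. }
destruct (op_norm A); [reflexivity|contradiction|contradiction].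
Qed.

Lemma linear_bound_ball {V W : NormedModule C_AbsRing} (A : V -> W) K : is_linear A ->
  (forall x, norm x <= 1 -> norm (A x) <= K) -> forall x, norm (A x) <= K * norm x.
Proof.
intros HA HK x; assert (X0 := norm_ge_0 x).
destruct (Req_EM_T (norm x) 0) as [E|E].
- destruct (linear_norm A HA) as [k [_ Hk]]; specialize (Hk x); rewrite E in Hk |- *; lra.
- assert (Ei : 0 < / norm x) by (apply Rinv_0_lt_compat; lra).
  assert (HU := HK (scal (RtoC (/ norm x)) x)).
  rewrite norm_scal_C, Cmod_R, Rabs_pos_eq, Rinv_l in HU by lra.
  specialize (HU (Rle_refl 1)).
  assert (L : A (scal (RtoC (/ norm x)) x) = scal (RtoC (/ norm x)) (A x))
    by apply (linear_scal A HA).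
  rewrite L, norm_scal_C, Cmod_R, Rabs_pos_eq in HU by lra.
  apply (Rmult_le_reg_l (/ norm x)); [exact Ei|].
  replace (/ norm x * (K * norm x)) with K by (field; exact E); exact HU.
Qed.

Lemma contraction_bound {H : HilbertSpace} (T : H -> H) : contraction T ->
  is_linear T /\ forall x, norm (T x) <= norm x.
Proof.
intros [HT HT1]; split; [exact HT|]; intros x; rewrite <- (Rmult_1_l (norm x)).
apply linear_bound_ball; [exact HT|]; now apply op_norm_le.
Qed.

Lemma is_linear_pointwise_limit {V W : NormedModule C_AbsRing} (P : nat -> V -> W) (A : V -> W) :
  (forall i, is_linear (P i)) ->
  (forall x eps, 0 < eps -> exists i0, forall i, (i0 <= i)%nat -> norm (minus (P i x) (A x)) <= eps) ->
  (exists K, 0 < K /\ forall x, norm (A x) <= K * norm x) -> is_linear A.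
Proof.
intros HP HA HK.
assert (Heq : forall x y : W, (forall eps, 0 < eps -> norm (minus x y) <= eps) -> x = y).
{ intros x y E; apply norm_eq_minus, Rle_antisym; [|apply norm_ge_0].
  apply le_epsilon; intros eps He; rewrite Rplus_0_l; now apply E. }
split; [| |exact HK].
- intros x y; apply Heq; intros eps He.
  destruct (HA (plus x y) (eps / 3) ltac:(lra)) as [i1 H1].
  destruct (HA x (eps / 3) ltac:(lra)) as [i2 H2]; destruct (HA y (eps / 3) ltac:(lra)) as [i3 H3].
  set (i := Nat.max i1 (Nat.max i2 i3)).
  assert (E1 := H1 i ltac:(lia)); assert (E2 := H2 i ltac:(lia)); assert (E3 := H3 i ltac:(lia)).
  rewrite (linear_plus _ (HP i)) in E1.
  eapply Rle_trans; [apply (norm_minus_triangle _ (plus (P i x) (P i y)))|].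
  rewrite norm_minus_sym; eapply Rle_trans; [apply Rplus_le_compat_l, norm_minus_plus_le|]; lra.
- intros c x; apply Heq; intros eps He; assert (C0 := Cmod_ge_0 c).
  destruct (HA (scal c x) (eps / 2) ltac:(lra)) as [i1 H1].
  destruct (HA x (eps / (2 * (1 + Cmod c)))) as [i2 H2]; [apply Rdiv_lt_0_compat; lra|].
  set (i := Nat.max i1 i2).
  assert (E1 := H1 i ltac:(lia)); assert (E2 := H2 i ltac:(lia)).
  rewrite (linear_scal _ (HP i)) in E1.
  eapply Rle_trans; [apply (norm_minus_triangle _ (scal c (P i x)))|].
  rewrite norm_minus_sym.
  assert (E3 : norm (minus (scal c (P i x)) (scal c (A x))) <= eps / 2).
  { eapply Rle_trans; [right; exact (f_equal norm (eq_sym (scal_minus c (P i x) (A x))))|].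
    eapply Rle_trans; [right; apply norm_scal_C|].
    apply Rle_trans with ((1 + Cmod c) * (eps / (2 * (1 + Cmod c)))).
    - apply Rmult_le_compat; [exact C0|apply norm_ge_0|lra|exact E2].
    - right; field; lra. }
  eapply Rle_trans; [apply Rplus_le_compat; [exact E1|exact E3]|lra].
Qed.

Section Calculus.
Context {H : HilbertSpace}.
Variable S0 : H -> H.
Hypothesis S_lin : is_linear S0.
Hypothesis S_contr : forall x, norm (S0 x) <= norm x.
Variables (N : nat -> nat) (a : nat -> nat -> C) (F : C -> C).
Hypothesis F_lim : forall eps, 0 < eps -> exists i0, forall i, (i0 <= i)%nat ->
  forall z, Cmod z <= 1 -> Cmod (pev (N i) (a i) z - F z)%C <= eps.

Lemma pop_cauchy eps : 0 < eps -> exists i0, forall i j, (i0 <= i)%nat -> (i0 <= j)%nat ->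
  forall x, norm (minus (pop (N i) (a i) S0 x) (pop (N j) (a j) S0 x)) <= eps * norm x.
Proof.
intros He; destruct (F_lim (eps / 2) ltac:(lra)) as [i0 H0]; exists i0; intros i j Hi Hj x.
apply von_neumann_minus; [exact S_lin|exact S_contr|]; intros z Hz.
unfold circle in Hz.
assert (E1 := H0 i Hi z ltac:(lra)); assert (E2 := H0 j Hj z ltac:(lra)).
eapply Rle_trans; [apply (Cmod_dist_triangle _ _ (F z))|lra].
Qed.

Lemma is_linear_pop M b : is_linear (pop M b S0).
Proof.
split.
- intros x y; unfold pop; rewrite <- vsum_plus; apply vsum_ext; intros k _.
  rewrite (linear_plus _ (is_linear_iter S0 k S_lin)); apply scal_plus.
- intros c x; unfold pop; etransitivity; [|apply vsum_scal_l]; apply vsum_ext; intros k _.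
  rewrite (linear_scal _ (is_linear_iter S0 k S_lin)).
  etransitivity; [apply scal_CC|]; etransitivity; [|symmetry; apply scal_CC].
  f_equal; apply Cmult_comm.
- exists (1 + rsum (fun k => Cmod (b k)) M); split.
  + assert (Z : 0 <= rsum (fun k => Cmod (b k)) M) by (apply rsum_nonneg; intros; apply Cmod_ge_0); lra.
  + intros x; assert (X0 := norm_ge_0 x).
    apply Rle_trans with (rsum (fun k => Cmod (b k)) M * norm x); [|nra].
    unfold pop; eapply Rle_trans; [apply norm_vsum_le|].
    rewrite Rmult_comm, <- rsum_mult_l; apply rsum_le; intros k _.
    rewrite norm_scal_C, Rmult_comm; apply Rmult_le_compat_r; [apply Cmod_ge_0|].
    assert (I := norm_iter_le S0 1 k x ltac:(lra)).
    rewrite pow1, Rmult_1_l in I; apply I; intros y; rewrite Rmult_1_l; apply S_contr.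
Qed.

Lemma fcalc_exists : exists A : H -> H, is_fcalc F S0 A.
Proof.
assert (Ex : forall x, exists l : H, forall eps, 0 < eps -> exists i0, forall i, (i0 <= i)%nat ->
   norm (minus (pop (N i) (a i) S0 x) l) <= eps).
{ intros x; apply cauchy_limit; intros eps He; assert (X0 := norm_ge_0 x).
  destruct (pop_cauchy (eps / (1 + norm x))) as [i0 H0]; [apply Rdiv_lt_0_compat; lra|].
  exists i0; intros i j Hi Hj; eapply Rle_trans; [now apply H0|].
  apply Rle_trans with (eps / (1 + norm x) * (1 + norm x)).
  - apply Rmult_le_compat_l; [|lra]; left; apply Rdiv_lt_0_compat; lra.
  - right; field; lra. }
set (A := fun x => epsilon (inhabits (zero : H)) (fun l : H => forall eps, 0 < eps ->
   exists i0, forall i, (i0 <= i)%nat -> norm (minus (pop (N i) (a i) S0 x) l) <= eps)).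
assert (HA : forall x eps, 0 < eps -> exists i0, forall i, (i0 <= i)%nat ->
   norm (minus (pop (N i) (a i) S0 x) (A x)) <= eps).
{ intros x; exact (epsilon_spec (inhabits (zero : H)) _ (Ex x)). }
clearbody A.
assert (Hunif : forall eps, 0 < eps -> exists i0, forall i, (i0 <= i)%nat -> forall x,
   norm (minus (pop (N i) (a i) S0 x) (A x)) <= eps * norm x).
{ intros eps He; destruct (pop_cauchy eps He) as [i0 H0]; exists i0; intros i Hi x.
  apply le_epsilon; intros e He'; destruct (HA x e He') as [i1 H1].
  set (j := Nat.max i0 i1).
  assert (E1 := H1 j ltac:(lia)); assert (E2 := H0 i j Hi ltac:(lia) x).
  assert (T := norm_minus_triangle (pop (N i) (a i) S0 x) (pop (N j) (a j) S0 x) (A x)); lra. }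
exists A; split.
- apply (is_linear_pointwise_limit (fun i => pop (N i) (a i) S0)); [intros; apply is_linear_pop|exact HA|].
  destruct (Hunif 1 Rlt_0_1) as [i Hi].
    destruct (linear_norm _ (is_linear_pop (N i) (a i))) as [K [K0 HK]].
    exists (K + 1); split; [lra|]; intros x.
    assert (E1 := Hi i (le_n _) x); assert (E2 := HK x).
    assert (T := norm_le_plus_minus (A x) (pop (N i) (a i) S0 x)).
    rewrite norm_minus_sym in T; lra.
- exists (fun i => {| Defs.bound := N i; coef := a i |}); split.
  + intros eps; destruct (F_lim eps (cond_pos eps)) as [i0 H0]; exists i0; intros i Hi z Hz.
    exact (H0 i Hi z Hz).
  + intros eps; destruct (Hunif eps (cond_pos eps)) as [i0 H0]; exists i0; intros i Hi.
    apply op_norm_le; intros x Hx; eapply Rle_trans; [exact (H0 i Hi x)|].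
    assert (P := cond_pos eps); assert (X0 := norm_ge_0 x); nra.
Qed.

(** The polynomials [p] that witness the chosen value of [fcalc] are unrelated to the given ones;
    von Neumann's inequality compares both through [F] on the circle, so the error [eps] on the disk
    passes to the operators without loss. *)
Lemma fcalc_approximation eps i : 0 < eps ->
  (forall z, Cmod z <= 1 -> Cmod (pev (N i) (a i) z - F z)%C <= eps) ->
  forall x, norm x <= 1 -> norm (minus (pop (N i) (a i) S0 x) (fcalc F S0 x)) <= eps.
Proof.
intros He HF x Hx.
assert (Sp := epsilon_spec (inhabits (fun _ : H => zero)) _ fcalc_exists).
fold (fcalc F S0) in Sp; destruct Sp as [_ [p [Hp1 Hp2]]].
apply le_epsilon; intros e He'.
assert (He2 : 0 < e / 2) by lra.
destruct (Hp1 (mkposreal _ He2)) as [n1 H1]; destruct (Hp2 (mkposreal _ He2)) as [n2 H2].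
simpl in H1, H2; set (n := Nat.max n1 n2).
assert (E1 := H1 n ltac:(lia)); assert (E2 := H2 n ltac:(lia)).
assert (E3 := proj1 (op_norm_le _ _) E2 x Hx).
assert (E4 : norm (minus (pop (N i) (a i) S0 x) (pop (Defs.bound (p n)) (coef (p n)) S0 x))
   <= (eps + e / 2) * norm x).
{ apply von_neumann_minus; [exact S_lin|exact S_contr|]; intros z Hz.
  assert (Hz1 : Cmod z <= 1) by (unfold circle in Hz; lra).
  assert (E5 := HF z Hz1); assert (E6 := E1 z Hz1).
  change (poly_eval (p n) z) with (pev (Defs.bound (p n)) (coef (p n)) z) in E6.
  eapply Rle_trans; [apply (Cmod_dist_triangle _ _ (F z))|lra]. }
assert (X0 := norm_ge_0 x).
assert (T := norm_minus_triangle (pop (N i) (a i) S0 x)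
   (pop (Defs.bound (p n)) (coef (p n)) S0 x) (fcalc F S0 x)).
change (norm (minus (pop (Defs.bound (p n)) (coef (p n)) S0 x) (fcalc F S0 x)) <= e / 2) in E3.
nra.
Qed.

End Calculus.

(** The supremum excludes [tau = 1]; there both sides vanish, because the order of the difference is
    at least 1 and [nnpow 0 al = 0]. *)
Lemma zygmund_difference_bound al f : 0 < al -> Zygmund al f ->
  0 <= real (Zygmund_norm al f) /\
  forall tau z, circle tau -> circle z ->
    Cmod (Nat.iter (zygmund_order al) (Defs.Delta tau) f z)
    <= real (Zygmund_norm al f) * nnpow (Cmod (1 - tau)%C) al.
Proof.
intros Hal [_ Hfin].
set (n := zygmund_order al).
assert (Hub : forall tau z, circle tau -> tau <> RtoC 1 -> circle z ->
  0 < nnpow (Cmod (1 - tau)%C) al /\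
  Cmod (Nat.iter n (Defs.Delta tau) f z) / nnpow (Cmod (1 - tau)%C) al <= real (Zygmund_norm al f)).
{ intros tau z Ht Hn Hz; split.
  - unfold nnpow; destruct (Req_EM_T (Cmod (1 - tau)%C) 0) as [E|E]; [|apply exp_pos].
    apply Cmod_eq_0 in E; exfalso; apply Hn.
    replace tau with (1 - (1 - tau))%C by ring; rewrite E; ring.
  - set (E := fun r : R => exists tau zeta : C, circle tau /\ tau <> RtoC 1 /\ circle zeta /\
      r = Cmod (Nat.iter (zygmund_order al) (Defs.Delta tau) f zeta) / nnpow (Cmod (1 - tau)%C) al).
    assert (U := proj1 (Lub_Rbar_correct E) (Cmod (Nat.iter n (Defs.Delta tau) f z) / nnpow (Cmod (1 - tau)%C) al)).
    assert (U' := U ltac:(exists tau, z; repeat split; assumption)).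
    change (Lub_Rbar E) with (Zygmund_norm al f) in U'.
    rewrite <- Hfin in U'; exact U'. }
split.
- destruct (Hub (- RtoC 1)%C (RtoC 1)) as [P Q].
  + unfold circle; apply Cmod_m1.
  + intros E; apply (f_equal fst) in E; simpl in E; lra.
  + unfold circle; apply Cmod_1.
  + eapply Rle_trans; [|exact Q]; apply Rmult_le_pos; [apply Cmod_ge_0|left; now apply Rinv_0_lt_compat].
- intros tau z Ht Hz; destruct (Ceq_dec tau 1) as [->|Hn].
  + assert (Hn1 : exists k, n = S k).
    { assert (Sp := zygmund_order_spec al Hal); fold n in Sp; destruct n as [|k]; [simpl in Sp; lra|].
      now exists k. }
    destruct Hn1 as [k ->]; simpl; unfold Defs.Delta at 1; rewrite Cmult_1_l.
    replace (RtoC 1 - RtoC 1)%C with (RtoC 0) by ring.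
    match goal with |- Cmod (?u - ?u)%C <= _ => replace (u - u)%C with (RtoC 0) by ring end.
    rewrite Cmod_0; unfold nnpow; destruct (Req_EM_T 0 0); [lra|congruence].
  + destruct (Hub tau z Ht Hn Hz) as [P Q].
    apply (Rmult_le_compat_r (nnpow (Cmod (1 - tau)%C) al)) in Q; [|lra].
    unfold Rdiv in Q; rewrite Rmult_assoc, Rinv_l, Rmult_1_r in Q by lra; exact Q.
Qed.

Theorem theorem6p3 (m : nat) (alpha : R) (hm : (0 < m)%nat)
    (halpha : 0 < alpha < INR m) :
  exists c : R, 0 < c /\
    forall f : C -> C, Zygmund_plus alpha f ->
    forall (H : HilbertSpace) (T Q : H -> H),
      contraction T -> contraction Q ->
      Rbar_le (op_norm (op_difference m (disk_extension f) T Q))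
              (c * real (Zygmund_norm alpha f)
                 * nnpow (real (op_norm (op_minus T Q))) alpha).
Proof.
destruct (polynomial_zygmund_estimate m alpha hm halpha) as [c [c0 Hc]].
exists c; split; [exact c0|]; intros f [Hz Hneg] H T Q HT HQ.
destruct (zygmund_difference_bound alpha f (proj1 halpha) Hz) as [A0 HA].
assert (Hf : cont_on circle f) by (apply continuous_on_iff; exact (proj1 Hz)).
destruct (contraction_bound T HT) as [T_lin T_contr].
destruct (contraction_bound Q HQ) as [Q_lin Q_contr].
set (A := real (Zygmund_norm alpha f)) in *; set (n := zygmund_order alpha) in *.
assert (Dl : is_linear (op_minus T Q)) by (apply op_minus_linear; assumption).
(* A finite bound is what makes [real (op_norm (op_minus T Q))] the true norm and not a default
   value. *)
assert (Db : forall x, norm x <= 1 -> norm (op_minus T Q x) <= 2).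
{ intros x Hx; eapply Rle_trans; [exact (norm_minus_le (T x) (Q x))|].
  assert (E1 := T_contr x); assert (E2 := Q_contr x); lra. }
assert (Dfin := op_norm_finite _ _ Db).
set (d := real (op_norm (op_minus T Q))) in *.
assert (HD : forall x, norm (minus (Q x) (T x)) <= d * norm x).
{ intros x; eapply Rle_trans; [right; exact (norm_minus_sym (Q x) (T x))|].
  assert (E : Rbar_le (op_norm (op_minus T Q)) (Finite d)) by (rewrite Dfin; apply Rle_refl).
  exact (linear_bound_ball (op_minus T Q) d Dl (proj1 (op_norm_le _ _) E) x). }
assert (d0 : 0 <= d).
{ assert (Z : Rbar_le (op_norm (op_minus T Q)) (Finite d)) by (rewrite Dfin; apply Rle_refl).
  assert (Z' := proj1 (op_norm_le _ _) Z zero).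
  apply Rle_trans with (norm (op_minus T Q zero)); [apply norm_ge_0|apply Z'].
  eapply Rle_trans; [right; exact (norm_zero (K := C_AbsRing) (V := H))|lra]. }
apply op_norm_le; intros x Hx.
change (op_difference m (disk_extension f) T Q x)
  with (vdiff m (fun k => fcalc (disk_extension f) (op_segment T Q (INR k / INR m)) x)).
(* The polynomial estimate requires [d > 0]. For [d = 0] the right side is 0, but then [Q = T] and
   the difference is that of a constant sequence. *)
unfold nnpow; destruct (Req_EM_T d 0) as [Ed|Ed].
- assert (ES : forall t, op_segment T Q t = T).
  { intros t; apply functional_extensionality; intros y; unfold op_segment.
    assert (E : Q y = T y).
    { apply (norm_eq_minus (V := H)); assert (E := HD y); rewrite Ed, Rmult_0_l in E.
      apply Rle_antisym; [exact E|apply norm_ge_0]. }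
    rewrite E; unfold minus.
    etransitivity; [apply (f_equal (fun z : H => plus (T y) (scal (RtoC t) z))), (plus_opp_r (G := H))|].
    etransitivity; [apply (f_equal (plus (T y))), (@scal_zero_r C_Ring H)|].
    apply (plus_zero_r (G := H)). }
  rewrite Rmult_0_r.
  replace (vdiff m (fun k => fcalc (disk_extension f) (op_segment T Q (INR k / INR m)) x))
    with (vdiff m (fun _ => fcalc (disk_extension f) T x))
    by (unfold vdiff; apply vsum_ext; intros k _; now rewrite ES).
  right; etransitivity; [exact (f_equal norm (vdiff_const m _ hm))|].
  exact (norm_zero (K := C_AbsRing) (V := H)).
- assert (Hd : 0 < d) by lra.
  set (a := fun M => epsilon (inhabits (fun _ : nat => RtoC 0))
    (fun b => forall z, circle z -> fejer M f z = pev M b z)).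
  assert (Ha : forall M z, circle z -> fejer M f z = pev M (a M) z).
  { intros M; exact (epsilon_spec (inhabits (fun _ : nat => RtoC 0)) _ (fejer_polynomial M f Hf Hneg)). }
  clearbody a.
  assert (Hlim := disk_extension_uniform (fun i => i) a f Hf).
  assert (Hlim' : forall eps, 0 < eps -> exists i0, forall i, (i0 <= i)%nat ->
     forall z, Cmod z <= 1 -> Cmod (pev i (a i) z - disk_extension f z)%C <= eps).
  { apply Hlim; intros eps He; destruct (fejer_convergence f Hf eps He) as [i0 H0].
    exists i0; intros i Hi z Hzc; rewrite <- Ha by exact Hzc; now apply H0. }
  apply le_epsilon; intros eps He.
  assert (M0 := alt_mass_nonneg m).
  (* Replacing [fcalc] by a polynomial at each of the nodes costs [alt_mass m * e] in the [m]-th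
     difference. *)
  set (e := eps / (1 + alt_mass m)).
  assert (He' : 0 < e) by (apply Rdiv_lt_0_compat; lra).
  destruct (Hlim' e He') as [i Hi]; specialize (Hi i (le_n _)).
  assert (E1 := Hc n i (a i) A (fejer_zygmund i f n alpha A (a i) Hf (Ha i) HA) A0
    H T Q T_lin Q_lin T_contr Q_contr d Hd HD x).
  set (h1 := fun k => pop i (a i) (op_segment T Q (INR k / INR m)) x) in *.
  set (h2 := fun k => fcalc (disk_extension f) (op_segment T Q (INR k / INR m)) x).
  assert (E2 : norm (vdiff m (fun k => minus (h1 k) (h2 k))) <= alt_mass m * e).
  { apply vdiff_bound; intros k Hk.
    apply (fcalc_approximation _ (op_segment_linear T Q T_lin Q_lin T_contr Q_contr _)
      (fun y => op_segment_contr T Q T_contr Q_contr _ y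
         (fraction_unit k m hm Hk)) (fun i => i) a _ Hlim' e i He' Hi x Hx). }
  assert (T1 := norm_le_plus_minus (vdiff m h2) (vdiff m h1)).
  rewrite norm_minus_sym, <- vdiff_minus in T1.
  assert (Ee : alt_mass m * e <= eps).
  { apply Rle_trans with ((1 + alt_mass m) * e); [nra|right; unfold e; field; lra]. }
  assert (X0 := norm_ge_0 x).
  assert (E3 : c * A * Rpower d alpha * norm x <= c * A * Rpower d alpha).
  { rewrite <- (Rmult_1_r (c * A * Rpower d alpha)) at 2; apply Rmult_le_compat_l; [|exact Hx].
    apply Rmult_le_pos; [apply Rmult_le_pos; lra|left; apply exp_pos]. }
  lra.
Qed.
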